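(* Let $a=A(G)$ be a random coefficient field on $\mathbb{R}^d$ distributed according to the ensemble $\langle\cdot\rangle$ described in the context, let $g(x)=R^{-d}\eta(x/R)$ with $R>0$ and $\eta\in C_c^\infty(B_1)$, let $1\le n\le\tilde d$ and $1\le i,j\le d$, and set $$F^{o,n}_{ij}:=\int_{\mathbb{R}^d}g(x)\,\Xi^{o,n}_{ij}(x)\,dx ,$$ where $\Xi^{o,n}_{ij}$ is the standard homogenization commutator defined in the context. Then the functional derivative of $F^{o,n}_{ij}$ with respect to $a$ is given by $$\frac{\partial F^{o,n}_{ij}}{\partial a}=(\nabla\phi^1_i+e_i)\otimes\Big(\sum_{k=0}^{n}\partial^k_{i_1\dots i_k}g\,\big(\nabla\phi^{*,k+1}_{ji_1\dots i_k}+e_{i_k}\phi^{*,k}_{ji_1\dots i_{k-1}}\big)+\nabla h_j\Big),$$ where $h_j$ is the solution (with $\nabla h_j\in L^2(\mathbb{R}^d)^d$) of $$-\nabla\cdot a^*\nabla h_j=\nabla\cdot\Big(\big(a^*\phi^{*,n}_{ji_1\dots i_{n-1}}-\sigma^{*,n}_{ji_1\dots i_{n-1}}\big)\nabla\partial^{n-1}_{i_1\dots i_{n-1}}g\Big)\quad\text{in }\mathbb{R}^d .$$ In the sum, by convention, the $k=0$ term is $g\,(\nabla\phi^{*,1}_j+e_j)$ and the $k=n$ term is $\partial^n_{i_1\dots i_n}g\;e_{i_n}\phi^{*,n}_{ji_1\dots i_{n-1}}$.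
   Context: **Ensemble.** Fix $\lambda>0$ and let $\mathbb{R}^{d\times d}_\lambda$ be the set of (not necessarily symmetric) matrices $M$ with $\xi\cdot M\xi\ge\lambda|\xi|^2$ and $\xi\cdot M^{-1}\xi\ge|\xi|^2$ for all $\xi\in\mathbb{R}^d$. Let $G$ be a stationary, centered Gaussian scalar field on $\mathbb{R}^d$ with covariance function $c(x)=\langle G(x)G(0)\rangle$ satisfying $$|c(x)|\le \frac{C_0}{(1+|x|)^{d+\alpha_0}},\qquad \mathcal{F}c(k)\le\frac{C_1}{(1+|k|)^{d+2\alpha_1}},$$ for constants $0<\alpha_0\le\frac d2$, $\alpha_1\in(0,1)$, $C_0,C_1>0$, where $\mathcal{F}c\ge 0$ is the Fourier transform of $c$. Let $A:\mathbb{R}\to\mathbb{R}^{d\times d}_\lambda$ be Lipschitz and $a(x):=A(G(x))$. The symbol $\langle\cdot\rangle$ denotes expectation. $a^*$ is the pointwise transpose of $a$. Repeated indices are summed (Einstein convention). **Higher-order correctors.** Let $\tilde d$ be the smallest integer with $\tilde d\ge\frac d2$. The correctors $(\phi^n)_{0\le n\le\tilde d}$, flux correctors $(\sigma^n)_{0\le n\le\tilde d}$ and effective coefficients $(\bar a^n)_{1\le n\le\tilde d}$ are defined inductively: - $\phi^0:=1$, and for $1\le n\le\tilde d$, $\phi^n=(\phi^n_{i_1\dots i_n})_{1\le i_1,\dots,i_n\le d}$ with scalar fields satisfying $-\nabla\cdot a\nabla\phi^n_{i_1\dots i_n}=\nabla\cdot\big((a\phi^{n-1}_{i_1\dots i_{n-1}}-\sigma^{n-1}_{i_1\dots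 i_{n-1}})e_{i_n}\big)$ in $\mathbb{R}^d$, with $\nabla\phi^n_{i_1\dots i_n}$ stationary, centered, with finite second moments. - $\bar a^n=(\bar a^n_{i_1\dots i_{n-1}})$ with matrices given by $\bar a^n_{i_1\dots i_{n-1}}e_{i_n}:=\big\langle a(\nabla\phi^n_{i_1\dots i_n}+\phi^{n-1}_{i_1\dots i_{n-1}}e_{i_n})\big\rangle$. - $\sigma^0:=0$, and for $1\le n\le\tilde d$, $\sigma^n=(\sigma^n_{i_1\dots i_n})$ with skew-symmetric matrix fields satisfying $\nabla\cdot\sigma^n_{i_1\dots i_n}=a\nabla\phi^n_{i_1\dots i_n}+(a\phi^{n-1}_{i_1\dots i_{n-1}}-\sigma^{n-1}_{i_1\dots i_{n-1}})e_{i_n}-\bar a^n_{i_1\dots i_{n-1}}e_{i_n}$, with $\nabla\sigma^n_{i_1\dots i_n}$ stationary, centered, with finite second moments; here $(\nabla\cdot\sigma)_j=\sum_k\partial_k\sigma_{jk}$. It is known that these objects exist in this setting and can be chosen so that $\nabla\phi^n$, $\phi^n(x)$, $\sigma^n(x)$ have finite moments of every order, bounded locally uniformly in $x$; such a choice is fixed. Objects with superscript $*$ ($\phi^{*,n},\sigma^{*,n},\bar a^{*,n}$) are the corresponding objects with $a$ replaced by $a^*$. **Standard homogenization commutator.** For $1\le i,j\le d$ and $1\le n\le\tilde d$, $$\Xi^{o,n}_{ij}:=e_j\cdot(a-\bar a^1)(\nabla\phi^1_i+e_i)-\sum_{k=2}^n(-1)^{k-1}\,\bar a^{*,k}_{ji_1\dots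 i_{k-2}}e_{i_{k-1}}\cdot\partial^{k-1}_{i_1\dots i_{k-1}}\nabla\phi^1_i,$$ where the sum is empty for $n=1$, and the derivatives are understood in the distributional sense (when tested against $g$, they are moved onto $g$ by integration by parts). **Functional derivative.** For a functional $F=F(a)$, the random tensor field $\frac{\partial F}{\partial a(x)}$ is defined (almost surely) by $$\lim_{t\to0}\frac{F(a+t\,\delta a)-F(a)}{t}=\int\frac{\partial F}{\partial a(x)}:\delta a(x)\,dx$$ for bounded, compactly supported matrix-valued perturbations $\delta a$. Here the deterministic coefficients $\bar a^1,\bar a^{*,k}$ are kept fixed, and $\nabla\phi^1_i(a+t\delta a):=\nabla\phi^1_i(a)+\nabla\psi_i$, with $\psi_i$ the Lax–Milgram solution ($\nabla\psi_i\in L^2$) of $-\nabla\cdot(a+t\delta a)\nabla\psi_i=\nabla\cdot\big(t\,\delta a(\nabla\phi^1_i(a)+e_i)\big)$. The tensor product is paired with matrices through the convention $(u\otimes v):M:=v\cdot Mu$ for $u,v\in\mathbb{R}^d$, $M\in\mathbb{R}^{d\times d}$. *)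

(* Defs.v *)
(* Points and vectors of R^d are column vectors
   'cV[R]_d; multi-indices i_1 ... i_n are sequences [:: i_1; ...; i_n] over
   'I_d, so that a tensor of order n is evaluated at sequences of size n. *)
From HB Require Import structures.
From mathcomp Require Import all_boot all_order all_algebra.
From mathcomp Require Import all_classical all_reals all_analysis.
From mathcomp Require Import complex.
Set Implicit Arguments. Unset Strict Implicit. Unset Printing Implicit Defensive.
Import Order.TTheory GRing.Theory Num.Theory.
Import numFieldNormedType.Exports.
Local Open Scope classical_set_scope.
Local Open Scope ring_scope.

(* Borel sigma-algebra of R^d, generated by the coordinates. *)
Definition cV_display : measure_display. Proof. exact. Qed.

Section measurable_cV.
Context {R : realType} {d : nat}.

Let coord (i : 'I_d) (x : 'cV[R]_d) : measurableTypeR R := x i 0.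

Let cV_set0 : g_sigma_preimage coord set0.
Proof. exact: sigma_algebra0. Qed.

Let cV_setC A : g_sigma_preimage coord A -> g_sigma_preimage coord (~` A).
Proof. exact: sigma_algebraC. Qed.

Let cV_bigcup (F : (set 'cV[R]_d)^nat) : (forall i, g_sigma_preimage coord (F i)) ->
  g_sigma_preimage coord (\bigcup_i (F i)).
Proof. exact: sigma_algebra_bigcup. Qed.

HB.instance Definition _ := @isMeasurable.Build cV_display
  'cV[R]_d (g_sigma_preimage coord) cV_set0 cV_setC cV_bigcup.

Lemma measurable_coord (i : 'I_d) :
  measurable_fun [set: 'cV[R]_d] (fun x => x i 0).
Proof.
move=> _ Y mY; rewrite setTI; apply: sub_sigma_algebra => /=.
rewrite -bigcup_seq/=; exists i => /=; first by rewrite mem_index_enum.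
by exists Y => //; rewrite setTI.
Qed.

Lemma measurable_fun_cV dT (T : measurableType dT) (f : T -> 'cV[R]_d) :
  (forall i, measurable_fun setT (fun t => f t i 0)) -> measurable_fun setT f.
Proof.
move=> mf _ A mA; rewrite setTI.
suff: g_sigma_preimage (fun i => @coord i \o f) `<=` measurable.
  by apply; rewrite g_sigma_preimage_comp; exists A => //; rewrite setTI.
apply: smallest_sub; first exact: sigma_algebra_measurable.
rewrite -bigcup_seq; apply: bigcup_sub => i _ _ [B mB <-].
exact: mf.
Qed.

End measurable_cV.


Section lebesgue.
Context {R : realType}.

Definition vcons {d} (p : measurableTypeR R * 'cV[R]_d) : 'cV[R]_d.+1 :=
  \col_i oapp (fun j => p.2 j 0) p.1 (unlift ord0 i).

Definition vuncons {d} (x : 'cV[R]_d.+1) : measurableTypeR R * 'cV[R]_d :=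
  (x ord0 0, \col_j x (lift ord0 j) 0).

Lemma vconsK d : cancel (@vcons d) vuncons.
Proof.
move=> [t v]; congr pair; first by rewrite mxE unlift_none.
by apply/colP => j; rewrite !mxE liftK.
Qed.

Lemma measurable_vcons d : measurable_fun setT (@vcons d).
Proof.
apply: measurable_fun_cV => i; case: (unliftP ord0 i) => [j|] ->.
- rewrite (_ : (fun _ => _) = (fun x : 'cV[R]_d => x j 0) \o snd).
    by apply: measurableT_comp => //; exact: measurable_coord.
  by apply/funext => p; rewrite mxE liftK.
- rewrite (_ : (fun _ => _) = fst) //.
  by apply/funext => p; rewrite mxE unlift_none.
Qed.

Lemma measurable_vuncons d : measurable_fun setT (@vuncons d).
Proof.
apply/measurable_fun_pairP; split.
  exact: measurable_coord.
by apply: measurable_fun_cV => j; under eq_fun do rewrite mxE; exact: measurable_coord.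
Qed.

Section lebesgueS.
Context {d : nat}.
Variable m : {sigma_finite_measure set 'cV[R]_d -> \bar R}.
Local Open Scope ereal_scope.

Definition lebesgueS : set 'cV[R]_d.+1 -> \bar R :=
  pushforward (lebesgue_measure \x m) vcons.

Let lebesgueS0 : lebesgueS set0 = 0.
Proof. by rewrite /lebesgueS /pushforward preimage_set0 measure0. Qed.

Let lebesgueS_ge0 A : 0 <= lebesgueS A.
Proof. by rewrite /lebesgueS /pushforward; exact: measure_ge0. Qed.

Let lebesgueS_sigma_additive : semi_sigma_additive lebesgueS.
Proof.
move=> F mF tF mUF; rewrite /lebesgueS /pushforward preimage_bigcup.
have mvF n : measurable (@vcons d @^-1` F n).
  by rewrite -[X in measurable X]setTI; exact: measurable_vcons.
apply: measure_semi_sigma_additive => //.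
- apply/trivIsetP => /= i j _ _ ij; rewrite -preimage_setI.
  by move/trivIsetP : tF => /(_ _ _ _ _ ij) ->//; rewrite preimage_set0.
- exact: bigcup_measurable.
Qed.

HB.instance Definition _ := isMeasure.Build _ _ _ lebesgueS
  lebesgueS0 lebesgueS_ge0 lebesgueS_sigma_additive.

Let lebesgueS_sigma_finite : sigma_finite setT lebesgueS.
Proof.

have /sigma_finiteP[F [TF ndF Foo]] :=
  sigma_finiteT (@lebesgue_measure R : {sigma_finite_measure set _ -> \bar R}).
have /sigma_finiteP[K [TK ndK Koo]] := sigma_finiteT m.
exists (fun n => vuncons @^-1` (F n `*` K n)).
  rewrite -preimage_bigcup (_ : \bigcup_i _ = setT) ?preimage_setT//.
  rewrite -setXTT TF TK predeqE => -[x y]; split => [[n _ []/= ? ?]|].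
    by split; exists n.
  move=> [/= [n _ Fnx] [k _ Kky]]; exists (maxn n k) => //; split.
  - by move: x Fnx; exact/subsetPset/ndF/leq_maxl.
  - by move: y Kky; exact/subsetPset/ndK/leq_maxr.
move=> n; have [mF Fn] := Foo n; have [mK Kn] := Koo n; split.
  by rewrite -[X in measurable X]setTI; apply: measurable_vuncons => //; exact: measurableX.
rewrite /lebesgueS /pushforward -comp_preimage (_ : _ \o _ = id).
  by rewrite preimage_id product_measure1E// lte_mul_pinfty// ge0_fin_numE.
by apply/funext => x; exact: vconsK.
Qed.

HB.instance Definition _ := Measure_isSigmaFinite.Build _ _ _ lebesgueS
  lebesgueS_sigma_finite.
End lebesgueS.

(* Lebesgue measure on R^d; [lebesgue_cV_box] characterizes it on boxes. *)
Fixpoint lebesgue_cV (d : nat) : {sigma_finite_measure set 'cV[R]_d -> \bar R} :=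
  match d with
  | 0 => dirac (0 : 'cV[R]_0)
  | d'.+1 => lebesgueS (lebesgue_cV d')
  end.

Lemma lebesgue_cV_box (d : nat) (A : 'I_d -> set (measurableTypeR R)) :
  (forall i, measurable (A i)) ->
  lebesgue_cV d [set x | forall i, A i (x i 0)] =
    (\prod_(i < d) lebesgue_measure (A i))%E.
Proof.
elim: d A => [|d IH] A mA.
  rewrite big_ord0 /= diracE mem_set //=; by case.
rewrite big_ord_recl -IH //= /lebesgueS /pushforward.
rewrite (_ : _ @^-1` _ =
    A ord0 `*` [set x : 'cV[R]_d | forall i, A (lift ord0 i) (x i 0)]).
  rewrite product_measure1E //.
  rewrite (_ : [set _ | _] = \bigcap_(i in setT) ((fun x : 'cV[R]_d => x i 0) @^-1` A (lift ord0 i))).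
    apply: fin_bigcap_measurable => // i _.
    have := @measurable_coord R d i measurableT (A (lift ord0 i)) (mA _).
    rewrite setTI. exact.
  by apply/seteqP; split => [x Ax i _|x Ax i]; apply: Ax.
apply/seteqP; split => [[t v] /= H|[t v] [/= At Av] i].
- split; first by have := H ord0; rewrite mxE unlift_none.
  by move=> i; have := H (lift ord0 i); rewrite mxE liftK.
- by rewrite mxE; case: unliftP => [j|] -> /=.
Qed.
End lebesgue.

Section vectors.
Context {R : realType} {d : nat}.
Implicit Types (u v x xi : 'cV[R]_d) (M T : 'M[R]_d).

Definition dot u v : R := \sum_(i < d) u i 0 * v i 0.

Definition enorm u : R := Num.sqrt (dot u u).

Definition bvec (i : 'I_d) : 'cV[R]_d := delta_mx i 0.

Definition eball (r : R) : set 'cV[R]_d := [set x | enorm x < r].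

Definition tens u v : 'M[R]_d := u *m v^T.

(* Pairing T : M with the index convention fixed by [ddot_tens]. *)
Definition ddot T M : R := \tr (T *m M).

Lemma ddot_tens u v M : ddot (tens u v) M = dot v (M *m u).
Proof.
rewrite /ddot /tens -mulmxA mxtrace_mulC trace_mx11 -mulmxA mxE.
by apply: eq_bigr => i _; rewrite mxE.
Qed.

Definition elliptic (lambda : R) M : Prop :=
  forall xi, lambda * enorm xi ^+ 2 <= dot xi (M *m xi) /\
             enorm xi ^+ 2 <= dot xi (invmx M *m xi).

End vectors.

Section calculus.
Context {R : realType} {d : nat}.
Local Notation E := 'cV[R]_d.
Local Notation mu := (lebesgue_cV d).
Implicit Types (f g v u : E -> R) (F Du : E -> E) (b : E -> 'M[R]_d).

Definition pderiv (i : 'I_d) f : E -> R := fun x => 'D_(bvec i) f x.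

Definition pderivs (s : seq 'I_d) f : E -> R := foldr pderiv f s.

Definition grad f : E -> E := fun x => \col_i pderiv i f x.

Definition smooth f : Prop := forall s : seq 'I_d,
  continuous (pderivs s f) /\ forall i x, derivable (pderivs s f) x (bvec i).

Definition support {V : nmodType} (f : E -> V) : set E :=
  closure [set x | f x <> 0].

Definition Ccinfty (D : set E) f : Prop :=
  [/\ smooth f, compact (support f) & support f `<=` D].

Definition L2loc f : Prop := measurable_fun setT f /\
  forall r : R, (\int[mu]_(x in eball r) ((f x) ^+ 2)%:E < +oo)%E.

Definition L2 f : Prop := measurable_fun setT f /\
  (\int[mu]_x ((f x) ^+ 2)%:E < +oo)%E.

(* u is in H^1_loc and Du is (a representative of) its weak gradient. *)
Definition H1loc u Du : Prop :=
  [/\ L2loc u, forall i, L2loc (fun x => Du x i 0) &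
      forall v i, Ccinfty setT v ->
        \int[mu]_x (u x * pderiv i v x) = - \int[mu]_x (Du x i 0 * v x)].

Definition dotH1 u Du : Prop :=
  H1loc u Du /\ forall i, L2 (fun x => Du x i 0).

(* Distributional form of -div (b Du) = div F. *)
Definition weak_eq b Du F : Prop := forall v, Ccinfty setT v ->
  \int[mu]_x dot (grad v x) (b x *m Du x) = - \int[mu]_x dot (grad v x) (F x).

(* Solution u, with gradient Du in L^2, of -div (b Du) = div F on R^d, in the
   variational form of the Lax-Milgram theorem on the homogeneous Sobolev space
   {v | grad v in L^2}. *)
Definition lax_milgram b F u Du : Prop := dotH1 u Du /\
  forall v Dv, dotH1 v Dv ->
  \int[mu]_x dot (Dv x) (b x *m Du x) = - \int[mu]_x dot (Dv x) (F x).

(* The distribution d^s f tested against g. *)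
Definition dist_pderivs (s : seq 'I_d) f g : R :=
  (-1) ^+ size s * \int[mu]_x (f x * pderivs s g x).

Definition fourier (c : E -> R) (k : E) : R[i]%C :=
  ((\int[mu]_x (c x * cos (dot k x))) +i*
   (- \int[mu]_x (c x * sin (dot k x))))%C.

End calculus.

Section ensemble.
Context {R : realType} {d : nat} {dT : measure_display} {T : measurableType dT}.
Variable P : probability T R.
Local Notation E := 'cV[R]_d.
Local Notation mu := (lebesgue_cV d).
Implicit Types (G Y : T -> E -> R).

Definition random_field Y : Prop :=
  measurable_fun [set: T * E] (fun p => Y p.1 p.2).

(* Degenerate Gaussian laws (s = 0) are Dirac masses. *)
Definition gaussian_rv (X : T -> R) : Prop := exists m s : R,
  forall B : set (measurableTypeR R), measurable B ->
    P (X @^-1` B) = if s == 0 then dirac m B else normal_prob m s B.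

Definition gaussian_field G : Prop :=
  forall (n : nat) (x : 'I_n -> E) (c : 'I_n -> R),
    gaussian_rv (fun w => \sum_(k < n) c k * G w (x k)).

Definition stationary_law G : Prop :=
  forall (n : nat) (x : 'I_n -> E) (z : E) (B : 'I_n -> set (measurableTypeR R)),
    (forall k, measurable (B k)) ->
    P [set w | forall k, B k (G w (x k + z))] =
    P [set w | forall k, B k (G w (x k))].

Definition covariance_fun G : E -> R := fun x => \int[P]_w (G w x * G w 0).

Record gaussian_ensemble (C0 C1 alpha0 alpha1 : R) G : Prop := {
  ge_field : random_field G;
  ge_gaussian : gaussian_field G;
  ge_stationary : stationary_law G;
  ge_centered : forall x, \int[P]_w G w x = 0;
  ge_decay : forall x, `|covariance_fun G x|
    <= C0 / (1 + enorm x) `^ (d%:R + alpha0);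
  ge_fourier_ge0 : forall k, 0 <= fourier (covariance_fun G) k;
  ge_fourier_decay : forall k, fourier (covariance_fun G) k
    <= (C1 / (1 + enorm k) `^ (d%:R + 2 * alpha1))%:C%C;
}.

Definition cylinder_measurable (f : (E -> R) -> R) : Prop :=
  forall B : set (measurableTypeR R), measurable B ->
    <<s [set A : set (E -> R) | exists (x : E) (B' : set (measurableTypeR R)),
           measurable B' /\ A = [set w | B' (w x)]] >> (f @^-1` B).

(* Stationary random fields are shift-covariant functionals of the realization
   of the underlying field G: Y(x) = f(G(x + .)). *)
Definition stationary G Y : Prop := random_field Y /\
  exists f, cylinder_measurable f /\
    {ae mu, forall x, {ae P, forall w, Y w x = f (fun y => G w (x + y))}}.

Definition centered Y : Prop := {ae mu, forall x, \int[P]_w Y w x = 0}.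

Definition second_moments Y : Prop :=
  {ae mu, forall x, (\int[P]_w ((Y w x) ^+ 2)%:E < +oo)%E}.

Definition all_moments_loc Y : Prop := forall (p : nat) (r : R), exists K : R,
  {ae mu, forall x, enorm x <= r -> (\int[P]_w (`|Y w x| ^+ p)%:E <= K%:E)%E}.

Definition stationary_centered_L2 G (F : T -> E -> E) : Prop := forall l : 'I_d,
  let Y := fun w x => F w x l 0 in
  [/\ stationary G Y, centered Y & second_moments Y].

End ensemble.

Section correctors.
Context {R : realType} {d : nat} {dT : measure_display} {T : measurableType dT}.
Local Notation E := 'cV[R]_d.
Local Notation mu := (lebesgue_cV d).

Record corrector_data := CorrectorData {
  phi : seq 'I_d -> T -> E -> R;
  grad_phi : seq 'I_d -> T -> E -> E;
  sigma : seq 'I_d -> T -> E -> 'M[R]_d;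
  grad_sigma : seq 'I_d -> T -> E -> 'I_d -> 'I_d -> E;
  abar : seq 'I_d -> 'M[R]_d
}.

(* With s = i_1 ... i_(n-1) and k = i_n, [rcons s k] is i_1 ... i_n.
   [abar K s] is the coefficient of order n = (size s).+1. *)
Definition corrector_source (a : T -> E -> 'M[R]_d) (K : corrector_data)
    (s : seq 'I_d) (k : 'I_d) (w : T) (x : E) : E :=
  (phi K s w x *: a w x - sigma K s w x) *m bvec k.

Record corrector_step (P : probability T R) (G : T -> E -> R)
    (a : T -> E -> 'M[R]_d) (K : corrector_data)
    (s : seq 'I_d) (k : 'I_d) : Prop := {
  cs_phi_field : random_field (phi K (rcons s k));
  cs_phi_H1loc :
    {ae P, forall w, H1loc (phi K (rcons s k) w) (grad_phi K (rcons s k) w)};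
  cs_phi_eq :
    {ae P, forall w, weak_eq (a w) (grad_phi K (rcons s k) w)
                       (corrector_source a K s k w)};
  cs_grad_phi : stationary_centered_L2 P G (grad_phi K (rcons s k));
  cs_abar : {ae mu, forall x, forall l : 'I_d,
    (abar K s *m bvec k) l 0 =
    \int[P]_w (a w x *m (grad_phi K (rcons s k) w x
                           + phi K s w x *: bvec k)) l 0};
  cs_sigma_field : forall p q, random_field (fun w x => sigma K (rcons s k) w x p q);
  cs_sigma_skew : forall w x,
    (sigma K (rcons s k) w x)^T = - sigma K (rcons s k) w x;
  cs_sigma_H1loc : forall p q, {ae P, forall w,
    H1loc (fun x => sigma K (rcons s k) w x p q)
          (fun x => grad_sigma K (rcons s k) w x p q)};
  cs_sigma_eq : {ae P, forall w, {ae mu, forall x,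
    (\col_p \sum_(q < d) grad_sigma K (rcons s k) w x p q q 0) =
    a w x *m grad_phi K (rcons s k) w x + corrector_source a K s k w x
      - abar K s *m bvec k}};
  cs_grad_sigma : forall p q,
    stationary_centered_L2 P G (fun w x => grad_sigma K (rcons s k) w x p q);
  cs_phi_moments : all_moments_loc P (phi K (rcons s k));
  cs_grad_phi_moments : forall l,
    all_moments_loc P (fun w x => grad_phi K (rcons s k) w x l 0);
  cs_sigma_moments : forall p q,
    all_moments_loc P (fun w x => sigma K (rcons s k) w x p q)
}.

(* Correctors up to order N. *)
Record correctors (P : probability T R) (G : T -> E -> R)
    (a : T -> E -> 'M[R]_d) (N : nat) (K : corrector_data) : Prop := {
  co_phi0 : forall w x, phi K [::] w x = 1;
  co_sigma0 : forall w x, sigma K [::] w x = 0;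
  co_step : forall s k, (size s < N)%N -> corrector_step P G a K s k
}.

End correctors.
Arguments corrector_data : clear implicits.

Section commutator.
Context {R : realType} {d : nat}.
Local Notation E := 'cV[R]_d.
Local Notation mu := (lebesgue_cV d).

(* The distribution Xi^{o,n}_{ij} tested against g, for the coefficient field b
   and the gradient Dphi of the corresponding first corrector in direction i;
   abar1 and abars are the (fixed) effective coefficients. For
   I = i_1 ... i_(k-1), [belast j I] is j i_1 ... i_(k-2) and [last j I] is
   i_(k-1). *)
Definition commutator (abar1 : 'M[R]_d) (abars : seq 'I_d -> 'M[R]_d)
    (n : nat) (i j : 'I_d) (b : E -> 'M[R]_d) (Dphi : E -> E) (g : E -> R) : R :=
  \int[mu]_x (g x * dot (bvec j) ((b x - abar1) *m (Dphi x + bvec i)))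
  - \sum_(2 <= k < n.+1) (-1) ^+ k.-1 *
      \sum_(I : k.-1.-tuple 'I_d)
        dot (abars (belast j I) *m bvec (last j I))
            (\col_l dist_pderivs I (fun x => Dphi x l 0) g).

Definition admissible (da : E -> 'M[R]_d) : Prop :=
  [/\ forall p q, measurable_fun setT (fun x => da x p q),
      exists K : R, forall x p q, `|da x p q| <= K &
      compact (support da)].

(* D is the functional derivative at a of the functional F. *)
Definition functional_derivative (F : (E -> 'M[R]_d) -> R)
    (a D : E -> 'M[R]_d) : Prop :=
  forall da, admissible da ->
    mu.-integrable setT (EFin \o (fun x => ddot (D x) (da x))) /\
    (fun t : R => (F (fun x => a x + t *: da x) - F a) / t) @ 0^'
      --> \int[mu]_x ddot (D x) (da x).

(* b |-> U b is the gradient of the first corrector in direction i as a function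
   of the coefficient field near a, where it takes the value Dphi. *)
Definition corrector_gradient_map (a : E -> 'M[R]_d) (Dphi : E -> E) (i : 'I_d)
    (U : (E -> 'M[R]_d) -> E -> E) : Prop :=
  U a = Dphi /\
  forall da, admissible da -> \forall t \near (0 : R), exists psi Dpsi,
    lax_milgram (fun x => a x + t *: da x)
      (fun x => (t *: da x) *m (Dphi x + bvec i)) psi Dpsi /\
    U (fun x => a x + t *: da x) = (fun x => Dphi x + Dpsi x).

End commutator.

(* Main.v *)
(* Fix a realization and let u be the two-scale expansion, the sum over k < n of
   phi^*_(j i_1 ... i_k) d^k_(i_1 ... i_k) g. Up to divergences of the skew fields
   d^k g sigma^*_(j i_1 ... i_k), a^T (g e_j + grad u) is the sum of the flux defining h_j, the
   effective fluxes appearing in the commutator, and g (abar^*1 - (abar^1)^T) e_j.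
   Testing the equation of the increment psi_t of the perturbed corrector with
   u + h_j, and that of h_j with psi_t, therefore gives
     F(a + t da) - F(a) = t \int (g e_j + grad u + grad h_j)
                              . da (grad phi + e_i + grad psi_t),
   and grad psi_t is O(t) in L^2 by the energy estimate.

   It remains to see that abar^*1 = (abar^1)^T. This follows from the
   orthogonality in mean of grad phi^* and a (grad phi + e_i). Write both as
   functionals f and h of the translates of G; since f is curl free and h
   divergence free, z |-> sum_l E [f_l (G (z + .)) h_l (G)] is weakly invariant
   under all translations. By density of trigonometric polynomials in L^2 of the
   law of G and the decay of the covariance, it vanishes at infinity; being
   continuous at 0, it vanishes there. *)
Require Import Defs.
From HB Require Import structures.
From mathcomp Require Import all_boot all_order all_algebra.
From mathcomp Require Import all_classical all_reals all_analysis measurable_realfun.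
From mathcomp Require Import ring lra.
Set Implicit Arguments. Unset Strict Implicit. Unset Printing Implicit Defensive.
Import Order.TTheory GRing.Theory Num.Theory.
Import numFieldNormedType.Exports.
Local Open Scope classical_set_scope.
Local Open Scope ring_scope.

(** The equations of the correctors are known against smooth compactly supported functions only,
    whereas psi_t ranges over the whole homogeneous Sobolev space. The orthogonality of a skew
    divergence to grad psi_t is therefore proved by mollifying both factors, which is possible
    because each skew field carries a derivative of g and is thus square integrable together with
    its first derivatives. No bump function is constructed: all mollifiers are rescaled squares of
    eta or of g. If g = 0 the divergences vanish anyway, and abar^*1 = (abar^1)^T enters only
    multiplied by g x.

    The weak invariance comes from the identity d_k sum_l E [f_l (G (z + .)) h_l (G)] = sum_l d_l E
    [f_k (G (z + .)) h_l (G)], valid since f is curl free; by stationarity the derivatives on the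
    right fall on h and form its divergence. Trigonometric polynomials are convenient because, for
    jointly Gaussian centered variables, the characteristic function of a sum differs from the
    product of the characteristic functions by at most the covariance. *)

Lemma eqW (R : numDomainType) (x y : R) : x = y -> x <= y.
Proof. by move=> ->. Qed.

(** * Real-valued integration and square-integrable functions *)

Section integrable_real.
Context {dT : measure_display} {T : measurableType dT} {R : realType}.
Variable mu : {measure set T -> \bar R}.
Implicit Types (f g b : T -> R).

Definition intg f := mu.-integrable setT (EFin \o f).

Lemma intg_meas f : intg f -> measurable_fun setT f.
Proof. by move=> /measurable_int/measurable_EFinP. Qed.

Lemma intg_ext f g : f =1 g -> intg f -> intg g.
Proof. by move=> /funext ->. Qed.

Lemma intgD f g : intg f -> intg g -> intg (fun x => f x + g x).
Proof. by move=> hf hg; apply: eq_integrable (integrableD _ hf hg). Qed.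

Lemma intgB f g : intg f -> intg g -> intg (fun x => f x - g x).
Proof. by move=> hf hg; apply: eq_integrable (integrableB _ hf hg). Qed.

Lemma intgN f : intg f -> intg (fun x => - f x).
Proof. by move=> hf; apply: eq_integrable (integrableN hf). Qed.

Lemma intgZ (k : R) f : intg f -> intg (fun x => k * f x).
Proof. by move=> hf; apply: eq_integrable (integrableZl _ k hf). Qed.

Lemma intg0 : intg (fun=> 0).
Proof. by apply: eq_integrable (integrable0 _ _). Qed.

Lemma intg_sum I (s : seq I) (Q : pred I) (F : I -> T -> R) :
  (forall i, Q i -> intg (F i)) -> intg (fun x => \sum_(i <- s | Q i) F i x).
Proof.
move=> h; elim: s => [|i s ih].
  by apply: intg_ext intg0 => x; rewrite big_nil.
have [Qi|nQi] := boolP (Q i).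
  apply: intg_ext (intgD (h i Qi) ih) => x.
  by rewrite big_cons Qi.
by apply: intg_ext ih => x; rewrite big_cons (negbTE nQi).
Qed.

Lemma intg_dom f g : measurable_fun setT f -> (forall x, `|f x| <= g x) ->
  intg g -> intg f.
Proof.
move=> mf fg ig; apply: le_integrable ig => //; first exact/measurable_EFinP.
by move=> x _ /=; rewrite lee_fin (le_trans (fg x))// ler_norm.
Qed.

Lemma intg_norm f : intg f -> intg (fun x => `|f x|).
Proof. by move=> hf; apply: eq_integrable (integrable_abse hf). Qed.

Lemma intD f g : intg f -> intg g ->
  \int[mu]_x (f x + g x) = \int[mu]_x f x + \int[mu]_x g x.
Proof. exact: RintegralD. Qed.

Lemma intB f g : intg f -> intg g ->
  \int[mu]_x (f x - g x) = \int[mu]_x f x - \int[mu]_x g x.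
Proof. exact: RintegralB. Qed.

Lemma intZ (k : R) f : intg f -> \int[mu]_x (k * f x) = k * \int[mu]_x f x.
Proof. exact: RintegralZl. Qed.

Lemma int_ext f g : f =1 g -> \int[mu]_x f x = \int[mu]_x g x.
Proof. by move=> /funext ->. Qed.

Lemma int0 : \int[mu]_x (0 : R) = 0.
Proof. by rewrite /Rintegral integral0. Qed.

Lemma intN f : intg f -> \int[mu]_x (- f x) = - \int[mu]_x f x.
Proof.
by move=> hf; rewrite -mulN1r -intZ//; apply: int_ext => x; rewrite mulN1r.
Qed.

Lemma int_sum I (s : seq I) (Q : pred I) (F : I -> T -> R) :
  (forall i, Q i -> intg (F i)) ->
  \int[mu]_x (\sum_(i <- s | Q i) F i x) = \sum_(i <- s | Q i) \int[mu]_x F i x.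
Proof.
move=> h; elim: s => [|i s ih].
  by rewrite big_nil -[RHS]int0; apply: int_ext => x; rewrite big_nil.
rewrite big_cons; under int_ext do rewrite big_cons.
have [Qi|nQi] := boolP (Q i); last by rewrite ih.
by rewrite intD// ?ih//; [exact: h|exact: intg_sum].
Qed.

Lemma int_le f g : intg f -> intg g -> (forall x, f x <= g x) ->
  \int[mu]_x f x <= \int[mu]_x g x.
Proof. by move=> hf hg fg; apply: le_Rintegral => // x _; exact: fg. Qed.

Lemma int_ge0 f : (forall x, 0 <= f x) -> 0 <= \int[mu]_x f x.
Proof. by move=> h; apply: Rintegral_ge0. Qed.

Lemma int_norm f : intg f -> `|\int[mu]_x f x| <= \int[mu]_x `|f x|.
Proof. exact: le_normr_Rintegral. Qed.

Lemma int_norm_le f g : intg f -> intg g -> (forall x, `|f x| <= g x) ->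
  `|\int[mu]_x f x| <= \int[mu]_x g x.
Proof.
move=> hf hg fg; apply: le_trans (int_norm hf) _.
by apply: int_le => //; exact: intg_norm.
Qed.

Lemma intg_EFin f : intg f -> (\int[mu]_x (f x)%:E)%E = (\int[mu]_x f x)%:E.
Proof. by move=> hf; rewrite /Rintegral fineK//; exact: integrable_fin_num. Qed.

Lemma ge0_intgP f : measurable_fun setT f -> (forall x, 0 <= f x) ->
  intg f <-> (\int[mu]_x (f x)%:E < +oo)%E.
Proof.
move=> mf f0; split=> [/integrableP[_]|h].
  by under eq_integral do rewrite /= ger0_norm//.
apply/integrableP; split; first exact/measurable_EFinP.
by under eq_integral do rewrite /= ger0_norm//.
Qed.

Lemma intg_ae f g : measurable_fun setT g -> {ae mu, forall x, f x = g x} ->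
  intg f -> intg g.
Proof.
move=> mg fg hf; apply/integrableP; split; first exact/measurable_EFinP.
rewrite (ae_eq_integral (fun x => `|(f x)%:E|)%E) //.
- by case/integrableP : hf.
- by apply/measurable_EFinP; apply: measurableT_comp => //; exact: mg.
- by apply/measurable_EFinP; apply: measurableT_comp => //; exact: (intg_meas hf).
- by apply: filterS fg => x /= ->.
Qed.

Lemma int_ae f g : measurable_fun setT f -> measurable_fun setT g ->
  {ae mu, forall x, f x = g x} -> \int[mu]_x f x = \int[mu]_x g x.
Proof.
move=> mf mg fg; congr fine; apply: ae_eq_integral => //.
- exact/measurable_EFinP.
- exact/measurable_EFinP.
- by apply: filterS fg => x /= ->.
Qed.

(** Measurability of f is required separately because that of f ^+ 2 does not imply it. *)
Definition sqint f := measurable_fun setT f /\ intg (fun x => f x ^+ 2).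

Lemma sqintP f : sqint f <->
  measurable_fun setT f /\ (\int[mu]_x ((f x) ^+ 2)%:E < +oo)%E.
Proof.
split=> -[mf h]; split=> //; apply/ge0_intgP => //.
- exact: measurable_funX.
- by move=> x; rewrite sqr_ge0.
- exact: measurable_funX.
- by move=> x; rewrite sqr_ge0.
Qed.

Lemma sqint_mul f g : sqint f -> sqint g -> intg (fun x => f x * g x).
Proof.
move=> [mf hf] [mg hg]; apply: (@intg_dom _ (fun x => f x ^+ 2 + g x ^+ 2)).
- exact: measurable_funM.
- move=> x; rewrite normrM -(real_normK (num_real (f x))) -(real_normK (num_real (g x))).
  by have := normr_ge0 (f x); have := normr_ge0 (g x); nra.
- exact: intgD.
Qed.

Lemma sqint_dom f g : measurable_fun setT f -> sqint g ->
  (forall x, `|f x| <= `|g x|) -> sqint f.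
Proof.
move=> mf [mg hg] fg; split=> //.
apply: intg_dom hg; first exact: measurable_funX.
move=> x; rewrite normrX -(real_normK (num_real (g x))).
by rewrite lerXn2r ?nnegrE.
Qed.

Lemma sqintD f g : sqint f -> sqint g -> sqint (fun x => f x + g x).
Proof.
move=> hf hg; have [mf if_] := hf; have [mg ig] := hg.
split; first exact: measurable_funD.
apply: intg_ext (intgD (intgD if_ ig) (intgZ 2 (sqint_mul hf hg))) => x.
by ring.
Qed.

Lemma sqintZ k f : sqint f -> sqint (fun x => k * f x).
Proof.
move=> [mf hf]; split; first exact: measurable_funM.
by apply: intg_ext (intgZ (k ^+ 2) hf) => x; rewrite exprMn.
Qed.

Lemma sqint0 : sqint (fun=> 0).
Proof. by split=> //; apply: intg_ext intg0 => x; rewrite expr0n. Qed.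

Lemma sqint_ext f g : f =1 g -> sqint f -> sqint g.
Proof. by move=> /funext ->. Qed.

Lemma sqint_sum I (s : seq I) (Q : pred I) (F : I -> T -> R) :
  (forall i, Q i -> sqint (F i)) -> sqint (fun x => \sum_(i <- s | Q i) F i x).
Proof.
move=> h; elim: s => [|i s ih].
  by apply: sqint_ext sqint0 => x; rewrite big_nil.
have [Qi|nQi] := boolP (Q i).
  by apply: sqint_ext (sqintD (h i Qi) ih) => x; rewrite big_cons Qi.
by apply: sqint_ext ih => x; rewrite big_cons (negbTE nQi).
Qed.

Lemma sqint_bndM (K : R) b f : measurable_fun setT b -> (forall x, `|b x| <= K) ->
  sqint f -> sqint (fun x => b x * f x).
Proof.
move=> mb bK hf; apply: sqint_dom (sqintZ K hf) _.
  by apply: measurable_funM => //; case: hf.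
by move=> x; rewrite !normrM ler_wpM2r// (le_trans (bK x))// ler_norm.
Qed.

Lemma intg_bndM (K : R) b f : measurable_fun setT b -> (forall x, `|b x| <= K) ->
  intg f -> intg (fun x => b x * f x).
Proof.
move=> mb bK hf; apply: (@intg_dom _ (fun x => K * `|f x|)).
- by apply: measurable_funM => //; exact: intg_meas.
- by move=> x; rewrite normrM ler_wpM2r.
- exact/intgZ/intg_norm.
Qed.

(* AM-GM with the parameter s gives the scale-free form of Cauchy-Schwarz. *)
Lemma int_mul_le (s : R) f g : 0 < s -> sqint f -> sqint g ->
  `|\int[mu]_x (f x * g x)| <=
    s / 2 * (\int[mu]_x f x ^+ 2) + (2 * s)^-1 * (\int[mu]_x g x ^+ 2).
Proof.
move=> s0 hf hg; have [_ if_] := hf; have [_ ig] := hg.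
rewrite -!intZ// -intD; [|exact: intgZ|exact: intgZ].
apply: int_norm_le; first exact: sqint_mul.
  by apply: intgD; exact: intgZ.
move=> x; rewrite normrM -(real_normK (num_real (f x))) -(real_normK (num_real (g x))).
set a := `|f x|; set b := `|g x|.
rewrite -subr_ge0.
have -> : s / 2 * a ^+ 2 + (2 * s)^-1 * b ^+ 2 - a * b =
   (2 * s)^-1 * (s * a - b) ^+ 2 by field; rewrite gt_eqF.
by rewrite mulr_ge0 ?sqr_ge0// invr_ge0 mulr_ge0// ltW.
Qed.

Lemma int_mul_sq_le f g : sqint f -> sqint g ->
  (\int[mu]_x (f x * g x)) ^+ 2 <= (\int[mu]_x f x ^+ 2) * (\int[mu]_x g x ^+ 2).
Proof.
move=> hf hg; have [_ if_] := hf; have [_ ig] := hg.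
set F := \int[mu]_x f x ^+ 2; set G := \int[mu]_x g x ^+ 2.
set I := \int[mu]_x (f x * g x).
have F0 : 0 <= F by apply: int_ge0 => x; rewrite sqr_ge0.
have G0 : 0 <= G by apply: int_ge0 => x; rewrite sqr_ge0.
have H s : 0 < s -> `|I| <= s / 2 * F + (2 * s)^-1 * G by move=> s0; exact: int_mul_le.
rewrite -(real_normK (num_real I)).
have I0 := normr_ge0 I.
have [F00|F1] := eqVneq F 0; last first.
  have Fp : 0 < F by rewrite lt_def F1.
  have [->|I1] := eqVneq `|I| 0; first by rewrite expr0n mulr_ge0.
  have Ip : 0 < `|I| by rewrite lt_def I1.
  (* With s = |I| / F the first term of the bound is |I| / 2, which leaves |I| ^ 2 <= F * G. *)
  have := H _ (divr_gt0 Ip Fp).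
  have -> : `|I| / F / 2 * F + (2 * (`|I| / F))^-1 * G =
     (`|I| ^+ 2 + F * G) / (2 * `|I|) by field; rewrite I1 F1.
  rewrite ler_pdivlMr ?mulr_gt0//; nra.
rewrite F00 mul0r.
suff -> : `|I| = 0 by rewrite expr0n.
apply/eqP; rewrite eq_le I0 andbT leNgt; apply/negP => Ip.
(* When F = 0 only the term in 1 / s remains, and this large s makes it at most |I| / 2, which
   contradicts |I| > 0. *)
have s0 : 0 < (G + 1) / `|I| by rewrite divr_gt0// ltr_wpDl.
have := H _ s0; rewrite F00 mulr0 add0r.
have -> : (2 * ((G + 1) / `|I|))^-1 * G = `|I| * (G / (2 * (G + 1))).
  by field; rewrite !gt_eqF ?ltr_wpDl.
have : G / (2 * (G + 1)) <= 2^-1.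
  by rewrite ler_pdivrMr ?mulr_gt0 ?ltr_wpDl//; lra.
nra.
Qed.

Lemma cvg_int_ae (f_ : nat -> T -> R) f h :
  (forall k, measurable_fun setT (f_ k)) -> measurable_fun setT f ->
  {ae mu, forall x, f_ k x @[k --> \oo] --> f x} ->
  {ae mu, forall x, forall k, `|f_ k x| <= h x} -> intg h ->
  \int[mu]_x f_ k x @[k --> \oo] --> \int[mu]_x f x.
Proof.
move=> mf mff cf fh ih.
have [||||i1 _ ] := @dominated_convergence _ _ _ mu setT measurableT
  (fun k => EFin \o f_ k) (EFin \o f) (EFin \o h) _ _ _ ih.
- by move=> k; exact/measurable_EFinP.
- exact/measurable_EFinP.
- by apply: filterS cf => x cf _; apply/fine_cvgP; split; [exact: nearW|exact: cf].
- by apply: filterS fh => x fh k _; rewrite lee_fin.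
move=> h1; apply: fine_cvg => /=; rewrite intg_EFin // in h1.
Qed.

Lemma cvg_int (f_ : nat -> T -> R) f h :
  (forall k, measurable_fun setT (f_ k)) ->
  (forall x, f_ k x @[k --> \oo] --> f x) ->
  (forall k x, `|f_ k x| <= h x) -> intg h ->
  \int[mu]_x f_ k x @[k --> \oo] --> \int[mu]_x f x.
Proof.
move=> mf cf fh; apply: cvg_int_ae => //.
- by apply: (measurable_fun_cvg mf) => x _; exact: cf.
- exact: aeW.
- by apply: aeW => x k; exact: fh.
Qed.

(* The integral of a non-integrable function is a difference of extended integrals
   one of which is infinite, and [fine] sends infinities to 0. *)
Lemma int_nonintg f : measurable_fun setT f -> ~ intg f -> \int[mu]_x f x = 0.
Proof.
move=> mf nf; have mEf : measurable_fun setT (EFin \o f) by exact/measurable_EFinP.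
rewrite /Rintegral integralE.
have p0 : (0 <= \int[mu]_x (EFin \o f)^\+ x)%E by apply: integral_ge0.
have n0 : (0 <= \int[mu]_x (EFin \o f)^\- x)%E by apply: integral_ge0.
have : ~ ((\int[mu]_x (EFin \o f)^\+ x)%E \is a fin_num /\ (\int[mu]_x (EFin \o f)^\- x)%E
  \is a fin_num).
  move=> [fp fn]; apply: nf; apply/integrableP; split=> //.
  rewrite (eq_integral (fun x => (EFin \o f)^\+ x + (EFin \o f)^\- x)%E); last first.
    by move=> x _; exact: (congr1 (@^~ x) (fune_abse (EFin \o f))).
  rewrite ge0_integralD//.
  - by rewrite lte_add_pinfty// -ge0_fin_numE.
  - exact: measurable_funepos.
  - exact: measurable_funeneg.
move: (\int[mu]_x (EFin \o f)^\+ x)%E (\int[mu]_x (EFin \o f)^\- x)%E p0 n0.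
by move=> [a| |] [b| |] //= _ _ [].
Qed.

(** For k != 0, f and k * f are integrable together, and both integrals are 0 otherwise. This serves
    for sections of integrable functions on a product, which are integrable only almost surely. *)
Lemma intZm (k : R) f : measurable_fun setT f -> \int[mu]_x (k * f x) = k * \int[mu]_x f x.
Proof.
move=> mf; have [hf|nf] := pselect (intg f); first exact: intZ.
have [->|k0] := eqVneq k 0.
  by rewrite mul0r -[RHS]int0; apply: int_ext => x; rewrite mul0r.
rewrite (int_nonintg mf nf) mulr0; apply: int_nonintg; first exact: measurable_funM.
move=> hk; apply: nf; apply: intg_ext (intgZ k^-1 hk) => x.
by rewrite mulrA mulVf ?mul1r.
Qed.

End integrable_real.

(** * Borel sets and Lebesgue measure of R^d *)

Section borel_cV.
Context {R : realType} {d : nat}.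
Local Notation E := 'cV[R]_d.

Lemma cV_norm_le (x : E) (r : R) : 0 <= r ->
  (`|x| <= r) = [forall i, `|x i 0| <= r].
Proof.
move=> r0; apply/idP/forallP => [xr i|h].
  apply: le_trans xr; rewrite /Num.norm /= mx_normrE.
  by apply: le_trans (le_bigmax _ _ (i, 0)).
rewrite /Num.norm /= mx_normrE; apply: bigmax_le => //= -[i j] _ /=.
by rewrite (ord1 j).
Qed.

Lemma cV_coord_le (x : E) i : `|x i 0| <= `|x|.
Proof. by have := cV_norm_le x (normr_ge0 x); rewrite lexx => /esym/forallP. Qed.

Lemma cV_norm_lt (x : E) (r : R) : 0 < r ->
  (`|x| < r) = [forall i, `|x i 0| < r].
Proof.
move=> r0; apply/idP/forallP => [xr i|h].
  exact: le_lt_trans (cV_coord_le x i) xr.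
rewrite /Num.norm /= mx_normrE; apply: bigmax_lt => //= -[i j] _ /=.
by rewrite (ord1 j).
Qed.

Lemma measurable_cV_ball (x : E) (r : R) : measurable [set y : E | `|x - y| < r].
Proof.
have [r0|r0] := leP r 0.
  rewrite (_ : [set _ | _] = set0) //; apply/seteqP; split => // y /=.
  by rewrite ltNge (le_trans r0).
rewrite (_ : [set _ | _] = \bigcap_(i in [set: 'I_d])
    ((fun y : E => y i 0) @^-1` ball (x i 0) r)); last first.
  apply/seteqP; split => y /=.
    rewrite cV_norm_lt// => /forallP h i _ /=.
    by have := h i; rewrite !mxE.
  move=> h; rewrite cV_norm_lt//; apply/forallP => i.
  by have := h i I; rewrite /= !mxE.
apply: fin_bigcap_measurable => // i _; rewrite -[X in measurable X]setTI.
apply: measurable_coord => //.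
exact: measurable_ball.
Qed.

(** An open set is the union of the countably many balls with rational center and radius 1 / (m + 1)
    that it contains; balls not contained in it are replaced by the empty set. *)
Lemma open_measurable_cV (U : set E) : open U -> measurable U.
Proof.
move=> oU.
pose q (p : 'cV[rat]_d) : E := map_mx ratr p.
pose B (p : 'cV[rat]_d * nat) := [set y : E | `|q p.1 - y| < p.2.+1%:R^-1].
pose F p := if `[< B p `<=` U >] then B p else set0.
rewrite (_ : U = \bigcup_(p in [set: 'cV[rat]_d * nat]) F p); last first.
  apply/seteqP; split => [x Ux|x [p _]]; last by rewrite /F; case: asboolP => // + Bx; apply.
  have := oU; rewrite openE => /(_ _ Ux).
  rewrite /interior => /nbhs_ballP[e /= e0 xe].
  have e20 : 0 < e / 2 by rewrite divr_gt0.
  have [N hN] : exists N : nat, N.+1%:R^-1 < e / 2.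
    have [N _ hN] := near_infty_natSinv_lt (PosNum e20).
    by exists N; apply: hN => /=.
  have N0 : (0 : R) < N.+1%:R^-1 by rewrite invr_gt0.
  have hr i : exists r : rat, `|ratr r - x i 0| < N.+1%:R^-1.
    have xi : x i 0 < x i 0 + N.+1%:R^-1 by rewrite ltrDl.
    have [r] := rat_in_itvoo xi.
    rewrite in_itv /= => /andP[h1 h2]; exists r.
    by rewrite gtr0_norm ?subr_gt0// ltrBlDl.
  have /choice[r hr'] := hr.
  exists (\col_i r i, N) => //.
  have BU : B (\col_i r i, N) `<=` U.
    move=> y; rewrite /B /= => hy; apply: xe.
    rewrite mx_norm_ball /ball_ /= (splitr e).
    rewrite (_ : x - y = (x - q (\col_i r i)) + (q (\col_i r i) - y)); last first.
      by rewrite addrA subrK.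
    rewrite (le_lt_trans (ler_normD _ _))// ltrD ?(lt_trans hy)//.
    rewrite (lt_trans _ hN)// cV_norm_lt//; apply/forallP => i.
    by rewrite !mxE distrC.
  rewrite /F; case: asboolP => // _; rewrite /B /= cV_norm_lt//.
  by apply/forallP => i; rewrite !mxE.
apply: countable_bigcupT_measurable => // p.
rewrite /F; case: asboolP => _ //; exact: measurable_cV_ball.
Qed.

Lemma continuous_measurable_cV (f : E -> R) : continuous f -> measurable_fun setT f.
Proof.
move=> /continuousP cf; apply: (measurability _ (RGenOpens.measurableE R)).
move=> _ [_ [a [b ->] <-]]; rewrite setTI.
by apply: open_measurable_cV; apply: cf; exact: interval_open.
Qed.

End borel_cV.

Section invariance.
Context {R : realType}.

(** Translations and reflections are the only changes of variables made in integrals, so no Jacobian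
    factor occurs. *)
Let is_sign (s : R) := (s == 1) || (s == -1).

Lemma lebesgue_measure_affine (c s : R) : is_sign s ->
  forall A : set (measurableTypeR R), measurable A ->
  lebesgue_measure ((fun x => c + s * x) @^-1` A) = lebesgue_measure A.
Proof.
move=> ss A mA.
have mphi : measurable_fun [set: measurableTypeR R] (fun x : measurableTypeR R => c +
  s * x : measurableTypeR R).
  by apply: continuous_measurable_fun => x; apply: cvgD; [exact: cvg_cst|exact: mulrl_continuous].
pose phi : {mfun measurableTypeR R >-> measurableTypeR R} :=
  HB.pack (fun x : measurableTypeR R => c +
    s * x : measurableTypeR R) (isMeasurableFun.Build _ _ _ _ _ mphi).
apply/esym.
apply: (@lebesgue_measure_unique R (pushforward lebesgue_measure phi) _ A mA).
move=> _ /= [[a b] _ <-] /=; rewrite /pushforward.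
case/orP : ss => /eqP ->.
  rewrite (_ : _ @^-1` _ = `]a - c, b - c]%classic); last first.
    by apply/seteqP; split => x; rewrite /= !in_itv /= => /andP[h1 h2]; apply/andP; split; lra.
  by rewrite !lebesgue_measure_itv /= !lte_fin ltrBlDr subrK; case: ifP => // _; congr EFin; lra.
(* A reflection moves the closed end of the interval to the left, which does not affect its
   length. *)
rewrite (_ : _ @^-1` _ = `[c - b, c - a[%classic); last first.
  by apply/seteqP; split => x; rewrite /= !in_itv /= => /andP[h1 h2]; apply/andP; split; lra.
rewrite !lebesgue_measure_itv /= !lte_fin ltrD2l ltrN2; case: ifP => // _.
by congr EFin; lra.
Qed.

Lemma measurable_affine d (c : 'cV[R]_d) (s : R) :
  measurable_fun setT (fun x : 'cV[R]_d => c + s *: x).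
Proof.
apply: measurable_fun_cV => i.
rewrite (_ : (fun _ => _) = fun x : 'cV[R]_d => c i 0 + s * x i 0); last first.
  by apply/funext => x; rewrite !mxE.
by apply: measurable_funD => //; apply: measurable_funM => //; exact: measurable_coord.
Qed.

(** Induction on d: through [vcons] the map acts separately on the first coordinate and on the
    others, and a product measure is determined by its values on rectangles. *)
Lemma lebesgue_cV_affine d (c : 'cV[R]_d) (s : R) : is_sign s ->
  forall A, measurable A ->
  lebesgue_cV d ((fun x => c + s *: x) @^-1` A) = lebesgue_cV d A.
Proof.
move=> ss; elim: d c => [|d IH] c A mA.
  rewrite (_ : _ @^-1` A = A) //; apply/seteqP; split => x /=;
    by rewrite (_ : c + s *: x = x) //; apply/colP; case.
rewrite /= /lebesgueS /pushforward.
pose f (p : measurableTypeR R * 'cV[R]_d) : measurableTypeR R * 'cV[R]_d :=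
  (c ord0 0 + s * p.1, (\col_j c (lift ord0 j) 0) + s *: p.2).
have mf : measurable_fun setT f.
  apply/measurable_fun_pairP; split.
    apply: measurable_funD => //; apply: measurable_funM => //; exact: measurable_fst.
  apply: (@measurableT_comp _ _ _ _ _ _ (fun x : 'cV[R]_d => _ + s *: x)) => //.
  exact: measurable_affine.
pose phi : {mfun (measurableTypeR R * 'cV[R]_d)%type >-> (measurableTypeR R * 'cV[R]_d)%type} :=
  HB.pack f (isMeasurableFun.Build _ _ _ _ _ mf).
have mvA : measurable (@vcons R d @^-1` A).
  by rewrite -[X in measurable X]setTI; exact: measurable_vcons.
rewrite (_ : _ @^-1` _ = f @^-1` (@vcons R d @^-1` A)); last first.
  have vf p : vcons (f p) = c + s *: vcons p.
    by apply/colP => i; rewrite !mxE; case: unliftP => [j|] -> /=; rewrite ?mxE.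
  by apply/seteqP; split => p; rewrite /preimage /= vf.
apply/esym.
apply: (@product_measure_unique _ _ _ _ _ lebesgue_measure (lebesgue_cV d)
  (pushforward (lebesgue_measure \x lebesgue_cV d)%E phi)) => // B C mB mC.
transitivity ((lebesgue_measure \x lebesgue_cV d)%E
   (((fun x => c ord0 0 + s * x) @^-1` B) `*`
    ((fun x : 'cV[R]_d => (\col_j c (lift ord0 j) 0) + s *: x) @^-1` C))); first by [].
rewrite product_measure1E.
- by congr (_ * _)%E; [exact: (lebesgue_measure_affine _ ss mB)|exact: IH].
- rewrite -[X in measurable X]setTI.
  have : measurable_fun [set: measurableTypeR R] (fun x : measurableTypeR R => c ord0 0 +
    s * x : measurableTypeR R).
    by apply: measurable_funD => //; apply: measurable_funM.
  exact.
- by rewrite -[X in measurable X]setTI; exact: measurable_affine.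
Qed.

Section change.
Context {d : nat}.
Variables (c : 'cV[R]_d) (s : R).
Hypothesis ss : is_sign s.
Local Notation mu := (lebesgue_cV d).

Lemma ge0_integral_cV_affine (f : 'cV[R]_d -> \bar R) :
  measurable_fun setT f -> (forall x, 0 <= f x)%E ->
  (\int[mu]_x f (c + s *: x)%R = \int[mu]_x f x)%E.
Proof.
move=> mf f0.
have := @ge0_integral_pushforward _ _ _ _ R _ (measurable_affine c s) mu setT f measurableT
  mf (fun x _ => f0 x).
rewrite preimage_setT => <-.
apply: eq_measure_integral; first exact: measurable_affine.
by move=> mm A mA _; exact: (lebesgue_cV_affine c ss mA).
Qed.

Lemma intg_affine (f : 'cV[R]_d -> R) : intg mu f -> intg mu (fun x => f (c + s *: x)).
Proof.
move=> hf; have mf := intg_meas hf; apply/integrableP; split.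
  by apply/measurable_EFinP; apply: (@measurableT_comp _ _ _ _ _ _ f) => //; exact: measurable_affine.
have /integrableP[_] := hf.
rewrite -(@ge0_integral_cV_affine (fun x => `|(f x)%:E|%E)) //.
by apply/measurable_EFinP; apply: measurableT_comp.
Qed.

Lemma int_affine (f : 'cV[R]_d -> R) : intg mu f ->
  \int[mu]_x f (c + s *: x) = \int[mu]_x f x.
Proof.
move=> hf; have mf := intg_meas hf; congr fine.
rewrite [LHS]integralE [RHS]integralE; congr (_ - _)%E.
  transitivity (\int[mu]_x ((EFin \o f)^\+%E (c + s *: x)%R))%E;
    first by apply: eq_integral => x _; rewrite ?funeposE ?funenegE.
  apply: (@ge0_integral_cV_affine ((EFin \o f)^\+%E)) => //.
  by apply: measurable_funepos; exact/measurable_EFinP.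
transitivity (\int[mu]_x ((EFin \o f)^\-%E (c + s *: x)%R))%E;
  first by apply: eq_integral => x _; rewrite ?funeposE ?funenegE.
  apply: (@ge0_integral_cV_affine ((EFin \o f)^\-%E)) => //.
by apply: measurable_funeneg; exact/measurable_EFinP.
Qed.
End change.
End invariance.

Section compact_support.
Context {R : realType} {d : nat}.
Local Notation E := 'cV[R]_d.
Local Notation mu := (lebesgue_cV d).

(** Transposition is continuous and carries the Heine-Borel theorem over from row vectors. *)
Lemma cV_bounded_closed_compact (A : set E) (r : R) :
  (forall x, A x -> `|x| <= r) -> closed A -> compact A.
Proof.
move=> bA cA.
have ctr m n : continuous (@trmx R m n).
  move=> x B /nbhs_ballP[e /= e0 h]; apply/nbhs_ballP; exists e => //= y [_ hy].
  by apply: h; split => // i j; rewrite !mxE; exact: hy.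
have -> : A = (@trmx R 1 d) @` ((@trmx R 1 d) @^-1` A).
  apply/seteqP; split => [x Ax|_ [y Ay <-]] //.
  by exists x^T; rewrite /= trmxK.
apply: continuous_compact; first by apply: continuous_subspaceT; exact: ctr.
apply: bounded_closed_compact.
  exists r; split; first exact: num_real.
  move=> M rM y Ay; rewrite /globally /=.
  apply: le_trans (ltW rM); apply: le_trans (bA _ Ay).
  rewrite {1}/Num.norm /= mx_normrE; apply: bigmax_le => //= -[i j] _ /=.
  have -> : y i j = y^T j 0 by rewrite mxE (ord1 i).
  exact: cV_coord_le.
by apply: closed_comp => // x _; exact: ctr.
Qed.

Definition cpt {V : nmodType} (f : E -> V) := exists r : R, forall x, r < `|x| -> f x = 0.

Lemma cptP (V : nmodType) (f : E -> V) : compact (Defs.support f) <-> cpt f.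
Proof.
split=> [/compact_bounded[r [_ hr]]|[r hr]].
  exists (r + 1) => x rx; apply: contrapT => fx.
  have : Defs.support f x by exact: subset_closure.
  by move/(hr (r + 1) (ltr_pwDr ltr01 (lexx r)) x) => /=; rewrite leNgt rx.
apply: (@cV_bounded_closed_compact _ r); last exact: closed_closure.
move=> x sx; rewrite leNgt; apply/negP => rx.
have nb : nbhs x [set y : E | r < `|y|].
  by apply: (cvgr_gt _ (@norm_continuous _ E x)).
have [y [/= fy ry]] := sx _ nb.
by apply: fy; exact: hr.
Qed.

Lemma cpt_mull (f g : E -> R) : cpt f -> cpt (fun x => f x * g x).
Proof. by move=> [r h]; exists r => x /h ->; rewrite mul0r. Qed.

Lemma cpt_bounded (f : E -> R) : continuous f -> cpt f ->
  exists K, forall x, `|f x| <= K.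
Proof.
move=> cf /cptP cs.
have /compact_bounded[r [_ hr]] : compact (f @` (Defs.support f)).
  by apply: continuous_compact => //; exact: continuous_subspaceT.
exists (`|r| + 1) => x; have [->|fx] := eqVneq (f x) 0.
  by rewrite normr0 addr_ge0.
apply: hr; first by rewrite (le_lt_trans (ler_norm r))// ltrDl.
by exists x => //; apply: subset_closure; exact/eqP.
Qed.

Lemma mu_ball_lty (r : R) : (mu [set x : E | `|x| <= r]%R < +oo)%E.
Proof.
have [r0|r0] := ltP r 0.
  rewrite (_ : [set _ | _] = set0) ?measure0//.
  by apply/seteqP; split => // x /=; rewrite leNgt (lt_le_trans r0).
rewrite (_ : [set _ | _] = [set x : E | forall i : 'I_d, `[- r, r]%classic (x i 0)]).
  rewrite (@lebesgue_cV_box R d (fun=> `[- r, r]%classic))//.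
  suff : (\prod_(i < d) (lebesgue_measure `[(- r)%R,
    r]))%E \is a fin_num by move=> /fineK <-; exact: ltry.
  elim/big_ind : _ => //; first exact: fin_numM.
  by move=> i _; rewrite lebesgue_measure_itv /=; case: ifP.
apply/seteqP; split => x /=.
  by rewrite cV_norm_le// => /forallP h i; rewrite in_itv /= -ler_norml.
move=> h; rewrite cV_norm_le//; apply/forallP => i.
by have := h i; rewrite in_itv /= -ler_norml.
Qed.

End compact_support.

(** * Smooth functions and test functions *)

Section calculus_cV.
Context {R : realType} {d : nat}.
Local Notation E := 'cV[R]_d.
Local Notation mu := (lebesgue_cV d).
Implicit Types (f g v : E -> R) (x : E) (i j : 'I_d) (s : seq 'I_d).

Lemma is_derive_line f x (v : E) (l : R) (t : R) :
  is_derive (x + t *: v) v f l <-> is_derive t 1 (fun h : R => f (x + h *: v)) l.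
Proof.
have e : (fun h : R => h^-1 *: ((f \o shift (x + t *: v)) (h *: v) - f (x + t *: v))) =
    (fun h : R => h^-1 *: (((fun h : R => f (x + h *: v)) \o shift t) (h *: 1) -
      (fun h : R => f (x + h *: v)) t)).
  apply/funext => h /=; congr (_ *: (f _ - _)).
  by rewrite addrC -addrA -scalerDl addrC [h *: 1]mulr1 [t + h]addrC addrC.
split=> -[h1 h2]; split.
- by move: h1; rewrite /derivable e.
- by move: h2; rewrite /derive e.
- by move: h1; rewrite /derivable -e.
- by move: h2; rewrite /derive -e.
Qed.

Lemma pderivable_line f i x t : derivable f (x + t *: bvec i) (bvec i) ->
  is_derive t 1 (fun h : R => f (x + h *: bvec i)) (pderiv i f (x + t *: bvec i)).
Proof. by move=> h; apply/is_derive_line; exact/derivableP. Qed.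

Lemma line_MVT f i x t : (forall y, derivable f y (bvec i)) -> 0 < t ->
  exists2 c, 0 < c < t &
    f (x + t *: bvec i) - f x = t * pderiv i f (x + c *: bvec i).
Proof.
move=> df t0.
have h (c : R) : is_derive c 1 (fun h : R => f (x + h *: bvec i)) (pderiv i f (x + c *: bvec i)).
  by apply: pderivable_line.
have [|c ci] := MVT t0 (fun c _ => h c).
  by apply: derivable_within_continuous => c _; case: (h c).
rewrite scale0r addr0 subr0 mulrC => e; exists c => //.
Qed.

Lemma pderivs_rcons s i f : pderivs (rcons s i) f = pderivs s (pderiv i f).
Proof. by rewrite /pderivs foldr_rcons. Qed.

Lemma smooth_derivable f : smooth f -> forall i x, derivable f x (bvec i).
Proof. by move=> /(_ [::])[]. Qed.

Lemma smooth_continuous f : smooth f -> continuous f.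
Proof. by move=> /(_ [::])[]. Qed.

Lemma smooth_pderiv f i : smooth f -> smooth (pderiv i f).
Proof. by move=> sf s; rewrite -pderivs_rcons. Qed.

Lemma smooth_pderivs f s : smooth f -> smooth (pderivs s f).
Proof. by elim: s => //= i s ih sf; exact/smooth_pderiv/ih. Qed.

Lemma pderivD f g i : smooth f -> smooth g ->
  pderiv i (fun x => f x + g x) = fun x => pderiv i f x + pderiv i g x.
Proof.
by move=> sf sg; apply/funext => x; apply: deriveD; exact: smooth_derivable.
Qed.

Lemma pderivZ f i (k : R) : smooth f ->
  pderiv i (fun x => k * f x) = fun x => k * pderiv i f x.
Proof.
by move=> sf; apply/funext => x; apply: deriveZ; exact: smooth_derivable.
Qed.

Lemma pderivM f g i : smooth f -> smooth g ->
  pderiv i (fun x => f x * g x) = fun x => pderiv i f x * g x + f x * pderiv i g x.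
Proof.
move=> sf sg; apply/funext => x; rewrite [LHS]deriveM; try exact: smooth_derivable.
by rewrite addrC; congr (_ + _); rewrite mulrC.
Qed.

Lemma pderivsD f g s : smooth f -> smooth g ->
  pderivs s (fun x => f x + g x) = fun x => pderivs s f x + pderivs s g x.
Proof.
elim/last_ind: s f g => // s i ih f g sf sg.
rewrite !pderivs_rcons pderivD// ih//; exact: smooth_pderiv.
Qed.

Lemma smoothD f g : smooth f -> smooth g -> smooth (fun x => f x + g x).
Proof.
move=> sf sg s; rewrite pderivsD//; have [cf df] := sf s; have [cg dg] := sg s.
split=> [x|i x]; first exact: (continuousD (cf x) (cg x)).
exact: derivableD.
Qed.

Lemma pderivsZ f s (k : R) : smooth f ->
  pderivs s (fun x => k * f x) = fun x => k * pderivs s f x.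
Proof.
elim/last_ind: s f => // s i ih f sf.
rewrite !pderivs_rcons pderivZ// ih//; exact: smooth_pderiv.
Qed.

Lemma smoothZ f (k : R) : smooth f -> smooth (fun x => k * f x).
Proof.
move=> sf s; rewrite pderivsZ//; have [cf df] := sf s.
split=> [x|i x]; first exact: (continuousM (cvg_cst k) (cf x)).
exact: derivableZ.
Qed.

Lemma continuous_mul f g : continuous f -> continuous g -> continuous (fun x => f x * g x).
Proof. by move=> cf cg x; exact: (continuousM (cf x) (cg x)). Qed.

(** The derivative of a product is a sum of two products of smooth functions, so the induction is on
    the order of differentiation, for all pairs f, g at once. The lemma [pderivsD] does not apply to
    that sum, since the smoothness of its summands is what is being proved. *)
Lemma smoothM f g : smooth f -> smooth g -> smooth (fun x => f x * g x).
Proof.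
move=> sf sg s.
suff : forall s, (forall f g, smooth f -> smooth g ->
    continuous (pderivs s (fun x => f x * g x)) /\
    forall i x, derivable (pderivs s (fun x => f x * g x)) x (bvec i)) by exact.
move=> {}s {f g sf sg}.
have [n] := ubnP (size s); elim: n s => // n IH s.
elim/last_ind: s => [_ f g sf sg|s i _].
  split=> [|i x]; first by apply: continuous_mul; exact: smooth_continuous.
  by apply: derivableM; exact: smooth_derivable.
rewrite size_rcons ltnS => sn f g sf sg.
rewrite pderivs_rcons pderivM//.
suff -> : pderivs s (fun x => pderiv i f x * g x + f x * pderiv i g x) =
   fun x => pderivs s (fun x => pderiv i f x * g x) x + pderivs s (fun x => f x * pderiv i g x) x.
  have [c1 d1] := IH s sn _ _ (smooth_pderiv i sf) sg.
  have [c2 d2] := IH s sn _ _ sf (smooth_pderiv i sg).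
  split=> [x|k x]; first exact: (continuousD (c1 x) (c2 x)).
  exact: derivableD.
have H u v : smooth u -> smooth v -> forall t, (size t < n)%N ->
    continuous (pderivs t (fun x => u x * v x)) /\
    forall i x, derivable (pderivs t (fun x => u x * v x)) x (bvec i).
  by move=> su sv t tn; exact: IH.
(* Additivity of the derivatives of order below n, whose differentiability is known from the
   induction hypothesis. *)
have K : forall t, (size t < n)%N -> pderivs t (fun x => pderiv i f x * g x + f x * pderiv i g x) =
   fun x => pderivs t (fun x => pderiv i f x * g x) x + pderivs t (fun x => f x * pderiv i g x) x.
  elim=> //= k t iht tn; rewrite iht; last exact: ltn_trans tn.
  apply/funext => x; apply: deriveD.
    by have [_] := H _ _ (smooth_pderiv i sf) sg t (ltn_trans (ltnSn _) tn); exact.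
  by have [_] := H _ _ sf (smooth_pderiv i sg) t (ltn_trans (ltnSn _) tn); exact.
exact: K.
Qed.

Lemma pderiv_affine f i (c : E) (k : R) : smooth f ->
  (pderiv i (fun x => f (c + k *: x)) = (fun x => k * pderiv i f (c + k *: x))) /\
  forall x, derivable (fun x => f (c + k *: x)) x (bvec i).
Proof.
move=> sf.
suff h x : is_derive x (bvec i) (fun x => f (c + k *: x)) (k * pderiv i f (c + k *: x)).
  by split=> [|x]; [apply/funext => x; case: (h x)|case: (h x)].
rewrite -[X in is_derive X](addr0 x) -[X in _ + X](scale0r (bvec i)).
apply/is_derive_line.
have -> : (fun h : R => f (c + k *: (x + h *: bvec i))) =
   (fun t : R => f ((c + k *: x) + t *: bvec i)) \o (fun h : R => k * h).
  by apply/funext => h /=; rewrite scalerDr scalerA addrA.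
have h1 : is_derive (k * (0 : R)) 1 (fun t : R => f ((c + k *: x) + t *: bvec i))
   (pderiv i f (c + k *: x)).
  rewrite -[X in pderiv i f X]addr0 -[X in _ + _ + X](scale0r (bvec i)) mulr0.
  by apply: pderivable_line; exact: smooth_derivable.
have h2 : is_derive (0 : R) 1 (fun h : R => k * h) k.
  apply: (@is_derive_eq _ _ _ _ _ _ _ (k *: (1 : R^o))); last exact: mulr1.
have := is_derive1_comp h1 h2.
by rewrite mulrC.
Qed.

Lemma pderivs_affine f s (c : E) (k : R) : smooth f ->
  pderivs s (fun x => f (c + k *: x)) = fun x => k ^+ size s * pderivs s f (c + k *: x).
Proof.
move=> sf; elim: s => [|i s ih] /=; first by apply/funext => x; rewrite mul1r.
have [e1 d1] := pderiv_affine i c k (smooth_pderivs s sf).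
rewrite ih; apply/funext => x.
have -> : pderiv i (fun x => k ^+ size s * pderivs s f (c + k *: x)) x =
   k ^+ size s * pderiv i (fun x => pderivs s f (c + k *: x)) x by exact: deriveZ.
by rewrite e1 exprSr mulrA.
Qed.

Lemma continuous_affine (c : E) (k : R) : continuous (fun x : E => c + k *: x).
Proof.
move=> x; apply: (@continuousD _ _ _ (fun=> c) (fun x : E => k *: x)).
  exact: cst_continuous.
exact: (@scaler_continuous _ _ k x).
Qed.

Lemma smooth_affine f (c : E) (k : R) : smooth f -> smooth (fun x => f (c + k *: x)).
Proof.
move=> sf s; rewrite pderivs_affine//.
split=> [|i x].
  apply: continuous_mul; first exact: cst_continuous.
  move=> x; apply: (@continuous_comp _ _ _ (fun x : E => c + k *: x)).
    exact: continuous_affine.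
  by have [cs _] := sf s; exact: cs.
by apply: derivableZ; have [_] := pderiv_affine i c k (smooth_pderivs s sf); exact.
Qed.

Lemma bvec_norm_le i : `|bvec i : E| <= 1.
Proof.
rewrite cV_norm_le//; apply/forallP => l; rewrite mxE eqxx andbT.
by case: eqP; rewrite ?normr1 ?normr0.
Qed.

(** Both mixed derivatives are limits of the second difference quotient, which is symmetric in the
    two directions. The mean value theorem in each direction writes this quotient as a mixed
    derivative at a nearby point, and continuity gives the limit. *)
Lemma schwarz f i j : smooth f -> pderiv i (pderiv j f) = pderiv j (pderiv i f).
Proof.
suff H i0 j0 x : smooth f -> forall e : R, 0 < e -> exists del, 0 < del /\ 
   forall t, 0 < t < del -> 
   `|(f (x + t *: bvec i0 + t *: bvec j0) - f (x + t *: bvec i0) - (f (x +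
     t *: bvec j0) - f x)) / (t * t) - 
    pderiv j0 (pderiv i0 f) x| <= e.
  move=> sf; apply/funext => x; apply/eqP; rewrite -subr_eq0 -normr_le0.
  apply/ler_addgt0Pl => e e0; rewrite addr0.
  have e2 : 0 < e / 2 by rewrite divr_gt0.
  have [d1 [d10 h1]] := H i j x sf _ e2.
  have [d2 [d20 h2]] := H j i x sf _ e2.
  pose t := Num.min d1 d2 / 2.
  have m0 : 0 < Num.min d1 d2 by rewrite lt_min d10.
  have t0 : 0 < t by rewrite divr_gt0.
  have td : t < Num.min d1 d2 by rewrite /t ltr_pdivrMr// mulr_natr mulr2n ltrDl.
  move: (td); rewrite lt_min => /andP[td1 td2].
  have := h1 t; rewrite t0 td1 => /(_ isT) {}h1.
  have := h2 t; rewrite t0 td2 => /(_ isT) {}h2.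
  set A := _ / _ in h1; set B := _ / _ in h2.
  have eA : A = B by rewrite /A /B (addrAC x); congr (_ / _); ring.
  rewrite -eA in h2.
  clearbody A B; clear -h1 h2.
  apply: le_trans (ler_distD A _ _) _; rewrite (splitr e).
  by apply: lerD; [rewrite distrC; exact: h2|exact: h1].
move=> sf e e0.
have cf := smooth_continuous (smooth_pderiv j0 (smooth_pderiv i0 sf)).
have /cvgrPdist_le /(_ _ e0) /nbhs_ballP[r /= r0 hr] := cf x.
exists (r / 2); split; first by rewrite divr_gt0.
move=> t /andP[t0 tr].
(* The second difference is the increment in direction i0 of u, itself an increment of f in
   direction j0; the factor 1 gives the form of [smooth_affine]. *)
pose u y := f (t *: bvec j0 + 1 *: y) + (-1) * f y.
have su : smooth u by apply: smoothD; [exact: smooth_affine|exact: smoothZ].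
have [c /andP[c0 ct]] := line_MVT x (@smooth_derivable _ su i0) t0.
have -> : pderiv i0 u = fun y => pderiv i0 f (t *: bvec j0 + 1 *: y) + (-1) * pderiv i0 f y.
  rewrite pderivD; [|exact: smooth_affine|exact: smoothZ].
  by rewrite (pderiv_affine i0 _ _ sf).1 pderivZ//; apply/funext => y; rewrite mul1r.
rewrite /u !scale1r !mulN1r => eu.
have [c' /andP[c0' ct']] := line_MVT (x +
  c *: bvec i0) (@smooth_derivable _ (smooth_pderiv i0 sf) j0) t0.
move=> eu'.
have -> : (f (x + t *: bvec i0 + t *: bvec j0) - f (x + t *: bvec i0) -
    (f (x + t *: bvec j0) - f x)) / (t * t) =
   pderiv j0 (pderiv i0 f) (x + c *: bvec i0 + c' *: bvec j0).
  rewrite !(addrC (t *: bvec j0)) eu' in eu.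
  by rewrite eu mulrA mulrAC divff ?mul1r// mulf_neq0// gt_eqF.
rewrite distrC; apply: hr.
rewrite mx_norm_ball /ball_ /=.
rewrite -addrA opprD addNKr normrN (le_lt_trans (ler_normD _ _))// !normrZ.
rewrite [ltRHS]splitr ltrD// (le_lt_trans (ler_piMr _ (bvec_norm_le _)))// gtr0_norm//;
  exact: lt_trans tr.
Qed.

Definition tf f := smooth f /\ cpt f.

Lemma tfP f : Ccinfty setT f <-> tf f.
Proof.
by split=> [[sf /cptP cf _]|[sf /cptP cf]]; split.
Qed.

Lemma cpt_pderiv f i : cpt f -> cpt (pderiv i f).
Proof.
move=> [r hr]; exists r => x rx; rewrite /pderiv /derive.
apply: (@lim_near_cst) => //.
near=> h; rewrite /= (hr x)// hr ?subr0 ?scaler0//.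
have hx : `|h| < `|x| - r by near: h; apply: dnbhs0_lt; rewrite subr_gt0.
have h1 : `|x| <= `|h *: bvec i + x| + `|h *: bvec i|.
  by rewrite -{1}(addKr (h *: bvec i) x) addrC ler_normB.
have h2 : `|h *: bvec i : E| <= `|h| by rewrite normrZ ler_piMr// bvec_norm_le.
lra.
Unshelve. all: end_near. Qed.

Lemma tf_pderiv f i : tf f -> tf (pderiv i f).
Proof. by move=> [sf cf]; split; [exact: smooth_pderiv|exact: cpt_pderiv]. Qed.

Lemma tf_pderivs f s : tf f -> tf (pderivs s f).
Proof. by elim: s => //= i s ih h; apply: tf_pderiv; exact: ih. Qed.

Lemma tf_bounded f : tf f -> exists K, forall x, `|f x| <= K.
Proof. by move=> [sf cf]; apply: cpt_bounded => //; exact: smooth_continuous. Qed.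

Lemma tf_meas f : tf f -> measurable_fun setT f.
Proof. by move=> [sf _]; apply: continuous_measurable_cV; exact: smooth_continuous. Qed.

Lemma tfM f g : tf f -> smooth g -> tf (fun x => f x * g x).
Proof. by move=> [sf cf] sg; split; [exact: smoothM|exact: cpt_mull]. Qed.

Lemma tfZ f (k : R) : tf f -> tf (fun x => k * f x).
Proof.
move=> [sf [r hr]]; split; first exact: smoothZ.
by exists r => x /hr ->; rewrite mulr0.
Qed.

Lemma tf_affine f (c : E) (k : R) : k != 0 -> tf f -> tf (fun x => f (c + k *: x)).
Proof.
move=> k0 [sf [r hr]]; split; first exact: smooth_affine.
exists ((`|c| + r) / `|k|) => x; rewrite ltr_pdivrMr ?normr_gt0// => h.
apply: hr; rewrite -(ltrD2l `|c|) (lt_le_trans h)//.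
rewrite mulrC -normrZ -{1}[k *: x](addKr c) (le_trans (ler_normD _ _))//.
by rewrite normrN.
Qed.

(** In [pderivs] the last index is the innermost derivative; bringing it outside amounts to
    commuting mixed derivatives. *)
Lemma pderivs_rcons_out f s i : smooth f -> pderivs (rcons s i) f = pderiv i (pderivs s f).
Proof.
elim/last_ind: s f => // s j ih f sf.
rewrite pderivs_rcons [in LHS]pderivs_rcons schwarz// [in RHS]pderivs_rcons.
by rewrite -ih ?pderivs_rcons//; exact: smooth_pderiv.
Qed.

Lemma measurable_norm_le (r : R) : measurable [set x : E | `|x| <= r].
Proof.
have mn : measurable_fun setT (fun x : E => `|x|).
  by apply: continuous_measurable_cV; exact: norm_continuous.
rewrite (_ : [set _ | _] = (fun x : E => `|x|) @^-1` `]-oo, r]).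
  by rewrite -[X in measurable X]setTI; exact: mn.
by apply/seteqP; split => x /=; rewrite in_itv.
Qed.

Lemma bounded_cpt_intg f (K : R) : measurable_fun setT f -> cpt f ->
  (forall x, `|f x| <= K) -> intg mu f.
Proof.
move=> mf [r hr] fK.
have mB := measurable_norm_le r.
apply: (@intg_dom _ _ _ _ _ (fun x => K * \1_[set x : E | `|x| <= r] x)) => //.
  move=> x; rewrite indicE; have [xr|xr] := boolP (x \in _).
    by rewrite mulr1.
  rewrite hr ?normr0 ?mulr0//.
  by move: xr; rewrite notin_setE /= => /negP; rewrite -ltNge.
apply: intgZ; apply/integrableP; split; first exact/measurable_EFinP.
rewrite (eq_integral (fun x => (\1_[set x : E | `|x| <= r] x)%:E)) => [|x _ /=].
  by rewrite integral_indic// setIT mu_ball_lty.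
by rewrite ger0_norm.
Qed.

Lemma tf_intg f : tf f -> intg mu f.
Proof.
move=> h; have [K hK] := tf_bounded h; apply: (@bounded_cpt_intg _ K) => //.
  exact: tf_meas.
by case: h.
Qed.

End calculus_cV.

(** * Square-integrable functions and translations *)

Section real_fubini.
Context {d1 d2 : measure_display} {T1 : measurableType d1} {T2 : measurableType d2}.
Context {R : realType}.
Variable m1 : {sigma_finite_measure set T1 -> \bar R}.
Variable m2 : {sigma_finite_measure set T2 -> \bar R}.
Variable f : T1 * T2 -> R.
Hypothesis fi : (m1 \x m2)%E.-integrable setT (EFin \o f).

(** For almost every x the section is integrable, and there the real inner integral is the extended
    one. On the remaining null set [fine] may change the value. *)
Lemma Rfubini_aux1 : intg m1 (fun x => \int[m2]_y f (x, y)) /\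
  (\int[m1]_x (\int[m2]_y f (x, y))%:E = \int[m1]_x \int[m2]_y (f (x, y))%:E)%E.
Proof.
have mF := measurable_fubini_F fi.
have iF := integrable_fubini_F fi.
have ae1 : {ae m1, forall x, (\int[m2]_y f (x, y))%:E = fubini_F m2 (EFin \o f) x}.
  apply: filterS (ae_integrable1 fi) => x ix.
  by rewrite /Rintegral fineK//; exact: integrable_fin_num.
have mR : measurable_fun setT (fun x => \int[m2]_y f (x, y)).
  by apply: measurableT_comp mF; exact: fine_measurable.
split.
  apply/integrableP; split; first exact/measurable_EFinP.
  have /integrableP[_] := iF.
  rewrite (ae_eq_integral (fun x => `|fubini_F m2 (EFin \o f) x|)%E) //.
  - by apply: measurableT_comp => //; exact/measurable_EFinP.
  - exact: measurableT_comp.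
  - by apply: filterS ae1 => x e _; congr abse; exact: e.
apply: ae_eq_integral => //; first exact/measurable_EFinP.
by apply: filterS ae1 => x e _; exact: e.
Qed.

Lemma Rfubini_aux2 : intg m2 (fun y => \int[m1]_x f (x, y)) /\
  (\int[m2]_y (\int[m1]_x f (x, y))%:E = \int[m2]_y \int[m1]_x (f (x, y))%:E)%E.
Proof.
have mF := measurable_fubini_G fi.
have iF : m2.-integrable setT (fubini_G m1 (EFin \o f)).
  have mf := measurable_int _ fi.
  apply/integrableP; split; first exact: mF.
  apply: le_lt_trans ((integrable21ltyP _ _ mf).1 fi).
  apply: ge0_le_integral => //.
  - exact: measurableT_comp.
  - apply: (@measurable_fun_fubini_tonelli_G _ _ _ _ _ m1 (fun z => `|(EFin \o f) z|%E)) => //.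
    exact: measurableT_comp.
  - move=> y _; apply: le_abse_integral => //.
    by apply: (@measurableT_comp _ _ _ _ _ _ (EFin \o f) _ (fun x => (x, y))).
have ae1 : {ae m2, forall y, (\int[m1]_x f (x, y))%:E = fubini_G m1 (EFin \o f) y}.
  apply: filterS (ae_integrable2 fi) => x ix.
  by rewrite /Rintegral fineK//; exact: integrable_fin_num.
have mR : measurable_fun setT (fun y => \int[m1]_x f (x, y)).
  by apply: measurableT_comp mF; exact: fine_measurable.
split.
  apply/integrableP; split; first exact/measurable_EFinP.
  have /integrableP[_] := iF.
  rewrite (ae_eq_integral (fun x => `|fubini_G m1 (EFin \o f) x|)%E) //.
  - by apply: measurableT_comp => //; exact/measurable_EFinP.
  - exact: measurableT_comp.
  - by apply: filterS ae1 => x e _; congr abse; exact: e.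
apply: ae_eq_integral => //; first exact/measurable_EFinP.
by apply: filterS ae1 => x e _; exact: e.
Qed.

Lemma Rfubini :
  \int[m1]_x (\int[m2]_y f (x, y)) = \int[m2]_y (\int[m1]_x f (x, y)).
Proof.
have [_ e1] := Rfubini_aux1; have [_ e2] := Rfubini_aux2.
by rewrite [LHS]/Rintegral [RHS]/Rintegral e1 e2; congr fine; exact: (Fubini fi).
Qed.
End real_fubini.

Section product_integrable.
Context {d1 d2 : measure_display} {T1 : measurableType d1} {T2 : measurableType d2}.
Context {R : realType}.
Variable m1 : {sigma_finite_measure set T1 -> \bar R}.
Variable m2 : {sigma_finite_measure set T2 -> \bar R}.

Lemma prod_intg1 (g : T1 -> T2 -> R) (K : R) (h : T1 -> R) :
  measurable_fun setT (fun p : T1 * T2 => g p.1 p.2) ->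
  (forall x, intg m2 (g x)) -> (forall x, \int[m2]_y `|g x y| <= K) -> intg m1 h ->
  (m1 \x m2)%E.-integrable setT (EFin \o (fun p : T1 * T2 => h p.1 * g p.1 p.2)).
Proof.
move=> mg ig gK ih; have mh := intg_meas ih.
have mk : measurable_fun setT (fun p : T1 * T2 => h p.1 * g p.1 p.2).
  apply: measurable_funM => //.
  by apply: (@measurableT_comp _ _ _ _ _ _ h).
apply/(integrable12ltyP) => /=; first exact/measurable_EFinP.
have iN x : intg m2 (fun y => `|h x| * `|g x y|) by exact/intgZ/intg_norm.
have e : (fun x => \int[m2]_y `|(h x * g x y)%:E|)%E = fun x => (\int[m2]_y (`|h x| * `|g x y|))%:E.
  apply/funext => x; rewrite -intg_EFin//; apply: eq_integral => y _; by rewrite /= normrM.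
have mF : measurable_fun setT (fun x => \int[m2]_y `|(h x * g x y)%:E|)%E.
  apply: (@measurable_fun_fubini_tonelli_F _ _ _ _ _ m2 (fun p => `|(h p.1 * g p.1 p.2)%:E|)%E) => //.
  by apply: measurableT_comp => //; exact/measurable_EFinP.
rewrite (_ : (fun x : T1 => _) = fun x => \int[m2]_y `|(h x * g x y)%:E|)%E//.
rewrite e in mF *.
apply: le_lt_trans (_ : \int[m1]_x (K * `|h x|)%:E < +oo)%E.
  apply: ge0_le_integral => //.
  - by move=> x _; rewrite lee_fin; apply: int_ge0 => y; rewrite mulr_ge0.
  - by apply/measurable_EFinP; apply: measurable_funM => //; exact: measurableT_comp.
  - move=> x _; rewrite lee_fin intZ 1?mulrC; last exact: intg_norm.
    by apply: ler_wpM2r => //; exact: gK.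
by rewrite intg_EFin ?ltry//; exact/intgZ/intg_norm.
Qed.

Lemma prod_intg2 (g : T1 -> T2 -> R) (K : R) (h : T2 -> R) :
  measurable_fun setT (fun p : T1 * T2 => g p.1 p.2) ->
  (forall y, intg m1 (g ^~ y)) -> (forall y, \int[m1]_x `|g x y| <= K) -> intg m2 h ->
  (m1 \x m2)%E.-integrable setT (EFin \o (fun p : T1 * T2 => h p.2 * g p.1 p.2)).
Proof.
move=> mg ig gK ih; have mh := intg_meas ih.
have mk : measurable_fun setT (fun p : T1 * T2 => h p.2 * g p.1 p.2).
  apply: measurable_funM => //.
  by apply: (@measurableT_comp _ _ _ _ _ _ h).
apply/(integrable21ltyP) => /=; first exact/measurable_EFinP.
have iN x : intg m1 (fun y => `|h x| * `|g y x|).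
  by apply: intgZ; apply: intg_norm; exact: ig.
have e : (fun x => \int[m1]_y `|(h x * g y x)%:E|)%E = fun x => (\int[m1]_y (`|h x| * `|g y x|))%:E.
  apply/funext => x; rewrite -intg_EFin//; apply: eq_integral => y _; by rewrite /= normrM.
have mF : measurable_fun setT (fun x => \int[m1]_y `|(h x * g y x)%:E|)%E.
  apply: (@measurable_fun_fubini_tonelli_G _ _ _ _ _ m1 (fun p => `|(h p.2 * g p.1 p.2)%:E|)%E) => //.
  by apply: measurableT_comp => //; exact/measurable_EFinP.
rewrite (_ : (fun x : T2 => _) = fun x => \int[m1]_y `|(h x * g y x)%:E|)%E//.
rewrite e in mF *.
apply: le_lt_trans (_ : \int[m2]_x (K * `|h x|)%:E < +oo)%E.
  apply: ge0_le_integral => //.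
  - by move=> x _; rewrite lee_fin; apply: int_ge0 => y; rewrite mulr_ge0.
  - by apply/measurable_EFinP; apply: measurable_funM => //; exact: measurableT_comp.
  - move=> x _; rewrite lee_fin intZ 1?mulrC; last by apply: intg_norm; exact: ig.
    by apply: ler_wpM2r => //; exact: gK.
by rewrite intg_EFin ?ltry//; exact/intgZ/intg_norm.
Qed.

Lemma prod_intg_dom (f g : T1 * T2 -> R) : measurable_fun setT f ->
  (forall p, `|f p| <= g p) -> (m1 \x m2)%E.-integrable setT (EFin \o g) ->
  (m1 \x m2)%E.-integrable setT (EFin \o f).
Proof. by move=> mf fg ig; exact: (@intg_dom _ _ _ (m1 \x m2)%E). Qed.

End product_integrable.

Section measure_preserving.
Context {d1 d2 : measure_display} {T1 : measurableType d1} {T2 : measurableType d2}.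
Context {R : realType}.
Variables (m1 : {measure set T1 -> \bar R}) (m2 : {measure set T2 -> \bar R}).
Variable phi : T1 -> T2.
Hypothesis mphi : measurable_fun setT phi.
Hypothesis mp : forall A, measurable A -> m1 (phi @^-1` A) = m2 A.

Lemma ge0_integral_mp (f : T2 -> \bar R) : measurable_fun setT f ->
  (forall x, 0 <= f x)%E -> (\int[m1]_x f (phi x) = \int[m2]_x f x)%E.
Proof.
move=> mf f0.
have := @ge0_integral_pushforward _ _ _ _ R _ mphi m1 setT f measurableT mf (fun x _ => f0 x).
rewrite preimage_setT => <-.
by apply: eq_measure_integral => // A mA _; exact: mp.
Qed.

Lemma intg_mp (f : T2 -> R) : intg m2 f -> intg m1 (fun x => f (phi x)).
Proof.
move=> hf; have mf := intg_meas hf; apply/integrableP; split.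
  by apply/measurable_EFinP; apply: (@measurableT_comp _ _ _ _ _ _ f).
have /integrableP[_] := hf.
rewrite -(@ge0_integral_mp (fun x => `|(f x)%:E|%E)) //.
by apply/measurable_EFinP; apply: measurableT_comp.
Qed.

Lemma intg_mpV (f : T2 -> R) : measurable_fun setT f -> intg m1 (fun x => f (phi x)) -> intg m2 f.
Proof.
move=> mf hf; apply/integrableP; split; first exact/measurable_EFinP.
have /integrableP[_] := hf.
rewrite -(@ge0_integral_mp (fun x => `|(f x)%:E|%E)) //.
by apply/measurable_EFinP; apply: measurableT_comp.
Qed.

Lemma int_mp (f : T2 -> R) : measurable_fun setT f ->
  \int[m1]_x f (phi x) = \int[m2]_x f x.
Proof.
move=> mf; congr fine; rewrite [LHS]integralE [RHS]integralE; congr (_ - _)%E.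
  rewrite -(@ge0_integral_mp ((EFin \o f)^\+%E))//.
    by apply: eq_integral => x _; rewrite !funeposE.
  by apply: measurable_funepos; exact/measurable_EFinP.
rewrite -(@ge0_integral_mp ((EFin \o f)^\-%E))//.
  by apply: eq_integral => x _; rewrite !funenegE.
by apply: measurable_funeneg; exact/measurable_EFinP.
Qed.

Lemma sqint_mp (f : T2 -> R) : sqint m2 f -> sqint m1 (fun x => f (phi x)).
Proof.
move=> [mf hf]; split; first exact: (@measurableT_comp _ _ _ _ _ _ f).
exact: (intg_mp hf).
Qed.

End measure_preserving.

Section L2_induction.
Import HBNNSimple.
Context {dT : measure_display} {T : measurableType dT} {R : realType}.
Variable mu : {measure set T -> \bar R}.
Variable V : (T -> R) -> Prop.
Hypothesis V_sqint : forall f, V f -> sqint mu f.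
Hypothesis VD : forall f g, V f -> V g -> V (fun x => f x + g x).
Hypothesis VZ : forall k f, V f -> V (fun x => k * f x).
Hypothesis V_lim : forall (f_ : nat -> T -> R) f h, sqint mu h ->
  (forall k, V (f_ k)) -> (forall x, f_ k x @[k --> \oo] --> f x) ->
  (forall k x, `|f_ k x| <= h x) -> V f.

Lemma V_sum (I : Type) (s : seq I) (F : I -> T -> R) : V (fun=> 0) ->
  (forall i, V (F i)) -> V (fun x => \sum_(i <- s) F i x).
Proof.
move=> V0 VF; elim: s => [|i s ih].
  by rewrite (_ : (fun _ => _) = fun=> 0)//; apply/funext => x; rewrite big_nil.
rewrite (_ : (fun _ => _) = fun x => F i x + \sum_(i <- s) F i x); first exact: VD.
by apply/funext => x; rewrite big_cons.
Qed.

(* Intersections correspond to products, so no monotone class argument is needed. *)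
Lemma V_sigma_algebra (B : set T) : V (\1_B) ->
  (forall f g, (forall x, `|f x| <= 1) -> (forall x, `|g x| <= 1) -> V f -> V g ->
    V (fun x => f x * g x)) ->
  sigma_algebra setT [set A | V (\1_(A `&` B))].
Proof.
move=> VB VM.
have b1 (A : set T) x : `|\1_A x : R| <= 1.
  by rewrite indicE; case: (_ \in _); rewrite ?normr1 ?normr0.
have VC A : V (\1_(A `&` B)) -> V (\1_(~` A `&` B)).
  move=> VA; rewrite (_ : \1_(~` A `&` B) = fun x => \1_B x + (-1) * \1_(A `&` B) x).
    by apply: VD => //; exact: VZ.
  apply/funext => x; rewrite !indicE !in_setI in_setC mulN1r.
  by case: (x \in A); case: (x \in B); rewrite /= ?subrr ?subr0.
have VI A A' : V (\1_(A `&` B)) -> V (\1_(A' `&` B)) -> V (\1_(A `&` A' `&` B)).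
  move=> VA VA'.
  rewrite (_ : \1_(A `&` A' `&` B) = fun x => \1_(A `&` B) x * \1_(A' `&` B) x).
    exact: VM.
  apply/funext => x; rewrite !indicE !in_setI.
  by case: (x \in A); case: (x \in B); case: (x \in A'); rewrite /= ?mulr0 ?mul0r ?mulr1.
have V0 : V (\1_(set0 `&` B)) by rewrite -setCT; apply: VC; rewrite setTI.
split=> //=.
  by move=> A VA; rewrite setTD; exact: VC.
move=> A VA.
pose U k := \big[setU/set0]_(i < k) A i.
have VU k : V (\1_(U k `&` B)).
  rewrite /U; elim: k => [|k ih]; first by rewrite big_ord0.
  rewrite big_ord_recr /=.
  by rewrite -[X in X `&` B]setCK setCU; apply: (VC); apply: (VI); apply: (VC).
apply: (@V_lim (fun k => \1_(U k `&` B)) _ (\1_B)) => //; first exact: V_sqint.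
- move=> x; have [[N _ AN]|nA] := pselect ((\bigcup_k A k) x).
    apply: cvg_near_cst; exists N.+1 => // k /= Nk.
    rewrite !indicE !in_setI; congr (nat_of_bool (_ && _))%:R.
    by rewrite !mem_set//; [exists N|rewrite /U -bigcup_mkord; exists N].
  apply: cvg_near_cst; apply: nearW => k.
  rewrite !indicE !in_setI; congr (nat_of_bool (_ && _))%:R.
  rewrite !memNset// /U -bigcup_mkord => -[i _ Ai]; apply: nA; by exists i.
- move=> k x; rewrite !indicE in_setI; case: (x \in U k); case: (x \in B) => /=;
    by rewrite ?normr1 ?normr0.
Qed.

(** Positive and negative parts are dominated limits of simple functions cut off by [Bk]. The
    cut-off matters on a space of infinite measure, where the indicator of the whole space is not
    square integrable. V will be the continuity of translations and the approximability by
    trigonometric polynomials. *)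
Lemma L2_induction (Bk : nat -> set T) :
  (forall k A, measurable A -> V (\1_(A `&` Bk k))) ->
  (forall x, \forall k \near \oo, Bk k x) ->
  forall f, sqint mu f -> V f.
Proof.
move=> VB Bx.
have V0 : V (fun=> 0).
  rewrite (_ : (fun=> 0) = fun x => 0 * (\1_(setT `&` Bk 0%N) x : R)).
    by apply: VZ; exact: VB.
  by apply/funext => x; rewrite mul0r.
suff H f : (forall x, 0 <= f x) -> sqint mu f -> V f.
  move=> f hf; have [mf _] := hf.
  rewrite (_ : f = fun x => Num.max (f x) 0 + (-1) * Num.max (- f x) 0); last first.
    apply/funext => x; have [f0|f0] := leP 0 (f x).
      by rewrite (max_idPr _) ?oppr_le0// mulr0 addr0.
    by rewrite (max_idPl _) ?oppr_ge0 ?(ltW f0)// mulN1r opprK add0r.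
  apply: VD; last apply: VZ; apply: H => [x|]; rewrite ?le_max ?lexx ?orbT//.
    apply: sqint_dom hf _; first by apply: measurable_maxr.
    by move=> x; rewrite ger0_norm ?le_max ?lexx ?orbT// ge_max ler_norm normr_ge0.
  apply: sqint_dom hf _.
    by apply: measurable_maxr => //; exact: measurableT_comp.
  by move=> x; rewrite ger0_norm ?le_max ?lexx ?orbT// ge_max -normrN ler_norm normr_ge0.
move=> f0 hf; have [mf _] := hf.
have mEf : measurable_fun setT (EFin \o f) by exact/measurable_EFinP.
pose g := nnsfun_approx measurableT mEf.
have f0' x : setT x -> (0 <= (EFin \o f) x)%E by move=> _; rewrite lee_fin.
have cg x : g k x @[k --> \oo] --> f x.
  by have /fine_cvgP[] := cvg_nnsfun_approx measurableT mEf f0' (x := x) I.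
have gf k x : g k x <= f x.
  have -> : f x = limn (g ^~ x) by apply/esym/cvg_lim.
  apply: nondecreasing_cvgn_le; last by apply/cvg_ex; exists (f x).
  by move=> m n mn; have /lefP := nd_nnsfun_approx measurableT mEf mn; apply.
apply: (@V_lim (fun k x => g k x * \1_(Bk k) x) f f) => //.
- move=> k.
  under eq_fun do rewrite {1}(fimfunE (g k)) fsbig_finite//= mulr_suml.
  apply: V_sum => // y.
  rewrite (_ : (fun _ => _) = fun x => y * \1_((g k) @^-1` [set y] `&` Bk k) x).
    apply: VZ; apply: VB.
    by rewrite -[X in measurable X]setTI; exact: measurable_funP.
  by apply/funext => x; rewrite -mulrA indicI.
- move=> x; rewrite -[f x]mulr1; apply: cvgM => //.
  apply: cvg_near_cst; apply: filterS (Bx x) => k Bkx.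
  by rewrite indicE mem_set.
- move=> k x; rewrite normrM indicE; case: (_ \in _).
    by rewrite normr1 mulr1 ger0_norm.
  by rewrite normr0 mulr0.
Qed.

End L2_induction.

Section sqnorm.
Context {dT : measure_display} {T : measurableType dT} {R : realType}.
Variable mu : {measure set T -> \bar R}.
Implicit Types f g : T -> R.

Lemma sqintB f g : sqint mu f -> sqint mu g -> sqint mu (fun x => f x - g x).
Proof.
by move=> hf hg; apply: sqint_ext (sqintD hf (sqintZ (-1) hg)) => x; rewrite mulN1r.
Qed.

Definition sqnorm f : R := \int[mu]_x f x ^+ 2.

Lemma sqnorm_ge0 f : 0 <= sqnorm f.
Proof. by apply: int_ge0 => x; rewrite sqr_ge0. Qed.

Lemma sqnormD f g : sqint mu f -> sqint mu g ->
  sqnorm (fun x => f x + g x) <= 2 * sqnorm f + 2 * sqnorm g.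
Proof.
move=> hf hg; have [mf if_] := hf; have [mg ig] := hg.
rewrite /sqnorm -!intZ// -intD; [|exact: intgZ|exact: intgZ].
apply: int_le; first by case: (sqintD hf hg).
  by apply: intgD; exact: intgZ.
by move=> x; have := sqr_ge0 (f x - g x); nra.
Qed.

Lemma sqnorm_dom f g : sqint mu f -> sqint mu g -> (forall x, `|f x| <= `|g x|) ->
  sqnorm f <= sqnorm g.
Proof.
move=> [mf hf] [mg hg] fg; apply: int_le => // x.
by rewrite -(real_normK (num_real (f x))) -(real_normK (num_real (g x))) lerXn2r ?nnegrE.
Qed.

Lemma sqnormZ k f : sqint mu f -> sqnorm (fun x => k * f x) = k ^+ 2 * sqnorm f.
Proof.
by move=> [mf hf]; rewrite /sqnorm -intZ//; apply: int_ext => x; rewrite exprMn.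
Qed.

Lemma dominated_sqnorm (f_ : nat -> T -> R) f h : sqint mu h ->
  (forall k, measurable_fun setT (f_ k)) -> (forall x, f_ k x @[k --> \oo] --> f x) ->
  (forall k x, `|f_ k x| <= h x) ->
  sqint mu f /\ sqnorm (fun x => f x - f_ k x) @[k --> \oo] --> (0 : R).
Proof.
move=> hh Hf cf fh.
have fh' x : `|f x| <= h x.
  have cn : `|f_ k x| @[k --> \oo] --> `|f x| by apply: cvg_norm; exact: cf.
  rewrite -(cvg_lim _ cn)//; apply: limr_le; last exact: nearW.
  by apply/cvg_ex; exists `|f x|.
have h0 x : 0 <= h x by rewrite (le_trans _ (fh' x)).
have mf : measurable_fun setT f.
  by apply: (measurable_fun_cvg (h := f_)) => [k|x _]; [exact: Hf|exact: cf].
split; first by apply: sqint_dom hh _ => // x; rewrite (ger0_norm (h0 x)).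
rewrite -[X in _ --> X](int0 mu); have [_ ih] := hh.
apply: (@cvg_int _ _ _ mu _ _ (fun x => 4 * h x ^+ 2)).
- by move=> k; apply: measurable_funX; apply: measurable_funB.
- move=> x; rewrite (_ : 0 = (f x - f x) ^+ 2); last by rewrite subrr expr0n.
  apply: (@cvg_comp _ _ _ _ (fun u : R => u ^+ 2) _ (nbhs (f x - f x))); last exact: exprn_continuous.
  by apply: cvgB => //; exact: cvg_cst.
- move=> k x; rewrite normrX (_ : 4 * h x ^+ 2 = (h x + h x) ^+ 2); last by ring.
  by rewrite lerXn2r ?nnegrE ?addr_ge0// (le_trans (ler_normB _ _))// lerD.
- exact: intgZ.
Qed.

End sqnorm.

Section translation.
Context {R : realType} {d : nat}.
Local Notation E := 'cV[R]_d.
Local Notation mu := (lebesgue_cV d).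
Implicit Types (f g F : E -> R) (x y z : E).

Lemma intg_shift f z : intg mu f -> intg mu (fun x => f (x + z)).
Proof.
move=> hf; apply: intg_ext (intg_affine z (s := 1) _ hf); last by rewrite eqxx.
by move=> x; rewrite scale1r addrC.
Qed.

Lemma int_shift f z : intg mu f -> \int[mu]_x f (x + z) = \int[mu]_x f x.
Proof.
move=> hf; rewrite -[RHS](int_affine z (s := 1) _ hf); last by rewrite eqxx.
by apply: int_ext => x; rewrite scale1r addrC.
Qed.

Lemma meas_shift f z : measurable_fun setT f -> measurable_fun setT (fun x => f (x + z)).
Proof.
move=> mf; rewrite (_ : (fun _ => _) = f \o (fun x => z + 1 *: x)); last first.
  by apply/funext => x; rewrite /= scale1r addrC.
by apply: measurableT_comp => //; exact: measurable_affine.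
Qed.

Lemma sqint_shift f z : sqint mu f -> sqint mu (fun x => f (x + z)).
Proof.
move=> [mf hf]; split; first exact: meas_shift.
exact: (intg_shift z hf).
Qed.

Local Notation nrm2 := (sqnorm mu).

Definition tcont f := forall e : R, 0 < e -> exists2 del : R, 0 < del &
  forall z, `|z| < del -> nrm2 (fun x => f (x + z) - f x) <= e.

Lemma tcont_lim f : sqint mu f ->
  (forall e : R, 0 < e -> exists g, [/\ sqint mu g, tcont g & nrm2 (fun x => f x - g x) <= e]) ->
  tcont f.
Proof.
move=> hf H e e0.
(* The squared norm of the sum of three terms is at most twice that of the first plus four times
   those of the other two, which makes 10. *)
have e8 : 0 < e / 10 by rewrite divr_gt0.
have [g [hg tg fg]] := H _ e8.
have [del del0 hd] := tg _ e8.
exists del => // z zd.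
have h1 : sqint mu (fun x => f x - g x) by exact: sqintB.
have h2 := sqint_shift z h1.
have h3 : sqint mu (fun x => g (x + z) - g x) by apply: sqintB => //; exact: sqint_shift.
have h4 : sqint mu (fun x => g x - f x) by exact: sqintB.
have -> : (fun x => f (x + z) - f x) =
   (fun x => (f (x + z) - g (x + z)) + ((g (x + z) - g x) + (g x - f x))).
  by apply/funext => x; ring.
apply: le_trans (sqnormD h2 (sqintD h3 h4)) _.
have e1 : nrm2 (fun x => f (x + z) - g (x + z)) <= e / 10.
  by rewrite /nrm2 (@int_shift (fun x => (f x - g x) ^+ 2))//; case: h1.
have e2 : nrm2 (fun x => g x - f x) <= e / 10.
  by apply: le_trans fg; rewrite /nrm2; under int_ext do rewrite -sqrrN opprB.
have e3 := hd _ zd.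
have := sqnormD h3 h4.
lra.
Qed.

(** Dominated convergence is sequential, so a failure is turned into a sequence of shifts of size at
    most 1 / (k + 1). As these are at most 1, the differences are dominated by 2 K on the ball of
    radius r + 1. *)
Lemma tcont_continuous f : continuous f -> cpt f -> tcont f.
Proof.
move=> cf cptf e e0; apply: contrapT => nH.
have H (k : nat) : exists z, `|z| < k.+1%:R^-1 /\ e < nrm2 (fun x => f (x + z) - f x).
  apply: contrapT => nk; apply: nH; exists (k.+1%:R^-1); first by rewrite invr_gt0.
  move=> z hz; rewrite leNgt; apply/negP => ez; apply: nk; by exists z.
have [z_ hz] := choice H.
have [K hK] := cpt_bounded cf cptf.
have [r hr] := cptf.
have zc : z_ k @[k --> \oo] --> (0 : E).
  apply/cvgr0Pnorm_lt => e' e'0; near=> k.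
  have [h _] := hz k; apply: lt_trans h _.
  by near: k; exact: (near_infty_natSinv_lt (PosNum e'0)).
have iB : intg mu (fun x => (2 * K) ^+ 2 * \1_[set x : E | `|x| <= r + 1] x).
  apply: intgZ; apply: (@bounded_cpt_intg _ _ _ 1).
  - by apply: measurable_indic; exact: measurable_norm_le.
  - exists (r + 1) => x; rewrite ltNge => /negP h; rewrite indicE memNset//.
  - by move=> x; rewrite indicE; case: (_ \in _); rewrite ?normr1 ?normr0.
have mf := continuous_measurable_cV cf.
have : nrm2 (fun x => f (x + z_ k) - f x) @[k --> \oo] --> \int[mu]_x (0 : R).
  apply: (@cvg_int _ _ _ mu _ _ _ _ _ _ iB).
  - move=> k; apply: measurable_funX; apply: measurable_funB => //; exact: meas_shift.
  - move=> x; rewrite (_ : 0 = (f x - f x) ^+ 2); last by rewrite subrr expr0n.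
    apply: (@cvg_comp _ _ _ _ (fun u : R => u ^+ 2) _ (nbhs (f x - f x))); last exact: exprn_continuous.
    apply: cvgB; last exact: cvg_cst.
    apply: (@cvg_comp _ _ _ (fun k => x + z_ k) f _ (nbhs x)); last exact: cf.
    have : x + z_ k @[k --> \oo] --> x + 0 by apply: cvgD => //; exact: cvg_cst.
    by rewrite addr0.
  - move=> k x; rewrite normrX indicE.
    have [xr|xr] := boolP (x \in _).
      rewrite mulr1 lerXn2r ?nnegrE//; first by rewrite mulr_ge0// (le_trans _ (hK 0)).
      by rewrite (le_trans (ler_normB _ _))// mulr2n mulrDl mul1r lerD.
    have x1 : r + 1 < `|x|.
      by move: xr; rewrite notin_setE /= => /negP; rewrite -ltNge.
    rewrite mulr0 (hr x) ?(lt_trans _ x1) ?ltrDl// hr ?subrr ?normr0 ?expr0n//.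
    have [h _] := hz k.
    have h1 : `|z_ k| <= 1 by rewrite (le_trans (ltW h))// invf_le1 ?ltr0n// ler1n.
    have h2 := ler_normB (x + z_ k) (z_ k); rewrite addrK in h2.
    lra.
rewrite int0 => /cvgr0Pnorm_lt /(_ _ e0) [N _ /(_ N (leqnn N))].
have [_ h] := hz N; rewrite /= ger0_norm ?sqnorm_ge0// => h'.
by move: (lt_trans h h'); rewrite ltxx.
Unshelve. all: end_near. Qed.


Lemma tcontD f g : sqint mu f -> sqint mu g -> tcont f -> tcont g -> tcont (fun x => f x + g x).
Proof.
move=> hf hg tf_ tg e e0.
have e4 : 0 < e / 4 by rewrite divr_gt0.
have [d1 d10 h1] := tf_ _ e4; have [d2 d20 h2] := tg _ e4.
exists (Num.min d1 d2); first by rewrite lt_min d10.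
move=> z; rewrite lt_min => /andP[z1 z2].
rewrite (_ : (fun x => _) = fun x => (f (x + z) - f x) + (g (x + z) - g x)); last first.
  by apply/funext => x; ring.
apply: le_trans (sqnormD (sqintB (sqint_shift z hf) hf) (sqintB (sqint_shift z hg) hg)) _.
have := h1 _ z1; have := h2 _ z2; lra.
Qed.

Lemma tcontZ k f : sqint mu f -> tcont f -> tcont (fun x => k * f x).
Proof.
move=> hf tf_ e e0.
have e4 : 0 < e / (k ^+ 2 + 1) by rewrite divr_gt0// ltr_wpDl ?sqr_ge0.
have [d1 d10 h1] := tf_ _ e4; exists d1 => // z /h1.
rewrite (_ : (fun x => k * f (x + z) - _) = fun x => k * (f (x + z) - f x)); last first.
  by apply/funext => x; rewrite mulrBr.
rewrite sqnormZ; last by apply: sqintB => //; exact: sqint_shift.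
rewrite ler_pdivlMr ?ltr_wpDl ?sqr_ge0//.
have := sqnorm_ge0 mu (fun x => f (x + z) - f x); have := sqr_ge0 k; nra.
Qed.

Lemma tcontM f g : (forall x, `|f x| <= 1) -> (forall x, `|g x| <= 1) ->
  sqint mu f -> sqint mu g -> tcont f -> tcont g -> tcont (fun x => f x * g x).
Proof.
move=> f1 g1 hf hg tf_ tg e e0; have [mf _] := hf; have [mg _] := hg.
have e4 : 0 < e / 4 by rewrite divr_gt0.
have [d1 d10 h1] := tf_ _ e4; have [d2 d20 h2] := tg _ e4.
exists (Num.min d1 d2); first by rewrite lt_min d10.
move=> z; rewrite lt_min => /andP[z1 z2].
rewrite (_ : (fun x => _) = fun x => f (x + z) * (g (x + z) - g x) + g x * (f (x +
  z) - f x)); last first.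
  by apply/funext => x; ring.
have k1 := sqintB (sqint_shift z hg) hg; have k2 := sqintB (sqint_shift z hf) hf.
have s1 : sqint mu (fun x => f (x + z) * (g (x + z) - g x)).
  by apply: (@sqint_bndM _ _ _ _ 1) => //; exact: meas_shift.
have s2 : sqint mu (fun x => g x * (f (x + z) - f x)).
  by apply: (@sqint_bndM _ _ _ _ 1).
apply: le_trans (sqnormD s1 s2) _.
have n1 : nrm2 (fun x => f (x + z) * (g (x + z) - g x)) <= e / 4.
  apply: le_trans (h2 _ z2); apply: sqnorm_dom => // x.
  by rewrite normrM ler_piMl.
have n2 : nrm2 (fun x => g x * (f (x + z) - f x)) <= e / 4.
  apply: le_trans (h1 _ z1); apply: sqnorm_dom => // x.
  by rewrite normrM ler_piMl.
lra.
Qed.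

Lemma tcont_dlim (f_ : nat -> E -> R) f h : sqint mu h ->
  (forall k, sqint mu (f_ k) /\ tcont (f_ k)) -> (forall x, f_ k x @[k --> \oo] --> f x) ->
  (forall k x, `|f_ k x| <= h x) -> sqint mu f /\ tcont f.
Proof.
move=> hh Hf cf fh.
have mf k : measurable_fun setT (f_ k) by case: (Hf k) => -[].
have [sf cv] := dominated_sqnorm hh mf cf fh.
split=> //; apply: tcont_lim => // e e0.
have := cv => /cvgr0Pnorm_lt /(_ _ e0) [N _ /(_ N (leqnn N)) /=].
have [h1 h2] := Hf N; exists (f_ N); split => //.
by apply/ltW/(le_lt_trans (ler_norm _)).
Qed.

(* The ramps (1 - m h^+)^+ decrease to the indicator of [h <= 0]. *)
Lemma tcont_closed (h : E -> R) (r : R) : continuous h ->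
  sqint mu (\1_([set x | h x <= 0] `&` [set x | `|x| <= r])) /\
  tcont (\1_([set x | h x <= 0] `&` [set x | `|x| <= r])).
Proof.
move=> ch.
pose rp (u : R) (m : nat) := Num.max (1 - m%:R * Num.max u 0) 0.
have rp1 u m : `|rp u m| <= 1.
  rewrite ger0_norm; last by rewrite le_max lexx orbT.
  by rewrite ge_max ler01 andbT gerBl mulr_ge0// le_max lexx orbT.
have rp_le u m : u <= 0 -> rp u m = 1.
  by move=> u0; rewrite /rp (max_idPr u0) mulr0 subr0 (max_idPl _).
have rp_gt u m : 0 < u -> u^-1 <= m%:R -> rp u m = 0.
  move=> u0 um; rewrite /rp (max_idPl (ltW u0)) (max_idPr _)//.
  by rewrite subr_le0 -ler_pdivrMr// div1r.
have cmax0 : continuous (fun u : R => Num.max u 0).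
  move=> u; apply: (continuous_max (f := fun u => u) (g := fun=> 0)).
    exact: cvg_id.
  exact: cst_continuous.
have crp m : continuous (rp ^~ m).
  have c1 : continuous (fun u : R => 1 - m%:R * Num.max u 0).
    move=> u; apply: cvgB; first exact: cvg_cst.
    by apply: cvgM; [exact: cvg_cst|exact: cmax0].
  by move=> u; exact: (continuous_comp (c1 u) (cmax0 _)).
have rp_cvg u : rp u m @[m --> \oo] --> ((u <= 0)%R%:R : R).
  have [u0|u0] := leP u 0.
    by apply: cvg_near_cst; apply: nearW => m; exact: rp_le.
  apply: cvg_near_cst; near=> m; apply: rp_gt => //.
  by near: m; exact: nbhs_infty_ger.
pose h2 (x : E) : R := `|x| - r.
have ch2 : continuous h2.
  have cn : continuous (fun x : E => `|x|) by exact: norm_continuous.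
  have cc : continuous (fun _ : E => r) by exact: cst_continuous.
  by move=> x; exact: (continuousB (cn x) (cc x)).
pose f m x := rp (h x) m * rp (h2 x) m.
have cf m : continuous (f m.+1).
  have cc (u : E -> R) : continuous u -> continuous (fun x => rp (u x) m.+1).
    by move=> cu x; exact: (continuous_comp (cu x) (crp m.+1 _)).
  by apply: continuous_mul; exact: cc.
have cptf m : cpt (f m.+1).
  exists (r + 1) => x xr; rewrite /f [X in _ * X]rp_gt ?mulr0//.
    by rewrite subr_gt0 (lt_trans _ xr)// ltrDl.
  rewrite (@le_trans _ _ 1)// ?ler1n// invf_le1 /h2; lra.
apply: (@tcont_dlim (fun m => f m.+1) _ (\1_[set x | `|x| <= r + 1])).
- split; first by apply: measurable_indic; exact: measurable_norm_le.
  apply: (@bounded_cpt_intg _ _ _ 1).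
  + by apply: measurable_funX; apply: measurable_indic; exact: measurable_norm_le.
  + exists (r + 1) => x; rewrite ltNge => /negP h'; by rewrite indicE memNset// expr0n.
  + by move=> x; rewrite indicE; case: (_ \in _); rewrite ?expr1n ?expr0n ?normr1 ?normr0.
- move=> m; split; last exact: tcont_continuous.
  have [L hL] := cpt_bounded (cf m) (cptf m).
  split; first exact: continuous_measurable_cV.
  apply: (@bounded_cpt_intg _ _ _ (L ^+ 2)).
  + by apply: measurable_funX; exact: continuous_measurable_cV.
  + by have [s hs] := cptf m; exists s => x /hs ->; rewrite expr0n.
  + by move=> x; rewrite normrX lerXn2r ?nnegrE// (le_trans _ (hL x)).
- move=> x; rewrite indicE in_setI.
  have -> : ((x \in [set x | h x <= 0]) && (x \in [set x : E | `|x| <= r]))%:R =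
    ((h x <= 0)%R%:R * (h2 x <= 0)%R%:R : R).
    rewrite -natrM mulnb subr_le0; congr (nat_of_bool (_ && _))%:R; apply/idP/idP;
      by rewrite inE.
  by rewrite (cvg_shiftS (fun m => f m x)); apply: cvgM; exact: rp_cvg.
- move=> m x; rewrite indicE; have [xr|xr] := boolP (x \in _).
    by rewrite normrM mulr_ile1.
  rewrite /f [X in _ * X]rp_gt ?mulr0 ?normr0//;
    move: xr; rewrite notin_setE /= => /negP; rewrite -ltNge /h2 => xr; first lra.
  by rewrite (@le_trans _ _ 1)// ?ler1n// invf_le1; lra.
Unshelve. all: end_near. Qed.

(** Translations are continuous in L^2. By [L2_induction] and [V_sigma_algebra] it is enough to
    treat coordinate half-spaces cut off by a ball, which is [tcont_closed]. *)
Lemma sqint_tcont f : sqint mu f -> tcont f.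
Proof.
move=> hf; pose V f := sqint mu f /\ tcont f.
have VM f1 f2 : (forall x, `|f1 x| <= 1) -> (forall x, `|f2 x| <= 1) -> V f1 -> V f2 ->
    V (fun x => f1 x * f2 x).
  move=> fle gle [sf tf_] [sg tg]; split; last exact: tcontM.
  by apply: (@sqint_bndM _ _ _ _ 1) => //; case: sf.
have VD f1 f2 : V f1 -> V f2 -> V (fun x => f1 x + f2 x).
  by move=> [? ?] [? ?]; split; [exact: sqintD|exact: tcontD].
have VZ k f1 : V f1 -> V (fun x => k * f1 x).
  by move=> [? ?]; split; [exact: sqintZ|exact: tcontZ].
pose Bk (k : nat) := [set x : E | `|x| <= k%:R].
suff : V f by case.
apply: (@L2_induction _ _ _ mu V VD VZ _ Bk) => //.
- by move=> f_ f' h sh Vf cf fh; exact: (tcont_dlim sh Vf cf fh).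
- move=> k.
  have VB : V (\1_(Bk k)).
    have c0 : continuous (fun _ : E => 0 : R) by exact: cst_continuous.
    by have := @tcont_closed (fun=> 0) k%:R c0;
      rewrite (_ : [set _ | 0 <= 0] = setT) ?setTI//; apply/seteqP; split => x //=; rewrite lexx.
  have sa : sigma_algebra setT [set A | V (\1_(A `&` Bk k))].
    apply: (@V_sigma_algebra _ _ _ mu V) => //; first by move=> f1 [].
    by move=> f_ f' h sh Vf cf fh; exact: (tcont_dlim sh Vf cf fh).
  set S := [set A | _] in sa.
  have cS i : measurable_fun (setT : set (g_sigma_algebraType S)) (fun x : E => x i 0 : R).
    apply: (measurability _ (RGenCInfty.measurableE R)) => _ [_ [a ->] <-].
    rewrite setTI; apply: sub_sigma_algebra; rewrite /S /=.
    have := @tcont_closed (fun x : E => a - x i 0) k%:R.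
    rewrite (_ : [set x | _ <= 0] = (fun x : E => x i 0) @^-1` `[a, +oo[); last first.
      by apply/seteqP; split => x; rewrite /= in_itv /= andbT subr_le0.
    apply=> x; apply: (@continuousB _ _ _ (fun=> a)); first exact: cst_continuous.
    exact: coord_continuous.
  move=> A mA; suff : S A by [].
  apply: (smallest_sub sa) mA.
  rewrite -bigcup_seq; apply: bigcup_sub => i _ _ [B mB <-].
  have := cS i measurableT _ mB.
  by rewrite /measurable /= sigma_algebra_id.
- move=> x; near=> k; rewrite /Bk /=; near: k; exact: nbhs_infty_ger.
Unshelve. all: end_near. Qed.

End translation.

(** * Weak gradients *)

Section mollification.
Context {R : realType} {d : nat}.
Local Notation E := 'cV[R]_d.
Local Notation mu := (lebesgue_cV d).
Implicit Types (f g F rho b v : E -> R) (x y z : E).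

Lemma measurable_sub2 : measurable_fun setT (fun p : E * E => p.1 - p.2).
Proof.
apply: measurable_fun_cV => i.
rewrite (_ : (fun _ => _) = fun p : E * E => p.1 i 0 - p.2 i 0).
  apply: measurable_funB.
    by apply: (@measurableT_comp _ _ _ _ _ _ (fun x : E => x i 0)) => //; exact: measurable_coord.
  by apply: (@measurableT_comp _ _ _ _ _ _ (fun x : E => x i 0)) => //; exact: measurable_coord.
by apply/funext => p; rewrite !mxE.
Qed.

Lemma normM_le_sq (a b c : R) : `|a * b * c| <= a ^+ 2 * `|c| + b ^+ 2 * `|c|.
Proof.
rewrite !normrM -(real_normK (num_real a)) -(real_normK (num_real b)) -mulrDl.
by rewrite ler_wpM2r//; have := normr_ge0 a; have := normr_ge0 b; nra.
Qed.

Let sgnN1 : ((-1 : R) == 1) || ((-1 : R) == -1). Proof. by rewrite eqxx orbT. Qed.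

Lemma intg_subl f x : intg mu f -> intg mu (fun y => f (x - y)).
Proof.
by move=> hf; apply: intg_ext (intg_affine x sgnN1 hf) => y; rewrite scaleN1r.
Qed.

Lemma int_subl f x : intg mu f -> \int[mu]_y f (x - y) = \int[mu]_y f y.
Proof.
move=> hf; rewrite -[RHS](int_affine x sgnN1 hf); apply: int_ext => y.
by rewrite scaleN1r.
Qed.

Lemma intg_subr f y : intg mu f -> intg mu (fun x => f (x - y)).
Proof. by move=> hf; exact: (intg_shift (- y) hf). Qed.

Lemma int_subr f y : intg mu f -> \int[mu]_x f (x - y) = \int[mu]_x f x.
Proof. by move=> hf; exact: (int_shift (- y) hf). Qed.

(** The integrand is dominated by F^2 |rho| + f^2 |rho|, and the L^1 norm of rho (x - y) in either
    variable does not depend on the other one. *)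
Lemma conv2_intg F f rho : sqint mu F -> sqint mu f -> intg mu rho ->
  (mu \x mu)%E.-integrable setT
    (EFin \o (fun p : E * E => F p.1 * f p.2 * rho (p.1 - p.2))).
Proof.
move=> [mF iF] [mf if_] ir; have mr := intg_meas ir.
have mr2 : measurable_fun setT (fun p : E * E => `|rho (p.1 - p.2)|).
  apply: measurableT_comp => //.
  by apply: (@measurableT_comp _ _ _ _ _ _ rho) => //; exact: measurable_sub2.
apply: (@prod_intg_dom _ _ _ _ _ _ _ _ (fun p : E * E => F p.1 ^+ 2 * `|rho (p.1 - p.2)| +
  f p.2 ^+ 2 * `|rho (p.1 - p.2)|)).
- apply: measurable_funM; first apply: measurable_funM.
  + by apply: (@measurableT_comp _ _ _ _ _ _ F).
  + by apply: (@measurableT_comp _ _ _ _ _ _ f).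
  + by apply: (@measurableT_comp _ _ _ _ _ _ rho) => //; exact: measurable_sub2.
- by move=> p; exact: normM_le_sq.
- apply: (@intgD _ _ _ (mu \x mu)%E).
    apply: (@prod_intg1 _ _ _ _ _ _ _ (fun x y => `|rho (x - y)|) (\int[mu]_y `|rho y|)
      (fun x => F x ^+ 2)) => // x.
      by apply: (@intg_subl (fun y => `|rho y|)); exact: intg_norm.
    by apply: eqW; under int_ext do rewrite normr_id; apply: (@int_subl (fun y => `|rho y|));
      exact: intg_norm.
  apply: (@prod_intg2 _ _ _ _ _ _ _ (fun x y => `|rho (x - y)|) (\int[mu]_y `|rho y|)
      (fun x => f x ^+ 2)) => // x.
    by apply: (@intg_subr (fun y => `|rho y|)); exact: intg_norm.
  by apply: eqW; under int_ext do rewrite normr_id; apply: (@int_subr (fun y => `|rho y|));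
    exact: intg_norm.
Qed.

(** The pairing of F with the convolution of f and rho. *)
Definition conv2 F f rho : R := \int[mu]_x \int[mu]_y (F x * f y * rho (x - y)).

Lemma conv2_swap F f rho : sqint mu F -> sqint mu f -> intg mu rho ->
  conv2 F f rho = \int[mu]_y \int[mu]_x (F x * f y * rho (x - y)).
Proof. by move=> hF hf hr; exact: (Rfubini (conv2_intg hF hf hr)). Qed.

Lemma corr_intg F f rho : sqint mu F -> sqint mu f -> intg mu rho ->
  (mu \x mu)%E.-integrable setT
    (EFin \o (fun p : E * E => F p.1 * f (p.1 - p.2) * rho p.2)).
Proof.
move=> [mF iF] [mf if_] ir; have mr := intg_meas ir.
have mf2 : measurable_fun setT (fun p : E * E => f (p.1 - p.2)).
  by apply: (@measurableT_comp _ _ _ _ _ _ f) => //; exact: measurable_sub2.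
apply: (@prod_intg_dom _ _ _ _ _ _ _ _ (fun p : E * E => `|rho p.2| * F p.1 ^+ 2 +
  `|rho p.2| * f (p.1 - p.2) ^+ 2)).
- apply: measurable_funM; first apply: measurable_funM => //.
  + by apply: (@measurableT_comp _ _ _ _ _ _ F).
  + by apply: (@measurableT_comp _ _ _ _ _ _ rho).
- by move=> p; have := normM_le_sq (F p.1) (f (p.1 - p.2)) (rho p.2); rewrite ![_ * `|rho p.2|]mulrC.
- have ns (u : R) : `|u ^+ 2| = u ^+ 2 by rewrite ger0_norm ?sqr_ge0.
  apply: (@intgD _ _ _ (mu \x mu)%E).
    apply: (@prod_intg2 _ _ _ _ _ _ _ (fun x y => F x ^+ 2) (\int[mu]_y F y ^+ 2)
      (fun y => `|rho y|)) => //; last exact: intg_norm.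
    + by apply: measurable_funX; apply: (@measurableT_comp _ _ _ _ _ _ F).
    + by move=> y; apply: eqW; under int_ext do rewrite ns.
  apply: (@prod_intg2 _ _ _ _ _ _ _ (fun x y => f (x - y) ^+ 2) (\int[mu]_y f y ^+ 2)
      (fun y => `|rho y|)) => //; last exact: intg_norm.
  + exact: measurable_funX.
  + by move=> y; apply: (@intg_subr (fun x => f x ^+ 2)).
  + by move=> y; apply: eqW; under int_ext do rewrite ns; apply: (@int_subr (fun x => f x ^+ 2)).
Qed.

(** The cross-correlation of F and f. Paired with rho it gives [conv2], which reduces mollification
    to continuity at z = 0. *)
Definition corr F f z : R := \int[mu]_x (F x * f (x - z)).

Lemma corr_mul_intg F f rho : sqint mu F -> sqint mu f -> intg mu rho ->
  intg mu (fun z => corr F f z * rho z).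
Proof.
move=> hF hf hr.
have [h _] := Rfubini_aux2 (corr_intg hF hf hr).
apply: intg_ext h => z; rewrite /corr /= -[RHS]mulrC -intZ.
  by apply: int_ext => x; rewrite mulrC.
by apply: sqint_mul => //; exact: (sqint_shift (- z) hf).
Qed.

Lemma conv2E F f rho : sqint mu F -> sqint mu f -> sqint mu rho -> intg mu rho ->
  conv2 F f rho = \int[mu]_z (corr F f z * rho z).
Proof.
move=> hF hf hr2 hr.
transitivity (\int[mu]_x \int[mu]_z (F x * f (x - z) * rho z)).
  apply: int_ext => x.
  have : intg mu (fun y => F x * f y * rho (x - y)).
    have h : sqint mu (fun y => rho (x - y)).
      have [mr ir] := hr2; split; last exact: (@intg_subl (fun y => rho y ^+ 2)).
      by apply: (@intg_meas _ _ _ mu); exact: intg_subl.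
    by apply: intg_ext (intgZ (F x) (sqint_mul hf h)) => y; rewrite mulrA.
  move=> /(int_subl x) <-; apply: int_ext => z.
  by rewrite opprB addrCA subrr addr0.
rewrite (Rfubini (corr_intg hF hf hr)); apply: int_ext => z /=.
rewrite [RHS]mulrC -intZ.
  by apply: int_ext => x; rewrite mulrC.
by apply: sqint_mul => //; exact: (sqint_shift (- z) hf).
Qed.

(** Cauchy-Schwarz and the continuity of translations in L^2. *)
Lemma corr_continuous0 F f : sqint mu F -> sqint mu f ->
  forall e, 0 < e -> exists2 del : R, 0 < del &
    forall z, `|z| < del -> `|corr F f z - corr F f 0| <= e.
Proof.
move=> hF hf e e0.
have N0 := sqnorm_ge0 mu F.
have e1 : 0 < e ^+ 2 / (sqnorm mu F + 1) by rewrite divr_gt0 ?exprn_gt0// ltr_wpDl.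
have [del del0 hd] := sqint_tcont hf e1.
exists del => // z zd.
have hfz := sqint_shift (- z) hf.
have hd' := sqintB hfz hf.
have -> : corr F f z - corr F f 0 = \int[mu]_x (F x * (f (x - z) - f x)).
  rewrite /corr -intB; [|exact: sqint_mul|].
    by apply: int_ext => x; rewrite subr0 mulrBr.
  by under eq_fun do rewrite subr0; exact: sqint_mul.
have := int_mul_sq_le hF hd'.
have := hd (- z); rewrite normrN => /(_ zd); rewrite -/(sqnorm mu F) -/(sqnorm mu _).
rewrite ler_pdivlMr ?ltr_wpDl// => h1 h2.
rewrite -(ler_pXn2r (n := 2))// ?nnegrE// ?(ltW e0)//.
rewrite real_normK ?num_real//.
have := sqnorm_ge0 mu (fun x => f (x - z) - f x); nra.
Qed.

(** The mollifiers come from an arbitrary test function and are not normalized; the integral of rho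
    stays as a factor on both sides. *)
Lemma mollify F f e : sqint mu F -> sqint mu f -> 0 < e ->
  exists2 del : R, 0 < del & forall rho, tf rho -> (forall z, 0 <= rho z) ->
    (forall z, del <= `|z| -> rho z = 0) ->
    `|conv2 F f rho - (\int[mu]_x (F x * f x)) * \int[mu]_z rho z| <=
       e * \int[mu]_z rho z.
Proof.
move=> hF hf e0; have [del del0 hd] := corr_continuous0 hF hf e0.
exists del => // rho tr r0 rs.
have ir := tf_intg tr.
have sr : sqint mu rho.
  split; first exact: tf_meas.
  by apply: tf_intg; apply: tfM => //; case: tr.
have ic := corr_mul_intg hF hf ir.
have -> : \int[mu]_x (F x * f x) = corr F f 0 by apply: int_ext => x; rewrite subr0.
rewrite conv2E// -intZ// -intB//; last exact: intgZ.
rewrite -[leRHS]intZ//; apply: int_norm_le.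
- by apply: intgB => //; exact: intgZ.
- exact: intgZ.
move=> z; rewrite -mulrBl normrM (ger0_norm (r0 z)).
have [zd|zd] := ltP `|z| del; first by rewrite ler_wpM2r// hd.
by rewrite rs// !mulr0.
Qed.

Lemma mu_ball_gt0 x (e : R) : 0 < e -> (0 < mu [set y : E | `|x - y| < e]%R)%E.
Proof.
move=> e0.
rewrite (_ : [set _ | _] = [set y : E | forall i : 'I_d, `]x i 0 - e, x i 0 + e[%classic (y i 0)]).
  rewrite (@lebesgue_cV_box R d (fun i => `]x i 0 - e, x i 0 + e[%classic))//.
  elim/big_ind : _ => //; first exact: mule_gt0.
  move=> i _; rewrite lebesgue_measure_itv /= lte_fin.
  have -> : x i 0 - e < x i 0 + e by lra.
  by rewrite -EFinB lte_fin; lra.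
apply/seteqP; split => y /=.
  rewrite cV_norm_lt// => /forallP h i; have := h i; rewrite !mxE in_itv /= ltr_distl => /andP[h1 h2].
  by apply/andP; split; lra.
move=> h; rewrite cV_norm_lt//; apply/forallP => i.
have := h i; rewrite in_itv /= => /andP[h1 h2].
by rewrite !mxE ltr_distl; apply/andP; split; lra.
Qed.

Lemma continuous_int_gt0 f x : continuous f -> intg mu f -> (forall y, 0 <= f y) ->
  0 < f x -> 0 < \int[mu]_y f y.
Proof.
move=> cf hf f0 fx.
have fx2 : 0 < f x / 2 by rewrite divr_gt0.
have /cvgrPdist_lt /(_ _ fx2) /nbhs_ballP[e /= e0 he] := cf x.
pose B := [set y : E | `|x - y| < Num.min e 1].
have m0 : 0 < Num.min e 1 by rewrite lt_min e0 ltr01.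
have mB : measurable B := measurable_cV_ball x (Num.min e 1).
have iB : intg mu (fun y => f x / 2 * \1_B y).
  apply: intgZ; apply: (@bounded_cpt_intg _ _ _ 1).
  - exact: measurable_indic.
  - exists (`|x| + 1) => y h; rewrite indicE memNset// /B /= => h'.
    have h2 : `|x - y| < 1 by apply: (lt_le_trans h'); rewrite ge_min lexx orbT.
    have := ler_normB x (x - y); rewrite subKr; lra.
  - by move=> y; rewrite indicE; case: (_ \in _); rewrite ?normr1 ?normr0.
apply: (@lt_le_trans _ _ (\int[mu]_y (f x / 2 * \1_B y))).
  rewrite RintegralZl//; last first.
    by apply: intg_ext (intgZ (f x / 2)^-1 iB) => y; rewrite mulKf// gt_eqF.
  rewrite mulr_gt0// /Rintegral integral_indic// setIT fine_gt0// mu_ball_gt0//=.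
  apply: (@le_lt_trans _ _ (mu [set y : E | `|y| <= `|x| + 1])); last exact: mu_ball_lty.
  apply: le_measure; rewrite ?inE//; first exact: measurable_norm_le.
  move=> y; rewrite /B /= => h'.
  have h2 : `|x - y| < 1 by apply: (lt_le_trans h'); rewrite ge_min lexx orbT.
  have := ler_normB x (x - y); rewrite subKr; lra.
apply: int_le => // y; rewrite indicE; have [yB|yB] := boolP (y \in B); last by rewrite mulr0.
rewrite mulr1.
have : `|f x - f y| < f x / 2.
  apply: he; rewrite mx_norm_ball /ball_ /=.
  move: yB; rewrite inE /B /= => h; apply: (lt_le_trans h); by rewrite ge_min lexx.
rewrite ltr_norml => /andP[_]; lra.
Qed.

(* Squaring and shrinking any nonzero test function gives the mollifiers. *)
Lemma tf_bump (eta : E -> R) x0 (del : R) : tf eta -> eta x0 != 0 -> 0 < del ->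
  exists rho, [/\ tf rho, forall z, 0 <= rho z, forall z, del <= `|z| -> rho z = 0 &
    0 < \int[mu]_z rho z].
Proof.
move=> te e0 del0; have [se [r hr]] := te.
(* Since eta vanishes beyond radius r, dilating by k brings its support inside the ball of radius
   del. *)
pose k := (`|r| + 1) / del.
have k0 : 0 < k by rewrite divr_gt0// ltr_wpDl.
pose u z := eta (0 + k *: z).
have tu : tf u by apply: tf_affine => //; rewrite gt_eqF.
have tu2 : tf (fun z => u z * u z) by apply: tfM => //; case: tu.
exists (fun z => u z * u z); split => //.
- by move=> z; rewrite -expr2 sqr_ge0.
- move=> z dz; rewrite /u add0r hr ?mul0r//.
  rewrite normrZ gtr0_norm// (@lt_le_trans _ _ (k * del))//.
    by rewrite /k divfK ?gt_eqF// (le_lt_trans (ler_norm r))// ltrDl.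
  by rewrite ler_pM2l.
- apply: (@continuous_int_gt0 _ (k^-1 *: x0)).
  + by apply: smooth_continuous; case: tu2.
  + exact: tf_intg.
  + by move=> z; rewrite -expr2 sqr_ge0.
  + rewrite /u add0r scalerA divff ?gt_eqF// scale1r -expr2.
    by rewrite exprn_even_gt0.
Qed.


Lemma measurable_eball (r : R) : measurable (eball r : set E).
Proof.
have me : measurable_fun setT (fun x : E => enorm x).
  apply: (@measurableT_comp _ _ _ _ _ _ (@Num.sqrt R)).
    by apply: continuous_measurable_fun; exact: sqrt_continuous.
  apply: measurable_sum => i; apply: measurable_funM; exact: measurable_coord.
rewrite (_ : eball r = (fun x : E => enorm x) @^-1` `]-oo, r[).
  by rewrite -[X in measurable X]setTI; exact: me.
by apply/seteqP; split => x /=; rewrite /eball /= in_itv.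
Qed.

(** The Euclidean norm is at most sqrt d times the maximum norm; d replaces the square root, and the
    added 1 makes the inequality strict. *)
Lemma norm_le_eball (r : R) x : `|x| <= r -> eball (d%:R * r + 1) x.
Proof.
move=> xr; have r0 : 0 <= r := le_trans (normr_ge0 x) xr.
rewrite /eball /= /enorm.
have s0 : 0 <= d%:R * r + 1 by rewrite addr_ge0 ?mulr_ge0.
rewrite -[ltRHS](ger0_norm s0) -sqrtr_sqr ltr_sqrt; last by rewrite exprn_gt0// ltr_wpDl// mulr_ge0.
apply: (@le_lt_trans _ _ (\sum_(i < d) r ^+ 2)).
  apply: ler_sum => i _; rewrite -expr2 -(real_normK (num_real (x i 0))).
  by rewrite lerXn2r ?nnegrE// (le_trans (cV_coord_le x i)).
rewrite sumr_const card_ord -mulr_natl.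
have : (d%:R : R) * r ^+ 2 <= (d%:R * r) ^+ 2.
  rewrite exprMn ler_wpM2r ?sqr_ge0// -natrX ler_nat.
  by case: (d) => // m; rewrite expnS leq_pmulr// expn_gt0.
have : 0 <= d%:R * r by rewrite mulr_ge0.
nra.
Qed.

Lemma L2_sqint f : L2 f <-> sqint mu f.
Proof. by split=> [h|/sqintP]; first exact/sqintP. Qed.

Lemma L2loc_mul f b (K : R) : L2loc f -> measurable_fun setT b -> cpt b ->
  (forall x, `|b x| <= K) -> sqint mu (fun x => f x * b x).
Proof.
move=> [mf hf] mb [r hr] bK; apply/sqintP; split; first exact: measurable_funM.
pose B : set E := eball (d%:R * `|r| + 1).
have mB : measurable B := measurable_eball _.
pose f2 x : R := f x ^+ 2.
suff H : (\int[mu]_x ((K ^+ 2)%R%:E * ((EFin \o f2) \_ B) x) < +oo)%E.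
  apply: le_lt_trans H.
  apply: ge0_le_integral => //.
  - by move=> x _; rewrite lee_fin sqr_ge0.
  - by apply/measurable_EFinP; apply: measurable_funX; exact: measurable_funM.
  - apply: measurable_funeM; apply/(measurable_restrictT _ mB)/measurable_EFinP.
    by apply: measurable_funTS; exact: measurable_funX.
  move=> x _; rewrite patchE; have [xB|xB] := boolP (x \in B).
    rewrite /= -EFinM lee_fin exprMn mulrC ler_wpM2r ?sqr_ge0//.
    by rewrite -(real_normK (num_real (b x))) lerXn2r ?nnegrE// (le_trans _ (bK x)).
  rewrite mule0 hr ?mulr0 ?expr0n//.
  rewrite ltNge; apply/negP => xr; move/negP: xB; apply; rewrite inE.
  by apply: norm_le_eball; rewrite (le_trans xr)// ler_norm.
have m2 : measurable_fun setT ((EFin \o f2) \_ B).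
  apply/(measurable_restrictT _ mB)/measurable_EFinP.
  by apply: measurable_funTS; exact: measurable_funX.
have p2 x : (0 <= ((EFin \o f2) \_ B) x)%E.
  by rewrite patchE; case: ifP => // _; rewrite lee_fin sqr_ge0.
rewrite ge0_integralZl//; last by rewrite lee_fin sqr_ge0.
rewrite -integral_mkcond lte_mul_pinfty ?lee_fin ?sqr_ge0//; exact: hf.
Qed.

Lemma sqint_L2loc f : sqint mu f -> L2loc f.
Proof.
move=> hf; have /L2_sqint[mf h] := hf; split=> // r.
apply: le_lt_trans h; apply: ge0_subset_integral => //.
- exact: measurable_eball.
- by apply/measurable_EFinP; exact: measurable_funX.
- by move=> x _; rewrite lee_fin sqr_ge0.
Qed.

Lemma L2loc_tf f v : L2loc f -> tf v -> sqint mu (fun x => f x * v x).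
Proof.
move=> hf tv; have [K hK] := tf_bounded tv.
by apply: L2loc_mul hK => //; [exact: tf_meas|case: tv].
Qed.

Lemma sqint_cpt_intg f b (K : R) : sqint mu f -> measurable_fun setT b -> cpt b ->
  (forall x, `|b x| <= K) -> intg mu (fun x => f x * b x).
Proof.
move=> hf mb cb bK; apply: sqint_mul => //; split => //.
apply: (@bounded_cpt_intg _ _ _ (K ^+ 2)).
- exact: measurable_funX.
- by have [r hr] := cb; exists r => x /hr ->; rewrite expr0n.
- by move=> x; rewrite normrX lerXn2r ?nnegrE// (le_trans _ (bK x)).
Qed.

Lemma L2loc_cpt_intg f b (K : R) : L2loc f -> measurable_fun setT b -> cpt b ->
  (forall x, `|b x| <= K) -> intg mu (fun x => f x * b x).
Proof.
move=> hf mb cb bK; have [r hr] := cb.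
pose B := [set x : E | `|x| <= r].
have mB : measurable B := measurable_norm_le r.
have cB : cpt (\1_B : E -> R).
  by exists r => x xr; rewrite indicE memNset// /B /=; apply/negP; rewrite -ltNge.
have h := L2loc_mul hf mb cb bK.
apply: intg_ext (sqint_cpt_intg h (measurable_indic mB) cB (K := 1) _) => x.
  rewrite indicE; have [xB|xB] := boolP (x \in B); first by rewrite mulr1.
  rewrite hr ?mulr0 ?mul0r//; move: xB; rewrite notin_setE /B /= => /negP.
  by rewrite -ltNge.
by rewrite indicE; case: (_ \in _); rewrite ?normr1 ?normr0.
Qed.

Lemma L2loc_tf_intg f v : L2loc f -> tf v -> intg mu (fun x => f x * v x).
Proof.
move=> hf tv; have [K hK] := tf_bounded tv.
by apply: L2loc_cpt_intg hK => //; [exact: tf_meas|case: tv].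
Qed.

Lemma tf_sqint v : tf v -> sqint mu v.
Proof.
move=> tv; split; first exact: tf_meas.
by apply: tf_intg; apply: tfM => //; case: tv.
Qed.

Definition wgrad (i : 'I_d) (u w : E -> R) : Prop := forall v, tf v ->
  \int[mu]_x (u x * pderiv i v x) = - \int[mu]_x (w x * v x).

Lemma wgrad_mul i u w b : L2loc u -> L2loc w -> wgrad i u w -> tf b ->
  wgrad i (fun x => u x * b x) (fun x => w x * b x + u x * pderiv i b x).
Proof.
move=> lu lw uw tb v tv; have [sb cb] := tb; have [sv cv] := tv.
have tbv : tf (fun x => b x * v x) by exact: tfM.
have h := uw _ tbv; rewrite pderivM// in h.
have t1 : tf (fun x => pderiv i b x * v x) by apply: tfM => //; exact: tf_pderiv.
have t2 : tf (fun x => b x * pderiv i v x) by apply: tfM => //; exact: smooth_pderiv.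
have i1 := L2loc_tf_intg lu t1; have i2 := L2loc_tf_intg lu t2.
have i3 := L2loc_tf_intg lw tbv.
have e1 : \int[mu]_x (u x * (pderiv i b x * v x + b x * pderiv i v x)) =
   \int[mu]_x (u x * (pderiv i b x * v x)) + \int[mu]_x (u x * (b x * pderiv i v x)).
  by rewrite -intD//; apply: int_ext => x; rewrite mulrDr.
rewrite e1 in h.
have -> : \int[mu]_x (u x * b x * pderiv i v x) = \int[mu]_x (u x * (b x * pderiv i v x)).
  by apply: int_ext => x; rewrite mulrA.
have -> : \int[mu]_x ((w x * b x + u x * pderiv i b x) * v x) =
   \int[mu]_x (w x * (b x * v x)) + \int[mu]_x (u x * (pderiv i b x * v x)).
  by rewrite -intD//; apply: int_ext => x; rewrite mulrDl !mulrA.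
lra.
Qed.

Lemma pderiv_subl i f x : smooth f ->
  pderiv i (fun y => f (x - y)) = fun y => - pderiv i f (x - y).
Proof.
move=> sf; have e : (fun y => f (x - y)) = fun y => f (x + (-1) *: y).
  by apply/funext => y; rewrite scaleN1r.
rewrite e (pderiv_affine i x (-1) sf).1; apply/funext => y.
by rewrite mulN1r scaleN1r.
Qed.

Lemma tf_subl f x : tf f -> tf (fun y => f (x - y)).
Proof.
move=> h; have e : (fun y => f (x - y)) = fun y => f (x + (-1) *: y).
  by apply/funext => y; rewrite scaleN1r.
by rewrite e; apply: tf_affine => //; rewrite oppr_eq0 oner_eq0.
Qed.

Lemma pderiv_subr i f y : smooth f ->
  pderiv i (fun x => f (x - y)) = fun x => pderiv i f (x - y).
Proof.
move=> sf; have e : (fun x => f (x - y)) = fun x => f (- y + 1 *: x).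
  by apply/funext => x; rewrite scale1r addrC.
rewrite e (pderiv_affine i (- y) 1 sf).1; apply/funext => x.
by rewrite mul1r scale1r addrC.
Qed.

Lemma tf_subr f y : tf f -> tf (fun x => f (x - y)).
Proof.
move=> h; have e : (fun x => f (x - y)) = fun x => f (- y + 1 *: x).
  by apply/funext => x; rewrite scale1r addrC.
by rewrite e; apply: tf_affine => //; rewrite oner_eq0.
Qed.

(** Both sides are minus the integral of u against a mixed derivative of rho, and these derivatives
    commute. *)
Lemma curl_test p q u up uq rho : wgrad p u up -> wgrad q u uq -> tf rho ->
  \int[mu]_x (up x * pderiv q rho x) = \int[mu]_x (uq x * pderiv p rho x).
Proof.
move=> hp hq tr; have [sr _] := tr.
have e1 := hp _ (tf_pderiv q tr); have e2 := hq _ (tf_pderiv p tr).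
have e3 : \int[mu]_x (u x * pderiv p (pderiv q rho) x) =
    \int[mu]_x (u x * pderiv q (pderiv p rho) x) by rewrite (schwarz p q sr).
exact: oppr_inj (etrans (esym e1) (etrans e3 e2)).
Qed.

(** Two signs cancel: one from the definition of the weak derivative, one from differentiating rho
    (x - y) in y. *)
Lemma conv2_wgrad k v vk a rho : wgrad k v vk -> sqint mu a -> sqint mu v -> sqint mu vk ->
  tf rho -> conv2 a vk rho = \int[mu]_y (v y * \int[mu]_x (a x * pderiv k rho (x - y))).
Proof.
move=> hv la lv lvk tr; have [sr _] := tr; have tkr := tf_pderiv k tr.
have [sub1 sub2] : (forall x, sqint mu (fun y => rho (x - y))) /\
    (forall x, sqint mu (fun y => pderiv k rho (x - y))).
  by split=> x; apply: tf_sqint; exact: tf_subl.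
transitivity (conv2 a v (pderiv k rho)).
  apply: int_ext => x.
  have i1 : intg mu (fun y => vk y * rho (x - y)) by exact: sqint_mul.
  have i2 : intg mu (fun y => v y * pderiv k rho (x - y)) by exact: sqint_mul.
  transitivity (a x * \int[mu]_y (vk y * rho (x - y))).
    by rewrite -intZ//; apply: int_ext => y; rewrite mulrA.
  transitivity (a x * \int[mu]_y (v y * pderiv k rho (x - y))); last first.
    by rewrite -intZ//; apply: int_ext => y; rewrite mulrA.
  congr (_ * _).
  have := hv _ (tf_subl x tr); rewrite pderiv_subl// => /(congr1 -%R).
  rewrite opprK => <-; rewrite -intN.
    by apply: int_ext => y; rewrite mulrN opprK.
  by apply: intg_ext (intgN i2) => y; rewrite mulrN.
rewrite conv2_swap//; last exact: tf_intg.
apply: int_ext => y; rewrite -intZ.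
  by apply: int_ext => x; rewrite mulrCA mulrA.
by apply: sqint_mul => //; apply: tf_sqint; exact: tf_subr.
Qed.

(** Once the derivative of S has been moved to the mollifier, [curl_test] for u applies in the
    variable x for each fixed y. *)
Lemma conv2_curl p q u up uq S Sp Sq rho : wgrad p u up -> wgrad q u uq ->
  wgrad p S Sp -> wgrad q S Sq -> sqint mu up -> sqint mu uq -> sqint mu S -> sqint mu Sp ->
  sqint mu Sq -> tf rho -> conv2 up Sq rho = conv2 uq Sp rho.
Proof.
move=> hup huq hSp hSq lup luq lS lSp lSq tr; have [sr _] := tr.
rewrite (conv2_wgrad hSq lup lS lSq tr) (conv2_wgrad hSp luq lS lSp tr).
have e y := curl_test hup huq (tf_subr y tr).
apply: int_ext => y; apply: (congr1 ( *%R (S y))).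
by move: (e y); rewrite (pderiv_subr q y sr) (pderiv_subr p y sr).
Qed.

(* Both sides are limits of convolutions with a common mollifier, for which the
   derivatives can be exchanged (conv2_curl). *)
Lemma H1_curl p q (eta : E -> R) x0 u up uq S Sp Sq : tf eta -> eta x0 != 0 ->
  wgrad p u up -> wgrad q u uq ->
  wgrad p S Sp -> wgrad q S Sq -> sqint mu up -> sqint mu uq -> sqint mu S -> sqint mu Sp ->
  sqint mu Sq -> \int[mu]_x (up x * Sq x) = \int[mu]_x (uq x * Sp x).
Proof.
move=> te e0 hup huq hSp hSq lup luq lS lSp lSq.
apply/eqP; rewrite -subr_eq0 -normr_le0; apply/ler_addgt0Pl => e e1; rewrite addr0.
have e2 : 0 < e / 2 by rewrite divr_gt0.
have [d1 d10 h1] := mollify lup lSq e2; have [d2 d20 h2] := mollify luq lSp e2.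
have d0 : 0 < Num.min d1 d2 by rewrite lt_min d10.
have [rho [tr r0 rs ri]] := tf_bump te e0 d0.
have := h1 _ tr r0; have := h2 _ tr r0.
rewrite (conv2_curl hup huq hSp hSq lup luq lS lSp lSq tr).
set I := \int[mu]_z rho z in ri *.
have s1 z : d1 <= `|z| -> rho z = 0 by move=> h; rewrite rs// ge_min h.
have s2 z : d2 <= `|z| -> rho z = 0 by move=> h; rewrite rs// ge_min h orbT.
move=> /(_ s2) k2 /(_ s1) k1.
rewrite -(ler_pM2r ri) -[X in _ * X <= _](gtr0_norm ri) -normrM mulrBl.
move: k1 k2; set X := conv2 _ _ _; move: (_ * I) (\int[mu]_x _ * I) => a b.
rewrite !ler_norml => /andP[? ?] /andP[? ?]; apply/andP; split; lra.
Qed.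

End mollification.

(** * Two-scale expansion and functional derivative *)

Section vector_fields.
Context {R : realType} {d : nat}.
Local Notation E := 'cV[R]_d.
Local Notation mu := (lebesgue_cV d).
Implicit Types (V W : E -> E) (u v : E) (M : 'M[R]_d).

Lemma dotC u v : dot u v = dot v u.
Proof. by apply: eq_bigr => i _; rewrite mulrC. Qed.

Lemma dotDr u v w : dot u (v + w) = dot u v + dot u w :> R.
Proof. by rewrite -big_split; apply: eq_bigr => i _; rewrite mxE mulrDr. Qed.

Lemma dotZr u v (k : R) : dot u (k *: v) = k * dot u v.
Proof. by rewrite mulr_sumr; apply: eq_bigr => i _; rewrite mxE mulrCA. Qed.

Lemma dotDl u v w : dot (v + w) u = dot v u + dot w u :> R.
Proof. by rewrite dotC dotDr dotC (dotC u). Qed.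

Lemma dotZl u v (k : R) : dot (k *: u) v = k * dot u v.
Proof. by rewrite dotC dotZr dotC. Qed.

Lemma dotNr u v : dot u (- v) = - dot u v :> R.
Proof. by rewrite -scaleN1r dotZr mulN1r. Qed.

Lemma dotBr u v w : dot u (v - w) = dot u v - dot u w :> R.
Proof. by rewrite dotDr dotNr. Qed.

Lemma dot0r u : dot u 0 = 0 :> R.
Proof. by rewrite -(scale0r u) dotZr mul0r. Qed.

Lemma dot_sumr I (s : seq I) (P : pred I) (F : I -> E) u :
  dot u (\sum_(k <- s | P k) F k) = \sum_(k <- s | P k) dot u (F k).
Proof. by apply: (big_morph _ (dotDr u) (dot0r u)). Qed.

Lemma dot_bvec i u : dot (bvec i) u = u i 0.
Proof.
rewrite /dot (bigD1 i)//= mxE !eqxx mul1r big1 ?addr0// => j ji.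
by rewrite mxE (negbTE ji) mul0r.
Qed.

Lemma dot_mulmx u v M : dot u (M *m v) = dot (M^T *m u) v.
Proof.
transitivity (\sum_i \sum_j u i 0 * (M i j * v j 0)).
  by apply: eq_bigr => i _; rewrite mxE mulr_sumr.
rewrite exchange_big; apply: eq_bigr => j _; rewrite mxE mulr_suml.
by apply: eq_bigr => i _; rewrite mxE mulrCA mulrA.
Qed.

Definition vsq V := forall i, sqint mu (fun x => V x i 0).
Definition vloc V := forall i, L2loc (fun x => V x i 0).

Lemma vsq_dot V W : vsq V -> vsq W -> intg mu (fun x => dot (V x) (W x)).
Proof. by move=> hV hW; apply: intg_sum => i _; exact: sqint_mul. Qed.

Lemma vsqD V W : vsq V -> vsq W -> vsq (fun x => V x + W x).
Proof. by move=> hV hW i; apply: sqint_ext (sqintD (hV i) (hW i)) => x; rewrite mxE. Qed.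

Lemma vsqZ (k : R) V : vsq V -> vsq (fun x => k *: V x).
Proof. by move=> hV i; apply: sqint_ext (sqintZ k (hV i)) => x; rewrite mxE. Qed.

Lemma vsqB V W : vsq V -> vsq W -> vsq (fun x => V x - W x).
Proof.
move=> hV hW i; apply: sqint_ext (vsqD hV (vsqZ (-1) hW) i) => x.
by rewrite scaleN1r.
Qed.

Lemma vsq_ext V W : V =1 W -> vsq V -> vsq W.
Proof. by move=> /funext ->. Qed.

Lemma vsq_sum I (s : seq I) (P : pred I) (F : I -> E -> E) :
  (forall k, P k -> vsq (F k)) -> vsq (fun x => \sum_(k <- s | P k) F k x).
Proof.
move=> h i; apply: sqint_ext (sqint_sum s (fun k Pk => h k Pk i)) => x.
by rewrite summxE.
Qed.

Lemma vsq_mx (b : E -> 'M[R]_d) (K : R) V :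
  (forall p q, measurable_fun setT (fun x => b x p q)) ->
  (forall x p q, `|b x p q| <= K) -> vsq V -> vsq (fun x => b x *m V x).
Proof.
move=> mb bK hV i.
apply: (@sqint_ext _ _ _ _ (fun x => \sum_(q < d) b x i q * V x q 0)) => [x|].
  by rewrite mxE.
by apply: sqint_sum => q _; apply: (@sqint_bndM _ _ _ _ K).
Qed.

Lemma vsq_tfZ (c : E -> R) V : vloc V -> tf c -> vsq (fun x => c x *: V x).
Proof.
move=> hV tc i; apply: sqint_ext (L2loc_tf (hV i) tc) => x.
by rewrite mxE mulrC.
Qed.

Lemma vsq_tfv (c : E -> R) v : tf c -> vsq (fun x => c x *: v).
Proof.
move=> tc i; apply: sqint_ext (sqintZ (v i 0) (tf_sqint tc)) => x.
by rewrite mxE mulrC.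
Qed.

Lemma vsq_adm (da : E -> 'M[R]_d) V : admissible da -> vloc V ->
  vsq (fun x => da x *m V x).
Proof.
move=> [mda [K dK] /cptP[r hr]] hV i.
apply: (@sqint_ext _ _ _ _ (fun x => \sum_(q < d) V x q 0 * da x i q)) => [x|].
  by rewrite mxE; apply: eq_bigr => q _; rewrite mulrC.
apply: sqint_sum => q _; apply: (L2loc_mul (K := K)) => //.
by exists r => x /hr ->; rewrite mxE.
Qed.

Lemma enorm_ge (x : E) : `|x| <= enorm x.
Proof.
rewrite cV_norm_le ?sqrtr_ge0//; apply/forallP => i.
rewrite -sqrtr_sqr ler_sqrt /dot ?sumr_ge0//; last first.
  by move=> j _; rewrite -expr2 sqr_ge0.
rewrite (bigD1 i)//= expr2 lerDl sumr_ge0// => j _.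
by rewrite -expr2 sqr_ge0.
Qed.

Lemma L2loc_cst (c : R) : L2loc (fun _ : E => c).
Proof.
split=> // r; rewrite integral_cst; last exact: measurable_eball.
rewrite lte_mul_pinfty ?lee_fin ?sqr_ge0//.
apply: le_lt_trans (mu_ball_lty r); apply: le_measure; rewrite ?inE.
- exact: measurable_eball.
- exact: measurable_norm_le.
- by move=> x /= xr; apply: le_trans (enorm_ge x) (ltW xr).
Qed.

Lemma L2locD (f g : E -> R) : L2loc f -> L2loc g -> L2loc (fun x => f x + g x).
Proof.
move=> [mf hf] [mg hg]; split; first exact: measurable_funD.
move=> r; have mB := @measurable_eball R d r.
apply: (@le_lt_trans _ _ (\int[mu]_(x in eball r) ((2 * f x ^+ 2)%:E + (2 * g x ^+ 2)%:E))%E).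
  apply: ge0_le_integral => //.
  - by move=> x _; rewrite lee_fin sqr_ge0.
  - apply/measurable_EFinP; apply: measurable_funTS; apply: measurable_funX; exact: measurable_funD.
  - apply/measurable_EFinP; apply: measurable_funTS.
    by apply: measurable_funD; apply: measurable_funM => //; exact: measurable_funX.
  - by move=> x _; rewrite -EFinD lee_fin; have := sqr_ge0 (f x - g x); nra.
have i2 (h : E -> R) : measurable_fun setT h -> (\int[mu]_(x in eball r) ((h x) ^+ 2)%:E < +oo)%E ->
    (\int[mu]_(x in eball r) ((2 * h x ^+ 2)%:E) < +oo)%E.
  move=> mh hh.
  under eq_integral do rewrite EFinM.
  rewrite ge0_integralZl// ?lte_mul_pinfty//.
    by apply/measurable_EFinP; apply: measurable_funTS; exact: measurable_funX.
  by move=> x _; rewrite lee_fin sqr_ge0.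
rewrite ge0_integralD//.
- by rewrite lte_add_pinfty// i2.
- by move=> x _; rewrite lee_fin mulr_ge0 ?sqr_ge0.
- by apply/measurable_EFinP; apply: measurable_funTS; apply: measurable_funM => //;
  exact: measurable_funX.
- by move=> x _; rewrite lee_fin mulr_ge0 ?sqr_ge0.
- by apply/measurable_EFinP; apply: measurable_funTS; apply: measurable_funM => //;
  exact: measurable_funX.
Qed.

Lemma vlocD V W : vloc V -> vloc W -> vloc (fun x => V x + W x).
Proof.
move=> hV hW i; have h := L2locD (hV i) (hW i).
by rewrite (_ : (fun x => _) = fun x => V x i 0 + W x i 0)//; apply/funext => x; rewrite mxE.
Qed.

Lemma vloc_cst v : vloc (fun=> v).
Proof. by move=> i; exact: L2loc_cst. Qed.

Lemma int_dotD V W W' : vsq V -> vsq W -> vsq W' ->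
  \int[mu]_x dot (V x) (W x + W' x) =
  \int[mu]_x dot (V x) (W x) + \int[mu]_x dot (V x) (W' x).
Proof.
move=> hV hW hW'; rewrite -intD; [|exact: vsq_dot|exact: vsq_dot].
by apply: int_ext => x; rewrite dotDr.
Qed.

Lemma int_dotDl V W W' : vsq V -> vsq W -> vsq W' ->
  \int[mu]_x dot (W x + W' x) (V x) =
  \int[mu]_x dot (W x) (V x) + \int[mu]_x dot (W' x) (V x).
Proof.
move=> hV hW hW'; rewrite -intD; [|exact: vsq_dot|exact: vsq_dot].
by apply: int_ext => x; rewrite dotDl.
Qed.

Lemma int_dotB V W W' : vsq V -> vsq W -> vsq W' ->
  \int[mu]_x dot (V x) (W x - W' x) =
  \int[mu]_x dot (V x) (W x) - \int[mu]_x dot (V x) (W' x).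
Proof.
move=> hV hW hW'; rewrite -intB; [|exact: vsq_dot|exact: vsq_dot].
by apply: int_ext => x; rewrite dotBr.
Qed.

Lemma int_dotZ (k : R) V W : vsq V -> vsq W ->
  \int[mu]_x dot (V x) (k *: W x) = k * \int[mu]_x dot (V x) (W x).
Proof.
by move=> hV hW; rewrite -intZ; [apply: int_ext => x; rewrite dotZr|exact: vsq_dot].
Qed.

Lemma int_dot_sum I (s : seq I) (P : pred I) (F : I -> E -> E) V : vsq V ->
  (forall k, P k -> vsq (F k)) ->
  \int[mu]_x dot (V x) (\sum_(k <- s | P k) F k x) =
  \sum_(k <- s | P k) \int[mu]_x dot (V x) (F k x).
Proof.
move=> hV hF; rewrite -int_sum; last by move=> k Pk; apply: vsq_dot => //; exact: hF.
by apply: int_ext => x; rewrite dot_sumr.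
Qed.

Lemma sum_tuple_rcons (Z : nmodType) k (F : seq 'I_d -> Z) :
  \sum_(I : k.+1.-tuple 'I_d) F I = \sum_(I : k.-tuple 'I_d) \sum_(m < d) F (rcons I m).
Proof.
rewrite pair_big /=.
rewrite (reindex (fun p : k.-tuple 'I_d * 'I_d => [tuple of rcons p.1 p.2])) //=.
pose g (I : k.+1.-tuple 'I_d) : k.-tuple 'I_d * 'I_d :=
  ([tuple of belast (thead I) [tuple of behead I]], last (thead I) (behead I)).
exists g => [[I m] _|I _]; last first.
  by apply: val_inj; rewrite /= -lastI; case/tupleP: I => a I; rewrite theadE.
rewrite /g; case: I => -[|a s] /= sI.
  apply: (congr2 pair); first by apply: val_inj => /=.
  by rewrite /thead (tnth_nth m) /=.
apply: (congr2 pair); last by rewrite last_rcons.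
by apply: val_inj => /=; rewrite belast_rcons; congr (_ :: _).
Qed.

Lemma sum_tuple0 (Z : nmodType) (F : seq 'I_d -> Z) :
  \sum_(I : 0.-tuple 'I_d) F I = F [::].
Proof.
by rewrite (big_pred1 [tuple])// => I; apply/esym/eqP/val_inj; case: I => -[].
Qed.

End vector_fields.

Section divergence_free.
Context {R : realType} {d : nat}.
Local Notation E := 'cV[R]_d.
Local Notation mu := (lebesgue_cV d).

Lemma H1locP (u : E -> R) (Du : E -> E) :
  H1loc u Du <-> [/\ L2loc u, vloc Du & forall l, wgrad l u (fun x => Du x l 0)].
Proof.
split=> -[h1 h2 h3]; split; [exact: h1|exact: h2| |exact: h1|exact: h2|].
  by move=> l v /tfP tv; exact: h3.
by move=> v l /tfP tv; exact: h3.
Qed.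

Lemma wgradN l (u w : E -> R) : L2loc u -> L2loc w -> wgrad l u w ->
  wgrad l (fun x => - u x) (fun x => - w x).
Proof.
move=> hu hw h v tv; have := h v tv => /(congr1 -%R).
rewrite -intN; last by apply: L2loc_tf_intg => //; exact: tf_pderiv.
rewrite -[in X in _ = - X -> _]intN; last exact: L2loc_tf_intg.
under [in X in X = _ -> _]int_ext do rewrite -mulNr.
under [in X in _ = - X -> _]int_ext do rewrite -mulNr.
exact.
Qed.

(** The field paired with Du is the divergence of the skew matrix b sg. Hence the integral is the
    double sum of X p q, the integral of D_p u times D_q of the entry p q. Exchanging the two
    derivatives by [H1_curl] and using skewness gives X p q = - X q p, so the sum vanishes. *)
Lemma skew_div0 (eta : E -> R) x0 (u : E -> R) (Du : E -> E) (sg : E -> 'M[R]_d)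
    (gs : E -> 'I_d -> 'I_d -> E) (b : E -> R) :
  tf eta -> eta x0 != 0 -> dotH1 u Du -> (forall x, (sg x)^T = - sg x) ->
  (forall p q, H1loc (fun x => sg x p q) (fun x => gs x p q)) -> tf b ->
  \int[mu]_x dot (Du x) (b x *: (\col_p \sum_(q < d) gs x p q q 0) + sg x *m grad b x) = 0.
Proof.
move=> te e0 [/H1locP[lu vu wu] sDu] skew hs tb.
have sDu' l : sqint mu (fun x => Du x l 0) by exact/L2_sqint.
pose S p q x := sg x p q * b x.
pose DS p q l x := gs x p q l 0 * b x + sg x p q * pderiv l b x.
have hS p q : sqint mu (S p q) by have /H1locP[h _ _] := hs p q; exact: L2loc_tf.
have hDS p q l : sqint mu (DS p q l).
  have /H1locP[h1 h2 _] := hs p q; apply: sqintD; first exact: L2loc_tf.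
  by apply: L2loc_tf => //; exact: tf_pderiv.
have wS p q l : wgrad l (S p q) (DS p q l).
  by have /H1locP[h1 h2 h3] := hs p q; apply: wgrad_mul.
(* The gradients [gs] are not assumed skew, so this second weak derivative of S p q is obtained from
   that of S q p. *)
have wSN p q l : wgrad l (S p q) (fun x => - DS q p l x).
  have := wgradN (sqint_L2loc (hS q p)) (sqint_L2loc (hDS q p l)) (wS q p l).
  rewrite (_ : (fun x => - S q p x) = S p q)//; apply/funext => x.
  have := congr1 (fun M : 'M[R]_d => M p q) (skew x); rewrite !mxE /S => ->.
  by rewrite mulNr opprK.
pose X p q := \int[mu]_x (Du x p 0 * DS p q q x).
have XN p q : X p q = - X q p.
  have hN : sqint mu (fun x => - DS q p p x).
    by apply: sqint_ext (sqintZ (-1) (hDS q p p)) => x; rewrite mulN1r.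
  have := H1_curl te e0 (wu p) (wu q) (wSN p q p) (wS p q q) (sDu' p) (sDu' q) (hS p q) hN (hDS p q q).
  move=> e; rewrite {1}/X; apply: (etrans e); rewrite /X -intN; last exact: sqint_mul.
  by apply: int_ext => x; rewrite mulrN.
transitivity (\sum_(p < d) \sum_(q < d) X p q).
  transitivity (\int[mu]_x \sum_(p < d) \sum_(q < d) (Du x p 0 * DS p q q x)).
    apply: int_ext => x; apply: eq_bigr => p _; rewrite !mxE mulr_sumr -big_split /= mulr_sumr.
    by apply: eq_bigr => q _; rewrite /DS mxE [b x * _]mulrC.
  rewrite int_sum => [|p _]; last by apply: intg_sum => q _; exact: sqint_mul.
  by apply: eq_bigr => p _; rewrite int_sum// => q _; exact: sqint_mul.
have e : \sum_(p < d) \sum_(q < d) X p q = - \sum_(p < d) \sum_(q < d) X p q.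
  rewrite {1}exchange_big -sumrN; apply: eq_bigr => p _.
  by rewrite -sumrN; apply: eq_bigr => q _; exact: XN.
by move: e; move: (\sum_(p < d) _) => y /eqP; rewrite -subr_eq0 opprK -mulr2n mulrn_eq0 => /eqP.
Qed.

Lemma grad_sum (f : E -> R) x : grad f x = \sum_(m < d) pderiv m f x *: bvec m.
Proof.
apply/colP => l; rewrite mxE summxE (bigD1 l)//= big1 ?addr0.
  by rewrite !mxE !eqxx mulr1.
by move=> m ml; rewrite !mxE (eq_sym l) (negbTE ml) mulr0.
Qed.

(** Summing over the last index turns derivatives of order k + 1 into gradients of those of order k.
    It is stated for arbitrary coefficients c so as to serve for phi, for phi a^T and for sigma. *)
Lemma sum_pderivs_rcons (g : E -> R) (c : seq 'I_d -> 'M[R]_d) k j x : smooth g ->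
  \sum_(I : k.+1.-tuple 'I_d) pderivs I g x *: (c (belast j I) *m bvec (last j I)) =
  \sum_(I : k.-tuple 'I_d) c (j :: I) *m grad (pderivs I g) x.
Proof.
move=> sg; rewrite (@sum_tuple_rcons d _ k (fun I => pderivs I g x *: (c (belast j I) *m bvec
  (last j I)))).
apply: eq_bigr => I _; rewrite grad_sum mulmx_sumr; apply: eq_bigr => m _.
by rewrite belast_rcons last_rcons pderivs_rcons_out// -scalemxAr.
Qed.

End divergence_free.

Section two_scale.
Context {R : realType} {d : nat}.
Local Notation E := 'cV[R]_d.
Local Notation mu := (lebesgue_cV d).
Variables (a : E -> 'M[R]_d) (phi : seq 'I_d -> E -> R) (gphi : seq 'I_d -> E -> E).
Variables (sig : seq 'I_d -> E -> 'M[R]_d) (gsig : seq 'I_d -> E -> 'I_d -> 'I_d -> E).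
Variables (ab : seq 'I_d -> 'M[R]_d) (n : nat) (j : 'I_d) (g : E -> R).
Hypothesis phi0 : forall x, phi [::] x = 1.
Hypothesis sig0 : forall x, sig [::] x = 0.
Hypothesis Hphi : forall s k, (size s < n)%N -> H1loc (phi (rcons s k)) (gphi (rcons s k)).
Hypothesis Hskew : forall s k x, (size s < n)%N -> (sig (rcons s k) x)^T = - sig (rcons s k) x.
Hypothesis Hsig : forall s k, (size s < n)%N -> forall p q,
  H1loc (fun x => sig (rcons s k) x p q) (fun x => gsig (rcons s k) x p q).
Let divs s x : E := \col_p \sum_(q < d) gsig s x p q q 0.
Hypothesis Hsigeq : {ae mu, forall x, forall s k, (size s < n)%N ->
  divs (rcons s k) x = (a x)^T *m gphi (rcons s k) x
    + (phi s x *: (a x)^T - sig s x) *m bvec k - ab s *m bvec k}.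
Hypothesis tg : tf g.

Definition two_scale x : R :=
  \sum_(0 <= k < n) \sum_(I : k.-tuple 'I_d) phi (j :: I) x * pderivs I g x.
Definition two_scale_grad x : E :=
  \sum_(0 <= k < n) \sum_(I : k.-tuple 'I_d)
    (pderivs I g x *: gphi (j :: I) x + phi (j :: I) x *: grad (pderivs I g) x).

Lemma wgrad_sum I (s : seq I) l (F D : I -> E -> R) :
  (forall k, sqint mu (F k)) -> (forall k, sqint mu (D k)) ->
  (forall k, wgrad l (F k) (D k)) ->
  wgrad l (fun x => \sum_(k <- s) F k x) (fun x => \sum_(k <- s) D k x).
Proof.
move=> hF hD h v tv.
transitivity (\int[mu]_x \sum_(k <- s) (F k x * pderiv l v x)).
  by apply: int_ext => x; rewrite mulr_suml.
rewrite int_sum; last by move=> k _; apply: sqint_mul => //; apply: tf_sqint; exact: tf_pderiv.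
transitivity (- \int[mu]_x \sum_(k <- s) (D k x * v x)); last first.
  by apply: (congr1 -%R); apply: int_ext => x; rewrite mulr_suml.
rewrite int_sum; last by move=> k _; apply: sqint_mul => //; exact: tf_sqint.
by rewrite -sumrN; apply: eq_bigr => k _; exact: h.
Qed.

Lemma size_belast_lt k (I : k.-tuple 'I_d) : (k < n)%N -> (size (belast j I) < n)%N.
Proof. by rewrite size_belast size_tuple. Qed.

Lemma two_scale_dotH1 : dotH1 two_scale two_scale_grad.
Proof.
have hk k (I : k.-tuple 'I_d) : (k < n)%N ->
    H1loc (phi (j :: I)) (gphi (j :: I)).
  by move=> kn; rewrite lastI; apply: Hphi; exact: size_belast_lt.
pose F k x := \sum_(I : k.-tuple 'I_d) phi (j :: I) x * pderivs I g x.
pose D l k x := \sum_(I : k.-tuple 'I_d)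
   (gphi (j :: I) x l 0 * pderivs I g x + phi (j :: I) x * pderiv l (pderivs I g) x).
have sF0 k (I : k.-tuple 'I_d) : (k < n)%N -> sqint mu (fun x => phi (j :: I) x * pderivs I g x).
  by move=> kn; have /H1locP[h _ _] := hk k I kn; apply: L2loc_tf => //; exact: tf_pderivs.
have sD0 l k (I : k.-tuple 'I_d) : (k < n)%N -> sqint mu
   (fun x => gphi (j :: I) x l 0 * pderivs I g x + phi (j :: I) x * pderiv l (pderivs I g) x).
  move=> kn; have /H1locP[h h' _] := hk k I kn; apply: sqintD.
    by apply: L2loc_tf => //; exact: tf_pderivs.
  by apply: L2loc_tf => //; apply: tf_pderiv; exact: tf_pderivs.
(* The redundant condition k < n in the sum makes the hypotheses on orders below n available to the
   lemmas on finite sums. *)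
have eu : two_scale = fun x => \sum_(k <- index_iota 0 n | (k < n)%N) F k x.
  apply/funext => x; rewrite /two_scale big_seq_cond [RHS]big_seq_cond.
  by apply: eq_bigl => k; rewrite mem_index_iota; case: (k < n)%N; rewrite ?andbF.
have eU l : (fun x => two_scale_grad x l 0) = fun x => \sum_(k <- index_iota 0 n | (k < n)%N) D l k x.
  apply/funext => x; rewrite /two_scale_grad summxE.
  transitivity (\sum_(0 <= k < n) D l k x).
    apply: eq_bigr => k _; rewrite summxE; apply: eq_bigr => I _.
    by rewrite !mxE [pderivs I g x * _]mulrC.
  rewrite big_seq_cond [RHS]big_seq_cond.
  by apply: eq_bigl => k; rewrite mem_index_iota; case: (k < n)%N; rewrite ?andbF.
have sF k : (k < n)%N -> sqint mu (F k) by move=> kn; apply: sqint_sum => I _; exact: sF0.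
have sD l k : (k < n)%N -> sqint mu (D l k) by move=> kn; apply: sqint_sum => I _; exact: sD0.
have su : sqint mu two_scale by rewrite eu; apply: sqint_sum.
have sU l : sqint mu (fun x => two_scale_grad x l 0) by rewrite eU; apply: sqint_sum => k kn; exact: sD.
split; last by move=> l; exact/L2_sqint.
apply/H1locP; split; first exact: sqint_L2loc.
  by move=> l; exact: sqint_L2loc.
move=> l; rewrite eu eU.
have -> : (fun x => \sum_(k <- index_iota 0 n | (k < n)%N) F k x) =
  fun x => \sum_(k <- index_iota 0 n) (if (k < n)%N then F k x else 0).
  by apply/funext => x; rewrite big_mkcond.
have -> : (fun x => \sum_(k <- index_iota 0 n | (k < n)%N) D l k x) =
  fun x => \sum_(k <- index_iota 0 n) (if (k < n)%N then D l k x else 0).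
  by apply/funext => x; rewrite big_mkcond.
apply: (@wgrad_sum _ _ _ (fun k x => if (k < n)%N then F k x else 0)
   (fun k x => if (k < n)%N then D l k x else 0)) => k.
- by have [kn|kn] := ltnP k n; [exact: sF|exact: sqint0].
- by have [kn|kn] := ltnP k n; [exact: sD|exact: sqint0].
- have [kn|kn] := ltnP k n.
    apply: wgrad_sum => I; [exact: sF0|exact: sD0|].
    have /H1locP[h1 h2 h3] := hk k I kn.
    by apply: wgrad_mul => //; exact: tf_pderivs.
  move=> v tv; transitivity (0 : R).
    by rewrite -[RHS](int0 mu); apply: int_ext => x; rewrite mul0r.
  rewrite -[LHS]oppr0; apply: (congr1 -%R).
  by rewrite -[LHS](int0 mu); apply: int_ext => x; rewrite mul0r.
Qed.

(** This relates the formula of the theorem to g e_j + grad u. Write B k for the terms in phi with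
    derivatives of order k. Then B 0 = g e_j, because phi of the empty index is 1, and B (k + 1) is
    the part of grad u in which the gradient falls on derivatives of g of order k. *)
Lemma two_scale_gradE x :
  \sum_(0 <= k < n) \sum_(I : k.-tuple 'I_d)
     pderivs I g x *: (gphi (j :: I) x + phi (belast j I) x *: bvec (last j I))
  + \sum_(I : n.-tuple 'I_d) pderivs I g x *: (phi (belast j I) x *: bvec (last j I))
  = g x *: bvec j + two_scale_grad x.
Proof.
have [sg _] := tg.
pose B k := \sum_(I : k.-tuple 'I_d) pderivs I g x *: ((phi (belast j I) x)%:M *m bvec (last j I)).
have BE k : \sum_(I : k.-tuple 'I_d) pderivs I g x *: (phi (belast j I) x *: bvec (last j I)) = B k.
  by apply: eq_bigr => I _; rewrite mul_scalar_mx.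
have B0 : B 0%N = g x *: bvec j.
  rewrite /B (sum_tuple0 (fun I => pderivs I g x *: ((phi (belast j I) x)%:M *m bvec (last j I)))).
  by rewrite /= phi0 mul1mx.
have BS k : B k.+1 = \sum_(I : k.-tuple 'I_d) phi (j :: I) x *: grad (pderivs I g) x.
  rewrite /B (sum_pderivs_rcons (fun s => (phi s x)%:M)%R k j x sg).
  by apply: eq_bigr => I _; rewrite mul_scalar_mx.
rewrite BE /two_scale_grad.
under eq_bigr do under eq_bigr do rewrite scalerDr.
under eq_bigr do rewrite big_split /=.
under [in RHS]eq_bigr do rewrite big_split /=.
rewrite !big_split /= -addrA [RHS]addrCA; congr (_ + _).
under eq_bigr do rewrite BE.
rewrite -(big_nat_recr n 0 B)//= big_nat_recl// B0; congr (_ + _).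
by apply: eq_bigr => k _; exact: BS.
Qed.


Definition dual_flux x : E :=
  \sum_(I : n.-1.-tuple 'I_d)
     (phi (j :: I) x *: (a x)^T - sig (j :: I) x) *m grad (pderivs I g) x.

(** The sum starts at order 2: the term of order 1 is kept apart, as it has to be compared with the
    transposed coefficient of the first corrector of a. *)
Definition eff_flux x : E :=
  \sum_(2 <= k < n.+1) \sum_(I : k.-1.-tuple 'I_d)
     pderivs I g x *: (ab (belast j I) *m bvec (last j I)).

(** The divergence of the skew field sigma_(j I) d^I g, by the product rule. *)
Definition div_part k (I : k.-tuple 'I_d) x : E :=
  pderivs I g x *: divs (j :: I) x + sig (j :: I) x *m grad (pderivs I g) x.

Hypothesis n_gt0 : (0 < n)%N.

(** Inserting the equation of sigma, each order k < n of [two_scale_gradE] contributes a divergence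
    of sigma, a term in sigma of one order less and an effective flux; the order n leaves phi a^T,
    which cancels against [dual_flux]. The terms in sigma, shifted by one order since sigma of the
    empty index is 0, complete the divergences of sigma to those of the products with derivatives of
    g. *)
Lemma two_scale_flux : {ae mu, forall x,
  (a x)^T *m (g x *: bvec j + two_scale_grad x) - dual_flux x
    - g x *: (ab [::] *m bvec j) - eff_flux x =
  \sum_(0 <= k < n) \sum_(I : k.-tuple 'I_d) div_part I x}.
Proof.
have [sg _] := tg.
apply: filterS Hsigeq => x Hx.
pose T k (c : seq 'I_d -> 'M[R]_d) : E :=
  \sum_(I : k.-tuple 'I_d) pderivs I g x *: (c (belast j I) *m bvec (last j I)).
pose cp s := phi s x *: (a x)^T.
pose cs s := sig s x.
have TS k (c : seq 'I_d -> 'M[R]_d) : T k.+1 c =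
  \sum_(I : k.-tuple 'I_d) c (j :: I) *m grad (pderivs I g) x.
  by rewrite /T (sum_pderivs_rcons c k j x sg).
have T0 (c : seq 'I_d -> 'M[R]_d) : T 0%N c = g x *: (c [::] *m bvec j).
  by rewrite /T (sum_tuple0 (fun I => pderivs I g x *: (c (belast j I) *m bvec (last j I)))).
have eD : dual_flux x = T n cp - T n cs.
  rewrite /dual_flux -(prednK n_gt0) !TS -sumrB; apply: eq_bigr => I _.
  by rewrite mulmxBl.
have eE : eff_flux x = \sum_(0 <= k < n.-1) T k.+1 ab.
  rewrite /eff_flux -{1}(prednK n_gt0).
  by rewrite !big_add1 /=.
have eV : (a x)^T *m (g x *: bvec j + two_scale_grad x) =
   \sum_(0 <= k < n) \sum_(I : k.-tuple 'I_d) pderivs I g x *: divs (j :: I) x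
   + \sum_(0 <= k < n) T k cs + \sum_(0 <= k < n) T k ab + T n cp.
  rewrite -two_scale_gradE mulmxDr; congr (_ + _).
    rewrite mulmx_sumr -!big_split /= big_nat_cond [RHS]big_nat_cond.
    apply: eq_bigr => k /andP[/andP[_ kn] _].
    rewrite mulmx_sumr -!big_split /=; apply: eq_bigr => I _.
    rewrite -!scalerDr -scalemxAr; apply: (congr1 ( *:%R (pderivs I g x))).
    have := Hx (belast j I) (last j I) (size_belast_lt I kn).
    rewrite -lastI => ->.
    rewrite /cs mulmxDr mulmxBl -scalemxAl -scalemxAr.
    by apply/colP => l; rewrite !mxE; ring.
  rewrite mulmx_sumr; apply: eq_bigr => I _.
  by rewrite -!scalemxAr -scalemxAl.
rewrite eV eD eE.
have -> : \sum_(0 <= k < n) T k ab = g x *: (ab [::] *m bvec j) + \sum_(0 <= k < n.-1) T k.+1 ab.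
  by rewrite -{1}(prednK n_gt0) big_nat_recl// T0.
have -> : \sum_(0 <= k < n) \sum_(I : k.-tuple 'I_d) div_part I x =
   \sum_(0 <= k < n) \sum_(I : k.-tuple 'I_d) pderivs I g x *: divs (j :: I) x +
   \sum_(0 <= k < n) T k.+1 cs.
  rewrite -big_split; apply: eq_bigr => k _ /=; rewrite TS -big_split.
  by apply: eq_bigr => I _.
have -> : \sum_(0 <= k < n) T k.+1 cs = \sum_(0 <= k < n) T k cs + T n cs.
  rewrite -(big_nat_recr n 0 (fun k => T k cs))//= big_nat_recl// T0 /cs sig0.
  by rewrite mul0mx scaler0 add0r.
move: (\sum_(0 <= k < n) \sum_(I : _) _) (\sum_(0 <= k < n) T k cs) (\sum_(_ <= _ < n.-1) _).
move: (T n cp) (T n cs) (g x *: _) => A B C D F G.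
by apply/colP => l; rewrite !mxE; ring.
Qed.

Lemma div_part_vsq k (I : k.-tuple 'I_d) : (k < n)%N -> vsq (div_part I).
Proof.
move=> kn.
have hs p q : H1loc (fun x => sig (j :: I) x p q) (fun x => gsig (j :: I) x p q).
  by rewrite lastI; apply: Hsig; exact: size_belast_lt.
have tI := tf_pderivs I tg.
apply: vsqD => l.
  apply: (@sqint_ext _ _ _ _ (fun x => \sum_(q < d) gsig (j :: I) x l q q 0 * pderivs I g x)) => [x|].
    by rewrite !mxE mulrC mulr_suml.
  apply: sqint_sum => q _; have /H1locP[_ h _] := hs l q.
  exact: L2loc_tf.
apply: (@sqint_ext _ _ _ _ (fun x => \sum_(q < d) sig (j :: I) x l q * pderiv q (pderivs I g)
  x)) => [x|].
  by rewrite !mxE; apply: eq_bigr => q _; rewrite mxE.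
apply: sqint_sum => q _; have /H1locP[h _ _] := hs l q.
by apply: L2loc_tf => //; exact: tf_pderiv.
Qed.

Lemma dual_flux_vsq (K : R) : (forall p q, measurable_fun setT (fun x => a x p q)) ->
  (forall x p q, `|a x p q| <= K) -> vsq dual_flux.
Proof.
move=> ma aK; apply: vsq_sum => I _.
have kn : (n.-1 < n)%N by rewrite prednK.
have hs p q : H1loc (fun x => sig (j :: I) x p q) (fun x => gsig (j :: I) x p q).
  by rewrite lastI; apply: Hsig; exact: size_belast_lt.
have hp : H1loc (phi (j :: I)) (gphi (j :: I)).
  by rewrite lastI; apply: Hphi; exact: size_belast_lt.
have tI := tf_pderivs I tg.
move=> l.
apply: (@sqint_ext _ _ _ _ (fun x => \sum_(q < d) (a x q l * (phi (j :: I) x * pderiv q (pderivs I g) x)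
    + (-1) * (sig (j :: I) x l q * pderiv q (pderivs I g) x)))) => [x|].
  by rewrite mxE; apply: eq_bigr => q _; rewrite !mxE; ring.
apply: sqint_sum => q _; apply: sqintD.
  apply: (@sqint_bndM _ _ _ _ K) => //.
  by have /H1locP[h _ _] := hp; apply: L2loc_tf => //; exact: tf_pderiv.
apply: sqintZ; have /H1locP[h _ _] := hs l q.
by apply: L2loc_tf => //; exact: tf_pderiv.
Qed.

Lemma eff_flux_vsq : vsq eff_flux.
Proof.
apply: vsq_sum => k _; apply: vsq_sum => I _.
by apply: vsq_tfv; exact: tf_pderivs.
Qed.

Lemma two_scale_flux_int (K : R) (psi : E -> R) (Dpsi : E -> E) :
  (forall p q, measurable_fun setT (fun x => a x p q)) ->
  (forall x p q, `|a x p q| <= K) -> dotH1 psi Dpsi ->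
  \int[mu]_x dot (Dpsi x) ((a x)^T *m (g x *: bvec j + two_scale_grad x)) =
  \int[mu]_x dot (Dpsi x) (dual_flux x) +
  \int[mu]_x dot (Dpsi x) (g x *: (ab [::] *m bvec j)) +
  \int[mu]_x dot (Dpsi x) (eff_flux x).
Proof.
move=> ma aK hpsi; have [_ sD] := hpsi.
have sD' : vsq Dpsi by move=> l; exact/L2_sqint.
have sU : vsq two_scale_grad by have [_ h] := two_scale_dotH1; move=> l; exact/L2_sqint.
have maT p q : measurable_fun setT (fun x => (a x)^T p q).
  by under eq_fun do rewrite mxE; exact: ma.
have aTK x p q : `|(a x)^T p q| <= K by rewrite mxE.
have s1 : vsq (fun x => (a x)^T *m (g x *: bvec j + two_scale_grad x)).
  by apply: (vsq_mx (K := K)) => //; apply: vsqD => //; exact: vsq_tfv.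
have s2 := dual_flux_vsq ma aK.
have s3 : vsq (fun x => g x *: (ab [::] *m bvec j)) by exact: vsq_tfv.
have s4 := eff_flux_vsq.
apply/eqP; rewrite -!subr_eq; apply/eqP.
have sS : vsq (fun x => \sum_(0 <= k < n) \sum_(I : k.-tuple 'I_d) div_part I x).
  apply: (@vsq_ext _ _ (fun x => \sum_(k <- index_iota 0 n | (k < n)%N)
      \sum_(I : k.-tuple 'I_d) div_part I x)).
    move=> x; rewrite big_seq_cond [RHS]big_seq_cond.
    by apply: eq_bigl => k; rewrite mem_index_iota; case: (k < n)%N; rewrite ?andbF.
  by apply: vsq_sum => k kn; apply: vsq_sum => I _; exact: div_part_vsq.
have e0 : \int[mu]_x dot (Dpsi x) (\sum_(0 <= k < n) \sum_(I : k.-tuple 'I_d) div_part I x) = 0.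
  transitivity (\sum_(k <- index_iota 0 n | (k < n)%N) \sum_(I : k.-tuple 'I_d)
      \int[mu]_x dot (Dpsi x) (div_part I x)).
    transitivity (\int[mu]_x dot (Dpsi x) (\sum_(k <- index_iota 0 n | (k < n)%N)
      \sum_(I : k.-tuple 'I_d) div_part I x)).
      apply: int_ext => x; apply: (congr1 (dot _)).
      rewrite big_seq_cond [RHS]big_seq_cond.
      by apply: eq_bigl => k; rewrite mem_index_iota; case: (k < n)%N; rewrite ?andbF.
    rewrite int_dot_sum//; last first.
      by move=> k kn; apply: vsq_sum => I _; exact: div_part_vsq.
    by apply: eq_bigr => k kn; rewrite int_dot_sum// => I _; exact: div_part_vsq.
  apply: big1 => k kn; apply: big1 => I _.
  (* [skew_div0] takes its mollifiers from g, so g = 0 is treated apart. *)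
  have [g0|/existsNP[x0 /eqP gx0]] := pselect (forall x, g x = 0).
    have pI : pderivs I g = fun=> 0.
      have -> : g = fun x => 0 * g x by apply/funext => x; rewrite g0 mul0r.
      rewrite pderivsZ; last by case: tg.
      by apply/funext => x; rewrite mul0r.
    rewrite -[RHS](int0 mu); apply: int_ext => x.
    rewrite /div_part pI scale0r add0r.
    have -> : grad (fun=> 0 : R) x = 0 :> E.
      by apply/colP => l; rewrite !mxE /pderiv derive_cst.
    by rewrite mulmx0 dot0r.
  apply: (skew_div0 tg gx0 hpsi).
  - by move=> x; rewrite lastI; apply: Hskew; exact: size_belast_lt.
  - by move=> p q; rewrite lastI; apply: Hsig; exact: size_belast_lt.
  - exact: tf_pderivs.
have i1 := vsqB s1 s2; have i2 := vsqB i1 s3; have i3 := vsqB i2 s4.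
have e1 := int_dotB sD' s1 s2; have e2 := int_dotB sD' i1 s3; have e3 := int_dotB sD' i2 s4.
have e4 : \int[mu]_x dot (Dpsi x) ((a x)^T *m (g x *: bvec j + two_scale_grad x) - dual_flux x
    - g x *: (ab [::] *m bvec j) - eff_flux x) =
  \int[mu]_x dot (Dpsi x) (\sum_(0 <= k < n) \sum_(I : k.-tuple 'I_d) div_part I x).
  apply: int_ae.
  - exact: (intg_meas (vsq_dot sD' i3)).
  - exact: (intg_meas (vsq_dot sD' sS)).
  - by apply: filterS two_scale_flux => x ->.
have e5 := etrans (esym e3) (etrans e4 e0).
by move: e5 e2 e1; move: (Rintegral _ _ _) (Rintegral _ _ _) (Rintegral _ _ _) (Rintegral _ _ _)
  (Rintegral _ _ _) (Rintegral _ _ _) => A B C D F G; lra.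
Qed.

End two_scale.

Section two_scale_derivative.
Context {R : realType} {d : nat}.
Local Notation E := 'cV[R]_d.
Local Notation mu := (lebesgue_cV d).

Lemma int_dot_le (s : R) (V W : E -> E) : 0 < s -> vsq V -> vsq W ->
  `|\int[mu]_x dot (V x) (W x)| <=
    s / 2 * (\int[mu]_x dot (V x) (V x)) + (2 * s)^-1 * (\int[mu]_x dot (W x) (W x)).
Proof.
move=> s0 hV hW.
have e (F H : E -> E) : vsq F -> vsq H -> \int[mu]_x dot (F x) (H x) =
    \sum_(l < d) \int[mu]_x (F x l 0 * H x l 0).
  by move=> hF hH; rewrite -int_sum// => l _; exact: sqint_mul.
rewrite (e _ _ hV hW) (e _ _ hV hV) (e _ _ hW hW).
rewrite !mulr_sumr -big_split; apply: le_trans (ler_norm_sum _ _ _) _.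
apply: ler_sum => l _; apply: le_trans (int_mul_le s0 (hV l) (hW l)) _.
by rewrite lexx.
Qed.

Lemma dot_ge0 (u : E) : 0 <= dot u u.
Proof. by apply: sumr_ge0 => l _; rewrite -expr2 sqr_ge0. Qed.

Lemma dot_mulmx_le (K : R) (M : 'M[R]_d) (u : E) : (forall p q, `|M p q| <= K) ->
  `|dot u (M *m u)| <= K * d%:R * dot u u.
Proof.
move=> hM; apply: (@le_trans _ _ (\sum_(p < d) \sum_(q < d) K * ((u p 0 ^+ 2 + u q 0 ^+ 2) / 2))).
  apply: le_trans (ler_norm_sum _ _ _) _; apply: ler_sum => p _.
  rewrite mxE mulr_sumr; apply: le_trans (ler_norm_sum _ _ _) _; apply: ler_sum => q _.
  rewrite mulrCA !normrM; apply: ler_pM; [by []|by rewrite mulr_ge0|exact: hM|].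
  rewrite -(real_normK (num_real (u p 0))) -(real_normK (num_real (u q 0))).
  have := sqr_ge0 (`|u p 0| - `|u q 0|); move: `|u p 0| `|u q 0| => x y; nra.
apply/eqW; have e : \sum_(p < d) \sum_(q < d) u p 0 ^+ 2 = d%:R * dot u u.
  transitivity (\sum_(p < d) d%:R * (u p 0 * u p 0)).
    by apply: eq_bigr => p _; rewrite sumr_const card_ord expr2 mulr_natl.
  by rewrite -mulr_sumr.
transitivity (\sum_(p < d) \sum_(q < d) (K / 2 * (u p 0 ^+ 2) + K / 2 * (u q 0 ^+ 2))).
  by apply: eq_bigr => p _; apply: eq_bigr => q _; field.
under eq_bigr do rewrite big_split /=.
rewrite big_split /= [X in _ + X]exchange_big /=.
have e2 : \sum_(p < d) \sum_(q < d) (K / 2 * (u p 0 ^+ 2)) = K / 2 * (d%:R * dot u u).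
  by rewrite -e mulr_sumr; apply: eq_bigr => p _; rewrite mulr_sumr.
by rewrite e2; field.
Qed.

Variables (lambda K : R) (a : E -> 'M[R]_d).
Hypothesis lambda_gt0 : 0 < lambda.
Hypothesis ma : forall p q, measurable_fun setT (fun x => a x p q).
Hypothesis aK : forall x p q, `|a x p q| <= K.
Hypothesis a_coercive : forall x u, lambda * dot u u <= dot u (a x *m u).

(** Test the equation of psi with psi. For small t the coercivity of a absorbs the term with da, and
    the right-hand side carries a factor t, so grad psi is of order t in L^2. *)
Lemma perturbation_energy (da : E -> 'M[R]_d) (p0 : E -> E) : admissible da -> vloc p0 ->
  exists Q r : R, 0 < r /\ forall (t : R) psi Dpsi, `|t| < r ->
    lax_milgram (fun x => a x + t *: da x) (fun x => (t *: da x) *m p0 x) psi Dpsi ->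
    \int[mu]_x dot (Dpsi x) (Dpsi x) <= t ^+ 2 * Q.
Proof.
move=> hda hp0; have [mda [k dK] _] := hda.
(* As a bound on the entries of da, k is nonnegative unless there are no entries. *)
have K0 : 0 <= k \/ d = 0%N.
  case: d (da) dK => [|d'] da' dK; [by right|left].
  exact: le_trans (normr_ge0 _) (dK 0 0 0).
have kd0 : 0 <= k * d%:R by case: K0 => [h|->]; [rewrite mulr_ge0|rewrite mulr0].
pose Q0 := \int[mu]_x dot (da x *m p0 x) (da x *m p0 x).
(* For such t the term with da costs at most lambda / 4 of the energy, and the right-hand side
   another lambda / 4 plus t ^+ 2 / lambda * Q0. Half of the coercivity remains, whence the factor 2
   / lambda ^+ 2. *)
exists (2 * lambda ^- 2 * Q0), (lambda / (4 * (k * d%:R + 1))).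
split; first by rewrite divr_gt0// mulr_gt0// ltr_wpDl.
move=> t psi Dpsi ht [hpsi eqpsi]; have [_ sD] := hpsi.
have sD' : vsq Dpsi by move=> l; exact/L2_sqint.
have sq := vsq_adm hda hp0.
have s1 : vsq (fun x => da x *m Dpsi x) by apply: (vsq_mx (K := k)).
have s2 : vsq (fun x => a x *m Dpsi x) by apply: (vsq_mx (K := K)).
have := eqpsi psi Dpsi hpsi.
rewrite (@int_ext _ _ _ _ _ (fun x => dot (Dpsi x) (a x *m Dpsi x + t *: (da x *m Dpsi x))));
  last first.
  by move=> x; rewrite mulmxDl -scalemxAl.
rewrite int_dotD//; last exact: vsqZ.
rewrite int_dotZ//.
rewrite [X in _ = - X -> _](@int_ext _ _ _ _ _ (fun x => dot (Dpsi x) (t *: (da x *m p0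
  x)))); last first.
  by move=> x; rewrite -scalemxAl.
rewrite int_dotZ//.
have h1 : lambda * \int[mu]_x dot (Dpsi x) (Dpsi x) <= \int[mu]_x dot (Dpsi x) (a x *m Dpsi x).
  rewrite -intZ; last exact: vsq_dot.
  by apply: int_le => [||x]; [apply: intgZ; exact: vsq_dot|exact: vsq_dot|exact: a_coercive].
have h2 : `|\int[mu]_x dot (Dpsi x) (da x *m Dpsi x)| <= k * d%:R * \int[mu]_x dot (Dpsi x) (Dpsi x).
  rewrite -intZ; last exact: vsq_dot.
  apply: int_norm_le => [||x]; [exact: vsq_dot|apply: intgZ; exact: vsq_dot|].
  exact: dot_mulmx_le.
have h4 : 0 <= \int[mu]_x dot (Dpsi x) (Dpsi x) by apply: int_ge0 => x; exact: dot_ge0.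
have Q00 : 0 <= Q0 by apply: int_ge0 => x; exact: dot_ge0.
have [->|t0] := eqVneq t 0.
  rewrite expr0n /= !mul0r addr0 oppr0 => e.
  by rewrite -(pmulr_rle0 _ lambda_gt0); apply: le_trans h1 _; rewrite e.
have h31 : (- ((\int[mu]_x dot (Dpsi x) (da x *m p0 x)) * t) <=
     lambda / 4 * (\int[mu]_x dot (Dpsi x) (Dpsi x)) + t ^+ 2 / lambda * Q0).
  (* Chosen so that |t| * s / 2 = lambda / 4. *)
  have s0 : 0 < lambda / (2 * `|t|) by rewrite divr_gt0// mulr_gt0// normr_gt0.
  have := int_dot_le s0 sD' sq; rewrite -/Q0.
  move: (Rintegral _ _ _) (Rintegral _ _ _) => N X h.
  have : `|X| * `|t| <= lambda / 4 * N + t ^+ 2 / lambda * Q0.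
    apply: le_trans (ler_wpM2r (normr_ge0 t) h) _.
    rewrite -(real_normK (num_real t)).
    have key (u : R) : u != 0 -> (lambda / (2 * u) / 2 * N + (2 * (lambda / (2 * u)))^-1 * Q0) * u =
        lambda / 4 * N + u ^+ 2 / lambda * Q0.
      by move=> u0; field; rewrite u0 gt_eqF.
    by apply/eqW/key; rewrite normr_eq0.
  apply: le_trans; rewrite -normrM; apply: le_trans (ler_norm _) _.
  by rewrite normrN.
move: h1 h2 h31 h4; rewrite -/Q0.
have ht' : `|t| * (k * d%:R) <= lambda / 4.
  apply: (@le_trans _ _ (lambda / (4 * (k * d%:R + 1)) * (k * d%:R + 1))).
    by apply: ler_pM => //; [exact: ltW|rewrite lerDl].
  apply/eqW; have : k * d%:R + 1 != 0 by rewrite gt_eqF// ltr_wpDl.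
  by move: (k * d%:R) => z z0; field.
move: (Rintegral _ _ (fun x => dot (Dpsi x) (Dpsi x))) (Rintegral _ _ (fun x => dot (Dpsi x)
  (a x *m Dpsi x))).
move: (Rintegral _ _ (fun x => dot (Dpsi x) (da x *m Dpsi x))) (Rintegral _ _ (fun x => dot
  (Dpsi x) (da x *m p0 x))).
move=> X Y N Z h1 h2 h3 h4 e.
have h5 : - (t * X) <= lambda / 4 * N.
  apply: le_trans (ler_norm _) _; rewrite normrN normrM.
  apply: (@le_trans _ _ (`|t| * (k * d%:R * N))); first exact: ler_wpM2l.
  by rewrite mulrA; apply: ler_wpM2r.
have h6 : lambda / 2 * N <= t ^+ 2 / lambda * Q0 by move: h3; lra.
have -> : t ^+ 2 * (2 / lambda ^+ 2 * Q0) = 2 / lambda * (t ^+ 2 / lambda * Q0).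
  by field; rewrite gt_eqF.
have -> : N = 2 / lambda * (lambda / 2 * N) by field; rewrite gt_eqF.
by apply: ler_wpM2l => //; rewrite divr_ge0// ltW.
Qed.

Variables (phi : seq 'I_d -> E -> R) (gphi : seq 'I_d -> E -> E).
Variables (sig : seq 'I_d -> E -> 'M[R]_d) (gsig : seq 'I_d -> E -> 'I_d -> 'I_d -> E).
Variables (ab : seq 'I_d -> 'M[R]_d) (n : nat) (i j : 'I_d) (g : E -> R).
Hypothesis phi0 : forall x, phi [::] x = 1.
Hypothesis sig0 : forall x, sig [::] x = 0.
Hypothesis Hphi : forall s k, (size s < n)%N -> H1loc (phi (rcons s k)) (gphi (rcons s k)).
Hypothesis Hskew : forall s k x, (size s < n)%N -> (sig (rcons s k) x)^T = - sig (rcons s k) x.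
Hypothesis Hsig : forall s k, (size s < n)%N -> forall p q,
  H1loc (fun x => sig (rcons s k) x p q) (fun x => gsig (rcons s k) x p q).
Hypothesis Hsigeq : {ae mu, forall x, forall s k, (size s < n)%N ->
  (\col_p \sum_(q < d) gsig (rcons s k) x p q q 0) = (a x)^T *m gphi (rcons s k) x
    + (phi s x *: (a x)^T - sig s x) *m bvec k - ab s *m bvec k}.
Hypothesis tg : tf g.
Hypothesis n_gt0 : (0 < n)%N.
Variables (ab1 : 'M[R]_d) (Dphi : E -> E).
Hypothesis vDphi : vloc Dphi.
Hypothesis Hab : forall x, g x *: (ab [::] *m bvec j) = g x *: (ab1^T *m bvec j).

Let p0 x := Dphi x + bvec i.
Let U := two_scale_grad phi gphi n j g.
Let ef := eff_flux ab n j g.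

(** Only algebra: the commutator is affine in the coefficient field and in the corrector gradient
    separately. The equations enter in [commutator_increment]. *)
Lemma commutatorB (b : E -> 'M[R]_d) (Dpsi : E -> E) (t : R) (da : E -> 'M[R]_d) :
  b = (fun x => a x + t *: da x) -> admissible da -> vsq Dpsi ->
  commutator ab1 ab n i j b (fun x => Dphi x + Dpsi x) g - commutator ab1 ab n i j a Dphi g =
  \int[mu]_x dot (g x *: bvec j) (t *: (da x *m p0 x))
  + \int[mu]_x dot (g x *: bvec j) (b x *m Dpsi x)
  - \int[mu]_x dot (Dpsi x) (g x *: (ab1^T *m bvec j)) - \int[mu]_x dot (Dpsi x) (ef x).
Proof.
move=> eb hda sD; have [mda [k dK] _] := hda.
have sg : vsq (fun x => g x *: bvec j) by exact: vsq_tfv.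
have sq := vsq_adm hda (vlocD vDphi (vloc_cst (bvec i))).
have s1 : vsq (fun x => a x *m Dpsi x) by apply: (vsq_mx (K := K)).
have s2 : vsq (fun x => da x *m Dpsi x) by apply: (vsq_mx (K := k)).
have s3 : vsq (fun x => b x *m Dpsi x).
  by apply: vsq_ext (vsqD s1 (vsqZ t s2)) => x; rewrite eb mulmxDl -scalemxAl.
have s4 : vsq (fun x => ab1 *m Dpsi x).
  apply: (vsq_mx (b := fun=> ab1) (K := \sum_p \sum_q `|ab1 p q|)) => // _ p q.
  by rewrite (bigD1 p)//= (bigD1 q)//= -addrA lerDl addr_ge0// ?sumr_ge0// => *; rewrite sumr_ge0.
have s5 : vsq (fun x => g x *: (ab1^T *m bvec j)) by exact: vsq_tfv.
have s6 : vsq (fun x => (a x - ab1) *m (g x *: p0 x)).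
  apply: (vsq_mx (K := K + \sum_p \sum_q `|ab1 p q|)).
  - move=> p q; under eq_fun do rewrite !mxE.
    by apply: measurable_funB.
  - move=> x p q; rewrite !mxE; apply: le_trans (ler_normB _ _) _; apply: lerD => //.
    by rewrite (bigD1 p)//= (bigD1 q)//= -addrA lerDl addr_ge0// ?sumr_ge0// => *; rewrite sumr_ge0.
  - by apply: vsq_tfZ => //; exact: vlocD vDphi (vloc_cst (bvec i)).
have eD (I : seq 'I_d) l : dist_pderivs I (fun x => (Dphi x + Dpsi x) l 0) g =
    dist_pderivs I (fun x => Dphi x l 0) g + dist_pderivs I (fun x => Dpsi x l 0) g.
  have tI := tf_pderivs I tg.
  rewrite /dist_pderivs -mulrDr -intD; [|exact: L2loc_tf_intg|].
    by apply: (congr1 ( *%R _)); apply: int_ext => x; rewrite mxE mulrDl.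
  by apply: L2loc_tf_intg => //; apply: sqint_L2loc.
have e2 : \sum_(2 <= k < n.+1) (-1) ^+ k.-1 * \sum_(I : k.-1.-tuple 'I_d)
     dot (ab (belast j I) *m bvec (last j I)) (\col_l dist_pderivs I (fun x => (Dphi x + Dpsi x) l 0) g)
   = \sum_(2 <= k < n.+1) (-1) ^+ k.-1 * \sum_(I : k.-1.-tuple 'I_d)
     dot (ab (belast j I) *m bvec (last j I)) (\col_l dist_pderivs I (fun x => Dphi x l 0) g)
   + \int[mu]_x dot (Dpsi x) (ef x).
  transitivity (\sum_(2 <= k < n.+1) (-1) ^+ k.-1 * \sum_(I : k.-1.-tuple 'I_d)
     dot (ab (belast j I) *m bvec (last j I)) (\col_l dist_pderivs I (fun x => Dphi x l 0) g)
   + \sum_(2 <= k < n.+1) (-1) ^+ k.-1 * \sum_(I : k.-1.-tuple 'I_d)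
     dot (ab (belast j I) *m bvec (last j I)) (\col_l dist_pderivs I (fun x => Dpsi x l 0) g)).
    rewrite -big_split; apply: eq_bigr => k' _ /=; rewrite -mulrDr -big_split.
    apply: (congr1 ( *%R _)); apply: eq_bigr => I _ /=; rewrite -dotDr.
    by apply: (congr1 (dot _)); apply/colP => l; rewrite !mxE; exact: eD.
  apply: (congr1 ( +%R _)); rewrite /ef /eff_flux int_dot_sum//; last first.
    move=> k' _; apply: vsq_sum => I _; apply: vsq_tfv; exact: tf_pderivs.
  apply: eq_bigr => k' _; rewrite int_dot_sum//; last first.
    by move=> I _; apply: vsq_tfv; exact: tf_pderivs.
  rewrite mulr_sumr; apply: eq_bigr => I _.
  have tI := tf_pderivs I tg.
  rewrite /dot mulr_sumr int_sum; last first.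
    by move=> l _; apply: sqint_mul => //; exact: (vsq_tfv (ab (belast j I) *m bvec (last j I)) tI l).
  apply: eq_bigr => l _; rewrite [(\col__ _) l 0]mxE /dist_pderivs size_tuple.
  (* The sign in the commutator cancels the one in [dist_pderivs], both having exponent k - 1. *)
  rewrite mulrCA (mulrA ((-1) ^+ _)) -exprMn mulrN1 opprK expr1n mul1r -intZ; last first.
    by apply: L2loc_tf_intg => //; apply: sqint_L2loc.
  by apply: int_ext => x; rewrite [in RHS]mxE; ring.
have e1 : \int[mu]_x (g x * dot (bvec j) ((b x - ab1) *m (Dphi x + Dpsi x + bvec i))) =
   \int[mu]_x (g x * dot (bvec j) ((a x - ab1) *m (Dphi x + bvec i))) +
   \int[mu]_x dot (g x *: bvec j) (t *: (da x *m p0 x))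
  + \int[mu]_x dot (g x *: bvec j) (b x *m Dpsi x)
  - \int[mu]_x dot (g x *: bvec j) (ab1 *m Dpsi x).
  have i0 : intg mu (fun x => g x * dot (bvec j) ((a x - ab1) *m (Dphi x + bvec i))).
    apply: (@intg_ext _ _ _ _ (fun x => \sum_(l < d) (a x - ab1) j l * (p0 x l 0 * g x))) => [x|].
      by rewrite dot_bvec mxE mulr_sumr; apply: eq_bigr => l _; rewrite mulrA mulrC.
    apply: intg_sum => l _; apply: (@intg_bndM _ _ _ _ (K + \sum_p \sum_q `|ab1 p q|)).
    - by under eq_fun do rewrite !mxE; apply: measurable_funB.
    - move=> x; rewrite !mxE; apply: le_trans (ler_normB _ _) _; apply: lerD => //.
      by rewrite (bigD1 j)//= (bigD1 l)//= -addrA lerDl addr_ge0// ?sumr_ge0// => *; rewrite sumr_ge0.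
    - by apply: L2loc_tf_intg => //; exact: (vlocD vDphi (vloc_cst (bvec i)) l).
  have i1 := vsq_dot sg (vsqZ t sq); have i2 := vsq_dot sg s3; have i3 := vsq_dot sg s4.
  rewrite -intD// -intD; [|exact: intgD|by []].
  rewrite -intB; [|by apply: intgD => //; exact: intgD|by []].
  apply: int_ext => x; rewrite -!dotZl -!dotDr -dotBr; apply: (congr1 (dot _)).
  rewrite eb /p0 /= !mulmxDl !mulmxDr !mulNmx scalerDr -!scalemxAl.
  by apply/colP => l; rewrite !mxE; ring.
have e3 : \int[mu]_x dot (g x *: bvec j) (ab1 *m Dpsi x) =
  \int[mu]_x dot (Dpsi x) (g x *: (ab1^T *m bvec j)).
  apply: int_ext => x; rewrite dot_mulmx dotC; apply: (congr1 (dot _)).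
  by rewrite -scalemxAr.
rewrite /commutator e1 e2 e3.
move: (\sum_(_ <= _ < _) _) (Rintegral _ _ _) (Rintegral _ _ _) (Rintegral _ _ _) (Rintegral
  _ _ _) (Rintegral _ _ _).
by move=> *; ring.
Qed.

(** The equation of psi turns the terms of [commutatorB] containing t da into pairings of grad u +
    grad h with a grad psi; transposing a makes these computable from the equation of h and the flux
    identity. *)
Lemma commutator_increment (psi h : E -> R) (Dpsi Dh : E -> E) (t : R) (da : E -> 'M[R]_d) :
  admissible da -> lax_milgram (fun x => (a x)^T) (dual_flux a phi sig n j g) h Dh ->
  lax_milgram (fun x => a x + t *: da x) (fun x => (t *: da x) *m p0 x) psi Dpsi ->
  commutator ab1 ab n i j (fun x => a x + t *: da x) (fun x => Dphi x + Dpsi x) g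
    - commutator ab1 ab n i j a Dphi g =
  t * (\int[mu]_x dot (g x *: bvec j + U x + Dh x) (da x *m p0 x)
       + \int[mu]_x dot (g x *: bvec j + U x + Dh x) (da x *m Dpsi x)).
Proof.
move=> hda [hh eqh] [hpsi eqpsi]; have [mda [k dK] _] := hda.
have [_ sD] := hpsi; have [_ sDh] := hh.
have sD' : vsq Dpsi by move=> l; exact/L2_sqint.
have sDh' : vsq Dh by move=> l; exact/L2_sqint.
rewrite (@commutatorB _ Dpsi t da)//.
have hU : dotH1 (two_scale phi n j g) U by exact: two_scale_dotH1.
have sU : vsq U by have [_ s] := hU; move=> l; exact/L2_sqint.
have sg : vsq (fun x => g x *: bvec j) by exact: vsq_tfv.
have sq := vsq_adm hda (vlocD vDphi (vloc_cst (bvec i))).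
have s1 : vsq (fun x => a x *m Dpsi x) by apply: (vsq_mx (K := K)).
have s2 : vsq (fun x => da x *m Dpsi x) by apply: (vsq_mx (K := k)).
pose W x := a x *m Dpsi x + t *: (da x *m Dpsi x).
have sW : vsq W by apply: vsqD => //; exact: vsqZ.
have eW x : (a x + t *: da x) *m Dpsi x = W x by rewrite mulmxDl -scalemxAl.
pose q x := t *: (da x *m p0 x).
have sq' : vsq q by exact: vsqZ.
have eq x : (t *: da x) *m p0 x = q x by rewrite -scalemxAl.
have eqT (v : E -> R) Dv : dotH1 v Dv -> \int[mu]_x dot (Dv x) (W x) = - \int[mu]_x dot (Dv x) (q x).
  move=> hv; apply: etrans (etrans (eqpsi v Dv hv) _); last first.
    by apply: (congr1 -%R); apply: int_ext => x; rewrite eq.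
  by apply: int_ext => x; rewrite eW.
have eA : \int[mu]_x dot (g x *: bvec j) ((a x + t *: da x) *m Dpsi x) =
    \int[mu]_x dot (g x *: bvec j) (W x) by apply: int_ext => x; rewrite eW.
rewrite eA {eA}.
have e1 := eqT _ _ hU; have e2 := eqT _ _ hh.
have sV1 := vsqD sg sU; have sV := vsqD sV1 sDh'.
have f1 := int_dotDl sW sV1 sDh'; have f2 := int_dotDl sW sg sU.
have g1 := int_dotDl sq' sV1 sDh'; have g2 := int_dotDl sq' sg sU.
have f3 := int_dotD sV s1 (vsqZ t s2); have f4 := int_dotZ t sV s2; have g3 := int_dotZ t sV sq.
have k1 := eqh _ _ hpsi.
have k2 := two_scale_flux_int j phi0 sig0 Hphi Hskew Hsig Hsigeq tg n_gt0 ma aK hpsi.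
have k3 : \int[mu]_x dot (Dpsi x) (g x *: (ab [::] *m bvec j)) =
    \int[mu]_x dot (Dpsi x) (g x *: (ab1^T *m bvec j)).
  by apply: int_ext => x; rewrite Hab.
have sAT V : vsq V -> vsq (fun x => (a x)^T *m V x).
  apply: (vsq_mx (K := K)) => [p q0|x p q0]; last by rewrite mxE.
  by under eq_fun do rewrite mxE; exact: ma.
(* On the right, k1 and k2 contribute the flux defining h with opposite signs; what is left are
   exactly the effective fluxes subtracted in [commutatorB]. *)
have k4 : \int[mu]_x dot (g x *: bvec j + U x + Dh x) (a x *m Dpsi x) =
  \int[mu]_x dot (Dpsi x) ((a x)^T *m (g x *: bvec j + U x)) +
    \int[mu]_x dot (Dpsi x) ((a x)^T *m Dh x).
  rewrite -int_dotD//; [|exact: sAT|exact: sAT].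
  by apply: int_ext => x; rewrite dot_mulmx dotC mulmxDr.
move: k4 k3 k2 k1 g3 f4 f3 g2 g1 f2 f1 e2 e1.
rewrite -/(ef) -/U -/q.
set I1 := \int[mu]_x dot (g x *: bvec j) (q x).
set I2 := \int[mu]_x dot (g x *: bvec j) (W x).
move=> k4 k3 k2 k1 g3 f4 f3 g2 g1 f2 f1 e2 e1.
rewrite mulrDr.
rewrite -g3 -f4.
move: f3; rewrite -/W; move=> f3.
have m1 := etrans (esym f1) f3.
rewrite g1 g2.
have m2 := etrans m1 (congr1 (+%R^~ _) k4).
move: m2; rewrite f2 e1 e2 k1 k2 k3 => m2.
move: m2.
rewrite -/I1 -/I2.
move: (I1) (I2) => J1 J2.
move: (Rintegral _ _ _) (Rintegral _ _ _) (Rintegral _ _ _) (Rintegral _ _ _) (Rintegral _ _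
  _) (Rintegral _ _ _).
by move=> *; lra.
Qed.

Lemma two_scale_functional_derivative (Uc : (E -> 'M[R]_d) -> E -> E) (h : E -> R) (Dh : E -> E) :
  corrector_gradient_map a Dphi i Uc ->
  lax_milgram (fun x => (a x)^T) (dual_flux a phi sig n j g) h Dh ->
  functional_derivative (fun b => commutator ab1 ab n i j b (Uc b) g) a
    (fun x => tens (Dphi x + bvec i)
       (\sum_(0 <= k < n) \sum_(I : k.-tuple 'I_d)
          pderivs I g x *: (gphi (j :: I) x + phi (belast j I) x *: bvec (last j I))
        + \sum_(I : n.-tuple 'I_d)
            pderivs I g x *: (phi (belast j I) x *: bvec (last j I))
        + Dh x)).
Proof.
move=> [Uca hUc] hLM da hda.
have [[_ sDh] _] := hLM.
have sDh' : vsq Dh by move=> l; exact/L2_sqint.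
have sU : vsq U by have [_ s] := two_scale_dotH1 j Hphi tg; move=> l; exact/L2_sqint.
have sV : vsq (fun x => g x *: bvec j + U x + Dh x).
  by apply: vsqD => //; apply: vsqD => //; exact: vsq_tfv.
have vp0 : vloc p0 := vlocD vDphi (vloc_cst (bvec i)).
have sq := vsq_adm hda vp0.
have eD x : ddot (tens (Dphi x + bvec i) (\sum_(0 <= k < n) \sum_(I : k.-tuple 'I_d)
          pderivs I g x *: (gphi (j :: I) x + phi (belast j I) x *: bvec (last j I))
        + \sum_(I : n.-tuple 'I_d)
            pderivs I g x *: (phi (belast j I) x *: bvec (last j I))
        + Dh x)) (da x) = dot (g x *: bvec j + U x + Dh x) (da x *m p0 x).
  by rewrite ddot_tens two_scale_gradE.
split; first by apply: intg_ext (vsq_dot sV sq) => x; rewrite eD.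
under int_ext do rewrite eD.
have [mda [k dK] _] := hda.
pose W x := (da x)^T *m (g x *: bvec j + U x + Dh x).
have sW : vsq W.
  apply: (vsq_mx (K := k)) => // [p q|x p q]; last by rewrite mxE.
  by under eq_fun do rewrite mxE; exact: mda.
have [Q [r [r0 hQ]]] := perturbation_energy hda vp0.
(* The error is the integral of W . grad psi; [int_dot_le] with s = |t| and the energy bound t ^+ 2
   * Q make it at most |t| * M. *)
pose M := (\int[mu]_x dot (W x) (W x) + Q) / 2.
set L := \int[mu]_x _.
have near_bound : \forall t \near (0 : R), t != 0 -> `|L -
   (commutator ab1 ab n i j (fun x => a x + t *: da x) (Uc (fun x => a x + t *: da x)) g
      - commutator ab1 ab n i j a (Uc a) g) / t| <= `|t| * M.
  have : \forall t \near (0 : R), `|t| < r.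
    by apply/nbhs_ballP; exists r => //= t; rewrite /ball /= sub0r normrN.
  apply: filterS2 (hUc da hda) => t [psi [Dpsi [hpsi ->]]] tr t0.
  rewrite Uca (commutator_increment hda hLM hpsi).
  have := hQ t psi Dpsi tr hpsi.
  have sD : vsq Dpsi by case: hpsi => -[_ s] _ l; exact/L2_sqint.
  have t0' : 0 < `|t| by rewrite normr_gt0.
  have := int_dot_le t0' sW sD.
  have -> : \int[mu]_x dot (W x) (Dpsi x) =
    \int[mu]_x dot (g x *: bvec j + U x + Dh x) (da x *m Dpsi x).
    by apply: int_ext => x; rewrite dot_mulmx.
  rewrite -/L /M; move: (Rintegral _ _ _) (Rintegral _ _ _) (Rintegral _ _ _) => A B D hB hD.
  rewrite mulrC mulKf// opprD addNKr normrN; apply: le_trans hB _.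
  have : (2 * `|t|)^-1 * A <= (2 * `|t|)^-1 * (t ^+ 2 * Q).
    by apply: ler_wpM2l => //; rewrite invr_ge0 mulr_ge0.
  rewrite -[t ^+ 2](real_normK (num_real t)).
  have -> : (2 * `|t|)^-1 * (`|t| ^+ 2 * Q) = `|t| / 2 * Q.
    have key (u : R) : u != 0 -> (2 * u)^-1 * (u ^+ 2 * Q) = u / 2 * Q by move=> u0; field.
    by apply: key; rewrite gt_eqF.
  lra.
apply/cvgrPdist_le => e e0; rewrite near_withinE.
have : \forall t \near (0 : R), `|t| * M <= e.
  have : \forall t \near (0 : R), `|t| < e / (`|M| + 1).
    have e1 : 0 < e / (`|M| + 1) by rewrite divr_gt0// ltr_wpDl.
    by apply/nbhs_ballP; exists (e / (`|M| + 1)) => //= t; rewrite /ball /= sub0r normrN.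
  apply: filterS => t ht.
  apply: (@le_trans _ _ (e / (`|M| + 1) * (`|M| + 1))); last first.
    by rewrite divfK// gt_eqF// ltr_wpDl.
  apply: le_trans (ler_norm _) _; rewrite normrM normr_id.
  by apply: ler_pM => //; [exact: ltW|rewrite lerDl].
by apply: filterS2 near_bound => t h1 h2 t0; apply: le_trans h2; exact: h1.
Qed.

End two_scale_derivative.

(** * One-dimensional Gaussian laws *)

Section density.
Import HBNNSimple.
Context {dT : measure_display} {T : measurableType dT} {R : realType}.
Variables (mu nu : {measure set T -> \bar R}) (rho : T -> R).
Hypothesis mrho : measurable_fun setT rho.
Hypothesis rho0 : forall x, 0 <= rho x.
Hypothesis nuE : forall A, measurable A -> nu A = (\int[mu]_(x in A) (rho x)%:E)%E.

(** True for indicators by [nuE], hence for nonnegative simple functions, and in general by monotone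
    convergence on both sides. *)
Lemma ge0_integral_density (f : T -> R) : measurable_fun setT f -> (forall x, 0 <= f x) ->
  (\int[nu]_x (f x)%:E = \int[mu]_x (f x * rho x)%:E)%E.
Proof.
move=> mf f0; have mEf : measurable_fun setT (EFin \o f) by exact/measurable_EFinP.
have f0' x : setT x -> (0 <= (EFin \o f) x)%E by move=> _; rewrite lee_fin.
pose g := nnsfun_approx measurableT mEf.
have nd x : {homo (fun k => g k x) : a b / (a <= b)%N >-> a <= b}.
  by move=> a b ab; have /lefP := nd_nnsfun_approx measurableT mEf ab; exact.
have cg x : g k x @[k --> \oo] --> f x.
  by have /fine_cvgP[] := cvg_nnsfun_approx measurableT mEf f0' (x := x) I.
have L1 : (\int[nu]_x (f x)%:E = limn (fun k => \int[nu]_x (g k x)%:E))%E.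
  rewrite -monotone_convergence//.
  - apply: eq_integral => x _; apply/esym/cvg_lim => //.
    by apply/fine_cvgP; split; [exact: nearW|exact: cg].
  - by move=> k; exact/measurable_EFinP.
  - by move=> k x _; rewrite lee_fin.
  - by move=> x _ a b ab; rewrite lee_fin; exact: nd.
have L2 : (\int[mu]_x (f x * rho x)%:E = limn (fun k => \int[mu]_x (g k x * rho x)%:E))%E.
  rewrite -monotone_convergence//.
  - apply: eq_integral => x _; apply/esym/cvg_lim => //.
    apply/fine_cvgP; split; first exact: nearW.
    by apply: (@cvgM _ _ _ _ (fun k => g k x) (fun=> rho x)); [exact: cg|exact: cvg_cst].
  - by move=> k; apply/measurable_EFinP; exact: measurable_funM.
  - by move=> k x _; rewrite lee_fin mulr_ge0.
  - by move=> x _ a b ab; rewrite lee_fin ler_wpM2r//; exact: nd.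
rewrite L1 L2; congr (limn _); apply/funext => k.
have mI (A : set T) : measurable A -> (\int[nu]_x (\1_A x)%:E = \int[mu]_x (\1_A x * rho x)%:E)%E.
  move=> mA; rewrite integral_indic// setIT nuE// integral_mkcond; apply: eq_integral => x _.
  by rewrite patchE indicE; case: (x \in A); rewrite ?mul1r ?mul0r.
under eq_integral do rewrite fimfunE -fsumEFin//.
under [RHS]eq_integral.
  move=> x _; rewrite fimfunE EFinM -fsumEFin//.
  rewrite ge0_mule_fsuml; last by move=> y; exact: nnfun_muleindic_ge0.
  over.
rewrite ge0_integral_fsum//; last 2 first.
- by move=> y; exact/measurable_EFinP/measurableT_comp.
- by move=> n x _; rewrite EFinM nnfun_muleindic_ge0.
rewrite ge0_integral_fsum//; last 2 first.
- by move=> y; apply/measurable_EFinP; apply: measurable_funM => //; exact: measurableT_comp.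
- by move=> n x _; rewrite mule_ge0 ?lee_fin//; have := nnfun_muleindic_ge0 (g k) n x;
  rewrite -EFinM lee_fin.
apply: eq_fsbigr => y /[!inE] -[x _ gx].
have y0 : 0 <= y by rewrite -gx.
have mgy : measurable (g k @^-1` [set y]) by [].
under eq_integral do rewrite EFinM.
rewrite ge0_integralZl//; last first.
  by apply/measurable_EFinP; exact: measurable_indic.
rewrite mI// -ge0_integralZl//.
- by apply: eq_integral => z _; rewrite -!EFinM mulrA.
- by apply/measurable_EFinP; apply: measurable_funM => //; exact: measurable_indic.
- by move=> z _; rewrite lee_fin mulr_ge0.
Qed.

Lemma intg_density (f : T -> R) : measurable_fun setT f ->
  intg nu f <-> intg mu (fun x => f x * rho x).
Proof.
move=> mf; have mfr : measurable_fun setT (fun x => f x * rho x) by exact: measurable_funM.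
have e : (\int[nu]_x `|(f x)%:E| = \int[mu]_x `|(f x * rho x)%:E|)%E.
  have := @ge0_integral_density (fun x => `|f x|) (measurableT_comp (@normr_measurable R
    setT) mf) (fun x => normr_ge0 _).
  move=> h; transitivity (\int[nu]_x (`|f x|)%:E)%E; first by [].
  rewrite h; apply: eq_integral => x _.
  by rewrite /= normrM (ger0_norm (rho0 x)).
split=> /integrableP[_ h]; apply/integrableP; split; try exact/measurable_EFinP.
  by rewrite -e.
by rewrite e.
Qed.

Lemma int_density (f : T -> R) : measurable_fun setT f ->
  \int[nu]_x f x = \int[mu]_x (f x * rho x).
Proof.
move=> mf; congr fine; rewrite [LHS]integralE [RHS]integralE; congr (_ - _)%E.
  rewrite (eq_integral (fun x => (Num.max (f x) 0)%:E)); last by move=> x _; rewrite funeposE EFin_max.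
  rewrite ge0_integral_density//; last 2 first.
  - exact: measurable_maxr.
  - by move=> x; rewrite le_max lexx orbT.
  apply: eq_integral => x _; rewrite funeposE -EFin_max; congr EFin.
  by rewrite maxr_pMl// mul0r.
rewrite (eq_integral (fun x => (Num.max (- f x) 0)%:E)); last by move=> x _; rewrite funenegE EFin_max.
rewrite ge0_integral_density//; last 2 first.
- by apply: measurable_maxr => //; exact: measurableT_comp.
- by move=> x; rewrite le_max lexx orbT.
apply: eq_integral => x _; rewrite funenegE -EFinN -EFin_max; congr EFin.
by rewrite maxr_pMl// mul0r mulNr.
Qed.

End density.

Section real_line.
Context {R : realType}.


Local Notation L := (@lebesgue_measure R).
Implicit Types f : R -> R.

Let mp_affine (c s : R) : (s == 1) || (s == -1) -> forall A : set (measurableTypeR R),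
  measurable A -> L ((fun x => c + s * x) @^-1` A) = L A.
Proof. exact: lebesgue_measure_affine. Qed.

Let m_affine (c s : R) : measurable_fun setT (fun x : measurableTypeR R => c +
  s * x : measurableTypeR R).
Proof. by apply: measurable_funD => //; exact: measurable_funM. Qed.

Lemma intgR_affine (c s : R) f : (s == 1) || (s == -1) -> intg L f -> intg L (fun x => f (c + s * x)).
Proof. by move=> ss; apply: (intg_mp (m_affine c s)); exact: mp_affine. Qed.

Lemma intR_affine (c s : R) f : (s == 1) || (s == -1) -> measurable_fun setT f ->
  \int[L]_x f (c + s * x) = \int[L]_x f x.
Proof. by move=> ss; apply: (int_mp (m_affine c s)); exact: mp_affine. Qed.

End real_line.

Section normal.
Context {R : realType}.
Local Notation L := (@lebesgue_measure R).
Local Notation pdf := (@normal_pdf R).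
Implicit Types (s t r m x z : R) (F : R -> R).

Lemma pdfE m s x : s != 0 ->
  pdf m s x = normal_peak s * expR (- (x - m) ^+ 2 / (s ^+ 2 *+ 2)).
Proof. by move=> s0; rewrite normal_pdfE. Qed.

Lemma pdf_center m s x : s != 0 -> pdf m s (m + 1 * x) = pdf 0 s x.
Proof. by move=> s0; rewrite !pdfE// mul1r addrC addKr subr0. Qed.

Lemma pdf_sym s x : s != 0 -> pdf 0 s (0 + (-1) * x) = pdf 0 s x.
Proof. by move=> s0; rewrite !pdfE// add0r mulN1r !subr0 sqrrN. Qed.

Lemma intg_pdf m s : intg L (pdf m s).
Proof. exact: integrable_normal_pdf. Qed.

Lemma int_pdf m s : \int[L]_x pdf m s x = 1.
Proof. by rewrite /Rintegral integral_normal_pdf. Qed.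

(** Domination by a normal density of twice the variance: with y = x ^+ 2 / (4 s ^+ 2) the function
    is proportional to y exp (- 2 y), and y exp (- y) <= 1 leaves exp (- y). *)
Lemma intg_sqr_pdf s : s != 0 -> intg L (fun x => x ^+ 2 * pdf 0 s x).
Proof.
move=> s0; pose u := Num.sqrt 2 * s.
have u2 : u ^+ 2 = 2 * s ^+ 2 by rewrite exprMn sqr_sqrtr.
have u0 : u != 0 by rewrite mulf_neq0// sqrtr_eq0 -ltNge.
pose K := 4 * s ^+ 2 * (normal_peak s / normal_peak u).
apply: (intg_dom _ _ (intgZ K (intg_pdf 0 u))).
  by apply: measurable_funM => //; exact: measurable_normal_pdf.
move=> x; rewrite ger0_norm; last by rewrite mulr_ge0// ?sqr_ge0// normal_pdf_ge0.
have hp : normal_peak u != 0 by rewrite gt_eqF// normal_peak_gt0.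
have -> : K * pdf 0 u x = 4 * s ^+ 2 * (normal_peak s * expR (- x ^+ 2 / (u ^+ 2 *+ 2))).
  by rewrite pdfE// subr0 /K; field.
rewrite pdfE// subr0 u2.
set y := x ^+ 2 / (4 * s ^+ 2).
have sp : 0 < s ^+ 2 by rewrite exprn_even_gt0.
have -> : - x ^+ 2 / (s ^+ 2 *+ 2) = - y - y.
  by rewrite /y; field.
have -> : - x ^+ 2 / (2 * s ^+ 2 *+ 2) = - y by rewrite /y; field.
have -> : x ^+ 2 = 4 * s ^+ 2 * y by rewrite /y; field.
rewrite -[leLHS]mulrA; apply: ler_wpM2l; first by rewrite mulr_ge0 ?sqr_ge0.
rewrite mulrCA; apply: ler_wpM2l; first exact: normal_peak_ge0.
rewrite expRD mulrA ler_piMl ?expR_ge0// expRN.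
have e0 := expR_gt0 y; rewrite ler_pdivrMr// mul1r.
by apply: le_trans (expR_ge1Dx y); rewrite lerDr.
Qed.

Lemma intg_id_pdf s : s != 0 -> intg L (fun x => x * pdf 0 s x).
Proof.
move=> s0; apply: (intg_dom _ _ (intgD (intg_sqr_pdf s0) (intg_pdf 0 s))).
  by apply: measurable_funM => //; exact: measurable_normal_pdf.
move=> x; have p0 := normal_pdf_ge0 0 s x.
rewrite normrM (ger0_norm p0) -[leRHS](_ : (x ^+ 2 + 1) * pdf 0 s x = _); last by rewrite mulrDl mul1r.
apply: ler_wpM2r => //.
by rewrite -(real_normK (num_real x)); have := sqr_ge0 (`|x| - 1);
  move: `|x| (normr_ge0 x) => u u0; nra.
Qed.

Lemma int_odd_pdf F s : s != 0 -> measurable_fun setT F -> (forall x, F (- x) = - F x) ->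
  intg L (fun x => F x * pdf 0 s x) -> \int[L]_x (F x * pdf 0 s x) = 0.
Proof.
move=> s0 mF oF iF.
have ss : ((-1 : R) == 1) || ((-1 : R) == -1) by rewrite eqxx orbT.
have := intR_affine 0 ss (intg_meas iF).
have e : \int[L]_x (F (0 + (-1) * x) * pdf 0 s (0 + (-1) * x)) = - \int[L]_x (F x * pdf 0 s x).
  rewrite -intN//; apply: int_ext => x.
  by rewrite pdf_sym// add0r mulN1r oF mulNr.
move=> /(etrans (esym e)); move: (Rintegral _ _ _) => y; lra.
Qed.

(** Completing the square. For independent X and Y with these densities, the joint density of X and
    X + Y at (x, z) is the density of X + Y at z times the conditional density of X given X + Y =
    z. *)
Lemma pdf_conv s t x z : s != 0 -> t != 0 ->
  let r := Num.sqrt (s ^+ 2 + t ^+ 2) in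
  pdf 0 s x * pdf 0 t (z - x) =
    pdf 0 r z * pdf (s ^+ 2 / r ^+ 2 * z) (s * t / r) x.
Proof.
move=> s0 t0 r.
have sp : 0 < s ^+ 2 by rewrite exprn_even_gt0.
have tp : 0 < t ^+ 2 by rewrite exprn_even_gt0.
have r2 : r ^+ 2 = s ^+ 2 + t ^+ 2 by rewrite sqr_sqrtr// addr_ge0// ltW.
have rp : 0 < r by rewrite sqrtr_gt0 addr_gt0.
have r0 : r != 0 by rewrite gt_eqF.
have st0 : s * t / r != 0 by rewrite !mulf_neq0// invr_eq0.
rewrite !pdfE// !subr0 mulrACA -expRD [RHS]mulrACA -expRD.
congr (_ * expR _); last first.
  have key (a b : R) : a != 0 -> b != 0 -> a + b != 0 ->
      - x ^+ 2 / (a *+ 2) + - (z - x) ^+ 2 / (b *+ 2) =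
      - z ^+ 2 / ((a + b) *+ 2) + - (x - a / (a + b) * z) ^+ 2 / (a * b / (a + b) *+ 2).
    by move=> a0 b0 ab0; field; rewrite a0 b0 ab0.
  rewrite expr_div_n exprMn r2; apply: key; rewrite ?expf_neq0//.
  by rewrite gt_eqF// addr_gt0.
have h0 (u : R) : 0 <= u ^+ 2 * pi *+ 2 by rewrite mulrn_wge0// mulr_ge0 ?pi_ge0 ?sqr_ge0.
rewrite /normal_peak -[LHS]invfM -[RHS]invfM -(sqrtrM _ (h0 s)) -(sqrtrM _ (h0 r)).
congr (_^-1); congr Num.sqrt; rewrite expr_div_n exprMn; field.
exact: r0.
Qed.

(* A centered Gaussian of variance s^2 + t^2 is the sum of independent ones; this
   gives the variance and the characteristic function without computing either. *)
Lemma int_pdf_conv F s t : s != 0 -> t != 0 -> measurable_fun setT F ->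
  let r := Num.sqrt (s ^+ 2 + t ^+ 2) in intg L (fun z => F z * pdf 0 r z) ->
  (forall x, intg L (fun y => F (x + y) * pdf 0 t y)) ->
  \int[L]_z (F z * pdf 0 r z) =
  \int[L]_x (pdf 0 s x * \int[L]_y (F (x + y) * pdf 0 t y)).
Proof.
move=> s0 t0 mF r iF iF2.
pose g x z := pdf (s ^+ 2 / r ^+ 2 * z) (s * t / r) x.
have sp : 0 < s ^+ 2 by rewrite exprn_even_gt0.
have tp : 0 < t ^+ 2 by rewrite exprn_even_gt0.
have rp : 0 < r by rewrite sqrtr_gt0 addr_gt0.
have st0 : s * t / r != 0 by rewrite !mulf_neq0// invr_eq0 gt_eqF.
have mg : measurable_fun setT (fun p : measurableTypeR R * measurableTypeR R => g p.1 p.2).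
  rewrite /g; under eq_fun do rewrite pdfE//.
  apply: measurable_funM => //; apply: measurableT_comp => //.
  apply: measurable_funM => //; apply: measurableT_comp => //.
  apply: measurable_funX; apply: measurable_funB; first exact: measurable_fst.
  by apply: measurable_funM => //; exact: measurable_snd.
have ig (z : R) : intg L (fun x => g x z) by exact: intg_pdf.
have gn (z : R) : \int[L]_x `|g x z| <= 1.
  by apply: eqW; rewrite -(int_pdf (s ^+ 2 / r ^+ 2 * z) (s * t / r)); apply: int_ext => x;
    rewrite ger0_norm// normal_pdf_ge0.
have iP := prod_intg2 mg ig gn iF.
have e1 := Rfubini iP.
transitivity (\int[L]_z \int[L]_x (F z * pdf 0 r z * g x z)).
  apply: int_ext => z; rewrite intZ; last exact: ig.
  by rewrite int_pdf mulr1.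
rewrite -e1; apply: int_ext => x /=.
have h1 : ((1 : R) == 1) || ((1 : R) == -1) by rewrite eqxx.
have iH : intg L (fun z => F z * pdf 0 t (z - x)).
  apply: intg_ext (intgR_affine (- x) h1 (iF2 x)) => z /=.
  by rewrite mul1r addrA subrr add0r addrC.
have e2 : \int[L]_y (F (x + 1 * y) * pdf 0 t (x + 1 * y - x)) =
  \int[L]_y (F y * pdf 0 t (y - x)) := intR_affine x h1 (intg_meas iH).
have e3 : \int[L]_y (F (x + y) * pdf 0 t y) = \int[L]_y (F (x + 1 * y) * pdf 0 t (x + 1 * y - x)).
  by apply: int_ext => y; rewrite mul1r [x + y - x]addrC addKr.
apply: (etrans _ (congr1 ( *%R (pdf 0 s x)) (esym (etrans e3 e2)))).
apply: (etrans _ (intZ _ iH)); apply: int_ext => z.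
by rewrite /g -mulrA -(pdf_conv x z s0 t0) mulrCA.
Qed.


(** The variance of the centered normal law and, next, its characteristic function at 1, which is
    real because the law is even. Neither needs a closed form. *)
Definition nvar s : R := \int[L]_x (x ^+ 2 * pdf 0 s x).
Definition nchar s : R := \int[L]_x (cos x * pdf 0 s x).

Lemma intg_bnd_pdf F s : measurable_fun setT F -> (forall x, `|F x| <= 1) ->
  intg L (fun x => F x * pdf 0 s x).
Proof. by move=> mF F1; apply: (intg_bndM (K := 1)) => //; exact: intg_pdf. Qed.

Lemma norm_cos_le x : `|cos x : R| <= 1.
Proof. by rewrite ler_norml cos_geN1 cos_le1. Qed.

Lemma norm_sin_le x : `|sin x : R| <= 1.
Proof. by rewrite ler_norml sin_geN1 sin_le1. Qed.

Lemma measurable_cosR : measurable_fun [set: R] (@cos R).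
Proof. exact: continuous_measurable_fun (@continuous_cos R). Qed.

Lemma measurable_sinR : measurable_fun [set: R] (@sin R).
Proof. exact: continuous_measurable_fun (@continuous_sin R). Qed.

Lemma nvarD s t : s != 0 -> t != 0 -> nvar (Num.sqrt (s ^+ 2 + t ^+ 2)) = nvar s + nvar t.
Proof.
move=> s0 t0; set r := Num.sqrt _.
have rp : r != 0 by rewrite gt_eqF// sqrtr_gt0 addr_gt0 ?exprn_even_gt0.
have e x y : (x + y) ^+ 2 * pdf 0 t y =
  (x ^+ 2 * pdf 0 t y + 2 * x * (y * pdf 0 t y)) + y ^+ 2 * pdf 0 t y.
  ring.
have i1 x : intg L (fun y => x ^+ 2 * pdf 0 t y) by apply: intgZ; exact: intg_pdf.
have i2 x : intg L (fun y => 2 * x * (y * pdf 0 t y)) by apply: intgZ; exact: intg_id_pdf.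
have i3 := intg_sqr_pdf t0.
rewrite /nvar int_pdf_conv//; last 2 first.
- exact: intg_sqr_pdf.
- by move=> x; apply: intg_ext (intgD (intgD (i1 x) (i2 x)) i3) => y; rewrite e.
have eI x : \int[L]_y ((x + y) ^+ 2 * pdf 0 t y) = x ^+ 2 + nvar t.
  transitivity (\int[L]_y ((x ^+ 2 * pdf 0 t y + 2 * x * (y * pdf 0 t y)) + y ^+ 2 * pdf 0 t y)).
    by apply: int_ext => y; exact: e.
  rewrite intD//; last exact: intgD.
  rewrite intD// intZ; last exact: intg_pdf.
  rewrite int_pdf intZ; last exact: intg_id_pdf.
  rewrite (int_odd_pdf t0 (F := id))//; last exact: intg_id_pdf.
  by rewrite mulr0 addr0 mulr1.
transitivity (\int[L]_x (x ^+ 2 * pdf 0 s x + nvar t * pdf 0 s x)).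
  by apply: int_ext => x; rewrite eI; ring.
rewrite intD; [|exact: intg_sqr_pdf|by apply: intgZ; exact: intg_pdf].
by rewrite intZ ?int_pdf ?mulr1//; exact: intg_pdf.
Qed.

Lemma ncharM s t : s != 0 -> t != 0 -> nchar (Num.sqrt (s ^+ 2 + t ^+ 2)) = nchar s * nchar t.
Proof.
move=> s0 t0; set r := Num.sqrt _.
have rp : r != 0 by rewrite gt_eqF// sqrtr_gt0 addr_gt0 ?exprn_even_gt0.
have ic u : intg L (fun y => cos y * pdf 0 u y).
  exact: intg_bnd_pdf measurable_cosR norm_cos_le.
have is_ u : intg L (fun y => sin y * pdf 0 u y).
  exact: intg_bnd_pdf measurable_sinR norm_sin_le.
have e x y : cos (x + y) * pdf 0 t y = cos x * (cos y * pdf 0 t y) - sin x * (sin y * pdf 0 t y).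
  by rewrite cosD; ring.
have i1 x : intg L (fun y => cos x * (cos y * pdf 0 t y)) by exact: intgZ.
have i2 x : intg L (fun y => sin x * (sin y * pdf 0 t y)) by exact: intgZ.
rewrite /nchar (int_pdf_conv s0 t0 measurable_cosR); last 2 first.
- exact: ic.
- by move=> x; apply: intg_ext (intgB (i1 x) (i2 x)) => y; rewrite e.
have eI x : \int[L]_y (cos (x + y) * pdf 0 t y) = cos x * nchar t.
  transitivity (\int[L]_y (cos x * (cos y * pdf 0 t y) - sin x * (sin y * pdf 0 t y))).
    by apply: int_ext => y; exact: e.
  rewrite intB// intZ// intZ//.
  rewrite (int_odd_pdf t0 measurable_sinR)//; last by move=> y; rewrite sinN.
  by rewrite mulr0 subr0.
transitivity (\int[L]_x (nchar t * (cos x * pdf 0 s x))).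
  by apply: int_ext => x; rewrite eI; ring.
by rewrite intZ// mulrC.
Qed.

Lemma norm_sin_le_id x : `|sin x| <= `|x|.
Proof.
wlog x0 : x / 0 <= x.
  move=> h; have [|/ltW x0] := leP 0 x; first exact: h.
  by rewrite -normrN -sinN -(normrN x); apply: h; rewrite oppr_ge0.
move: x0; rewrite le_eqVlt => /predU1P[<-|x0]; first by rewrite sin0.
have ds (y : R) : is_derive y 1 (@sin R) (cos y) by exact: is_derive_sin.
have [|c _] := MVT x0 (fun y _ => ds y).
  by apply: continuous_subspaceT; exact: continuous_sin.
rewrite sin0 !subr0 => ->; rewrite normrM ler_piMl//; exact: norm_cos_le.
Qed.

Lemma cos_ge x : 1 - x ^+ 2 / 2 <= cos x.
Proof.
have -> : cos x = 1 - 2 * sin (x / 2) ^+ 2.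
  by rewrite {1}(splitr x) cosD -!expr2 cos2sin2; ring.
have : sin (x / 2) ^+ 2 <= (x / 2) ^+ 2.
  rewrite -(real_normK (num_real (sin _))) -(real_normK (num_real (x / 2))).
  by apply: lerXn2r; rewrite ?nnegrE//; exact: norm_sin_le_id.
lra.
Qed.

Lemma nvar_ge0 s : 0 <= nvar s.
Proof. by apply: int_ge0 => x; rewrite mulr_ge0 ?sqr_ge0 ?normal_pdf_ge0. Qed.

Lemma nchar_norm_le s : `|nchar s| <= 1.
Proof.
rewrite -(int_pdf 0 s); apply: int_norm_le.
- exact: intg_bnd_pdf measurable_cosR norm_cos_le.
- exact: intg_pdf.
- by move=> x; rewrite normrM (ger0_norm (normal_pdf_ge0 _ _ _)) ler_piMl ?normal_pdf_ge0// norm_cos_le.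
Qed.

Lemma nchar_ge s : s != 0 -> 1 - nvar s / 2 <= nchar s.
Proof.
move=> s0; have i2 := intg_sqr_pdf s0.
have e : 1 - nvar s / 2 = \int[L]_x (pdf 0 s x - 2^-1 * (x ^+ 2 * pdf 0 s x)).
  rewrite intB; [|exact: intg_pdf|exact: intgZ].
  by rewrite int_pdf intZ// mulrC.
rewrite e; apply: int_le.
- by apply: intgB; [exact: intg_pdf|exact: intgZ].
- exact: intg_bnd_pdf measurable_cosR norm_cos_le.
- move=> x; have := cos_ge x; have := normal_pdf_ge0 0 s x; move: (pdf 0 s x) (cos x) => p c; nra.
Qed.

(* Multiplicativity turns the Lipschitz bound into the bound 1 - cos x <= x^2 / 2. *)
Lemma nchar_lip s t : s != 0 -> t != 0 -> `|nchar s - nchar t| <= `|nvar s - nvar t| / 2.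
Proof.
wlog st : s t / s ^+ 2 <= t ^+ 2.
  move=> h s0 t0; have [st|/ltW st] := leP (s ^+ 2) (t ^+ 2); first exact: h.
  by rewrite distrC [X in _ <= X / 2]distrC; apply: h.
(* Both functions are even in their parameter, so t may be replaced by the square root of t ^+ 2,
   the form required by [nvarD] and [ncharM]. *)
have abs (F : R -> R) : (forall x, F (- x) = F x) -> forall x, F (Num.sqrt (x ^+ 2)) = F x.
  by move=> FN x; rewrite sqrtr_sqr; case: (ger0P x).
have pdfN u x : pdf 0 (- u) x = pdf 0 u x.
  by rewrite /normal_pdf oppr_eq0 /normal_peak /normal_fun sqrrN.
have vN u : nvar (- u) = nvar u by apply: int_ext => x; rewrite pdfN.
have cN u : nchar (- u) = nchar u by apply: int_ext => x; rewrite pdfN.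
move=> s0 t0; rewrite -(abs _ vN t) -(abs _ cN t).
pose u := Num.sqrt (t ^+ 2 - s ^+ 2).
have -> : t ^+ 2 = s ^+ 2 + u ^+ 2 by rewrite sqr_sqrtr ?subr_ge0// addrC subrK.
have [->|u0] := eqVneq u 0.
  by rewrite expr0n /= addr0 abs// abs// !subrr !normr0 mul0r.
rewrite ncharM// nvarD// opprD addNKr normrN -{1}(mulr1 (nchar s)) -mulrBr normrM.
have := nchar_norm_le s; have := nchar_ge u0; have := nvar_ge0 u.
have c1 := le_trans (ler_norm _) (nchar_norm_le u) => v0 cv cs.
rewrite (ger0_norm v0) [`|1 - _|]ger0_norm ?subr_ge0//.
by apply: (@le_trans _ _ (1 * (1 - nchar u))); [apply: ler_wpM2r; rewrite ?subr_ge0|lra].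
Qed.

(** At s = 0 [gaussian_rv] means a Dirac mass, and once the mean is 0 its variance is 0 and its
    characteristic function 1. *)
Definition gvar s : R := if s == 0 then 0 else nvar s.
Definition gchar s : R := if s == 0 then 1 else nchar s.

Let sqrt_eq0 s t : (Num.sqrt (s ^+ 2 + t ^+ 2) == 0) = (s == 0) && (t == 0).
Proof.
rewrite sqrtr_eq0 le_eqVlt ltNge addr_ge0 ?sqr_ge0//= orbF paddr_eq0 ?sqr_ge0//.
by rewrite !sqrf_eq0.
Qed.

Let pdfN u x : pdf 0 (- u) x = pdf 0 u x.
Proof. by rewrite /normal_pdf oppr_eq0 /normal_peak /normal_fun sqrrN. Qed.

Let nvar_abs u : nvar (Num.sqrt (u ^+ 2)) = nvar u.
Proof.
rewrite sqrtr_sqr; case: (ger0P u) => // _.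
by apply: int_ext => x; rewrite pdfN.
Qed.

Let nchar_abs u : nchar (Num.sqrt (u ^+ 2)) = nchar u.
Proof.
rewrite sqrtr_sqr; case: (ger0P u) => // _.
by apply: int_ext => x; rewrite pdfN.
Qed.

Lemma gvarD s t : gvar (Num.sqrt (s ^+ 2 + t ^+ 2)) = gvar s + gvar t.
Proof.
rewrite /gvar sqrt_eq0; have [->|s0] := eqVneq s 0; have [->|t0] := eqVneq t 0 => //=.
- by rewrite addr0.
- by rewrite expr0n /= !add0r nvar_abs.
- by rewrite expr0n /= !addr0 nvar_abs.
- exact: nvarD.
Qed.

Lemma gcharM s t : gchar (Num.sqrt (s ^+ 2 + t ^+ 2)) = gchar s * gchar t.
Proof.
rewrite /gchar sqrt_eq0; have [->|s0] := eqVneq s 0; have [->|t0] := eqVneq t 0 => //=.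
- by rewrite mulr1.
- by rewrite expr0n /= add0r mul1r nchar_abs.
- by rewrite expr0n /= addr0 mulr1 nchar_abs.
- exact: ncharM.
Qed.

Lemma gchar_lip s t : `|gchar s - gchar t| <= `|gvar s - gvar t| / 2.
Proof.
have key u : u != 0 -> `|1 - nchar u| <= nvar u / 2.
  move=> u0; have c1 := le_trans (ler_norm _) (nchar_norm_le u).
  by rewrite ger0_norm ?subr_ge0//; have := nchar_ge u0; lra.
rewrite /gchar /gvar; have [_|s0] := eqVneq s 0; have [_|t0] := eqVneq t 0.
- by rewrite !subrr !normr0 mul0r.
- by rewrite sub0r normrN [`|nvar t|]ger0_norm ?nvar_ge0//; exact: key.
- by rewrite distrC subr0 [`|nvar s|]ger0_norm ?nvar_ge0//; exact: key.
- exact: nchar_lip.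
Qed.

Context {dT : measure_display} {T : measurableType dT}.
Variable P : probability T R.

(** In the Dirac case as in the normal case the vanishing mean forces m = 0, so that s alone
    determines the law. *)
Lemma centered_gaussian (X : T -> R) : measurable_fun setT X -> gaussian_rv P X ->
  \int[P]_w X w = 0 -> exists s, [/\ sqint P X, \int[P]_w X w ^+ 2 = gvar s,
    \int[P]_w cos (X w) = gchar s & \int[P]_w sin (X w) = 0].
Proof.
move=> mX [m [s hX]] X0; exists s.
rewrite /gvar /gchar; have [s0|s0] := eqVneq s 0.
  have mp A : measurable A -> P (X @^-1` A) = dirac m A.
    by move=> mA; rewrite hX// s0 eqxx.
  have iF F : measurable_fun setT F -> \int[P]_w F (X w) = F m.
    move=> mF; rewrite (int_mp mX mp mF).
    by rewrite /Rintegral integral_dirac// ?diracT ?mul1e//; exact/measurable_EFinP.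
  have m0 : m = 0 by rewrite -X0 (iF id).
  have mX2 : measurable_fun setT (fun x : R => x ^+ 2) by exact: measurable_funX.
  split; [|by rewrite (iF _ mX2) m0 expr0n|by rewrite (iF _ measurable_cosR) m0 cos0|
    by rewrite (iF _ measurable_sinR) m0 sin0].
  split=> //; apply: (intg_mp mX mp (f := fun x => x ^+ 2)).
  apply/integrableP; split; first exact/measurable_EFinP.
  rewrite integral_dirac//; last by apply: measurableT_comp => //; exact/measurable_EFinP.
  by rewrite diracT mul1e ltry.
pose N : {measure set (measurableTypeR R) -> \bar R} := normal_prob m s.
have mp A : measurable A -> P (X @^-1` A) = N A.
  by move=> mA; rewrite hX// (negbTE s0).
have mpdf := measurable_normal_pdf m s.
have iE F : measurable_fun setT F -> \int[P]_w F (X w) = \int[L]_x (F x * pdf m s x).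
  move=> mF; rewrite (int_mp (m2 := N) mX mp mF).
  by apply: int_density => // x; exact: normal_pdf_ge0.
have iI F : measurable_fun setT F -> intg L (fun x => F x * pdf m s x) -> intg P (fun w => F (X w)).
  move=> mF iF; apply: (intg_mp (m2 := N) mX mp).
  apply/(intg_density (mu := L) mpdf (normal_pdf_ge0 m s)) => //.
have h1 : ((1 : R) == 1) || ((1 : R) == -1) by rewrite eqxx.
have sh F : measurable_fun setT F ->
  \int[L]_x (F x * pdf m s x) = \int[L]_x (F (m + 1 * x) * pdf 0 s x).
  move=> mF; rewrite -(intR_affine m h1 (measurable_funM mF mpdf)).
  by apply: int_ext => x; rewrite /= pdf_center.
have m0 : m = 0.
  move: X0; rewrite (iE id)// (sh id)//.
  rewrite (_ : Rintegral _ _ _ = \int[L]_x (m * pdf 0 s x + x * pdf 0 s x)); last first.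
    by apply: int_ext => x; rewrite mul1r mulrDl.
  rewrite intD; [|by apply: intgZ; exact: intg_pdf|exact: intg_id_pdf].
  rewrite intZ; last exact: intg_pdf.
  rewrite int_pdf mulr1 (int_odd_pdf s0 (F := id))//; last exact: intg_id_pdf.
  by rewrite addr0.
have mX2 : measurable_fun setT (fun x : R => x ^+ 2) by exact: measurable_funX.
split.
- split=> //; apply: (iI (fun x => x ^+ 2)) => //.
  by rewrite m0; exact: intg_sqr_pdf.
- by rewrite (iE _ mX2) m0.
- by rewrite (iE _ measurable_cosR) m0.
- rewrite (iE _ measurable_sinR) m0 (int_odd_pdf s0 measurable_sinR)//.
    by move=> x; rewrite sinN.
  exact: intg_bnd_pdf measurable_sinR norm_sin_le.
Qed.

End normal.

(** * Mixing of the Gaussian field *)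

Section bounded_algebra.
Context {dT : measure_display} {T : measurableType dT} {R : realType}.
Variable mu : {measure set T -> \bar R}.
Variable V : (T -> R) -> Prop.
Hypothesis V_sqint : forall f, V f -> sqint mu f.
Hypothesis VD : forall f g, V f -> V g -> V (fun x => f x + g x).
Hypothesis VZ : forall k f, V f -> V (fun x => k * f x).
Hypothesis V_lim : forall (f_ : nat -> T -> R) f h, sqint mu h ->
  (forall k, V (f_ k)) -> (forall x, f_ k x @[k --> \oo] --> f x) ->
  (forall k x, `|f_ k x| <= h x) -> V f.
Hypothesis VM : forall f g, (forall x, `|f x| <= 1) -> (forall x, `|g x| <= 1) ->
  V f -> V g -> V (fun x => f x * g x).
Hypothesis V1 : V (fun=> 1).

Let V1' : sqint mu (fun=> 1 : R) := V_sqint V1.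

Lemma V_norm (v : T -> R) : V v -> (forall x, `|v x| <= 1) -> V (fun x => `|v x|).
Proof.
move=> Vv v1.
(* Newton iteration for the square root of v ^+ 2. *)
pose p := fix p k x := if k is k'.+1 then p k' x + (v x ^+ 2 - p k' x ^+ 2) / 2 else 0 : R.
(* With u = |v x|, each step multiplies the error u - p by 1 - (u + p) / 2 <= 1 - u / 2; the
   convergence is geometric wherever v x != 0, and p stays 0 elsewhere. *)
have pb k x : 0 <= p k x <= `|v x| /\ `|v x| - p k x <= `|v x| * (1 - `|v x| / 2) ^+ k.
  elim: k => [|k [/andP[p0 pv] ih]] /=.
    by rewrite lexx normr_ge0 subr0 expr0 mulr1.
  have := v1 x; have := normr_ge0 (v x); rewrite -(real_normK (num_real (v x))).
  move: (`|v x|) pv ih => u pv ih u0 u1.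
  split; first by apply/andP; split; nra.
  have -> : u - (p k x + (u ^+ 2 - p k x ^+ 2) / 2) = (u - p k x) * (1 - (u + p k x) / 2) by field.
  rewrite exprSr mulrA; apply: ler_pM => //; [lra|lra|lra].
have p1 k x : `|p k x| <= 1.
  by have [/andP[h1 h2] _] := pb k x; rewrite ger0_norm// (le_trans h2).
have Vp k : V (p k).
  elim: k => [|k ih] /=.
    by rewrite (_ : (fun x => 0) = fun x => 0 * (1 : R)); [exact: VZ|apply/funext => x; rewrite mul0r].
  rewrite (_ : (fun x => _) = fun x => p k x + 2^-1 * (v x * v x + (-1) * (p k x * p k x))).
    by apply: VD => //; apply: VZ; apply: VD; [exact: VM|apply: VZ; exact: VM].
  by apply/funext => x; rewrite mulN1r -!expr2 mulrC.
apply: (V_lim (f_ := p) (h := fun=> 1)) => // x.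
apply/cvgrPdist_le => e e0.
have [v0|v0] := eqVneq (v x) 0.
  apply: nearW => k; have [/andP[h1 h2] _] := pb k x.
  move: h2; rewrite v0 normr0 => h2; rewrite (_ : p k x = 0) ?subrr ?normr0 ?ltW//.
  by apply/eqP; rewrite eq_le h1 h2.
have r1 : `|1 - `|v x| / 2| < 1.
  have := v1 x; have : 0 < `|v x| by rewrite normr_gt0.
  by move=> h1 h2; rewrite ger0_norm; lra.
have := cvg_expr r1 => /cvgr0Pnorm_le /(_ _ e0); apply: filterS => k hk.
have [/andP[h1 h2] h3] := pb k x.
rewrite ger0_norm ?subr_ge0//; apply: le_trans h3 _; apply: le_trans hk.
have r0 : 0 <= 1 - `|v x| / 2 by have := v1 x; lra.
by rewrite [`|_ ^+ k|]ger0_norm ?exprn_ge0// ler_piMl// exprn_ge0.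
Qed.

(** The function u is 1 minus the positive part of v: it equals 1 where v <= 0 and lies in [0, 1)
    elsewhere, so 1 - u ^+ k tends to the indicator. *)
Lemma V_indic_gt0 (v : T -> R) : V v -> (forall x, `|v x| <= 1) -> V (\1_[set x | 0 < v x]).
Proof.
move=> Vv v1; pose u x := 1 - (v x + `|v x|) / 2.
have Vu : V u.
  rewrite (_ : u = fun x => 1 + (-2^-1) * (v x + `|v x|)).
    by apply: VD => //; apply: VZ; apply: VD => //; exact: V_norm.
  by apply/funext => x; rewrite /u mulrC mulNr.
have u01 x : 0 <= u x <= 1.
  rewrite /u; have := v1 x; have := ler_norm (v x); have := ler_norm (- v x);
    rewrite normrN => h1 h2 h3.
  by apply/andP; split; lra.
have Vpow k : V (fun x => u x ^+ k).
  elim: k => [|k ih]; first by under eq_fun do rewrite expr0.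
  under eq_fun do rewrite exprS; apply: VM => // x; have /andP[h1 h2] := u01 x.
    by rewrite ger0_norm.
  by rewrite ger0_norm ?exprn_ge0// exprn_ile1.
apply: (V_lim (f_ := fun k x => 1 + (-1) * u x ^+ k) (h := fun=> 1)) => //.
- by move=> k; apply: VD => //; exact: VZ.
- move=> x; rewrite indicE; have [vx|vx] := ltP 0 (v x).
    rewrite mem_set// -[X in _ --> X]addr0; apply: cvgD; first exact: cvg_cst.
    rewrite -(mulr0 (-1)); apply: cvgM; first exact: cvg_cst.
    apply: cvg_expr; have := v1 x; rewrite /u !(ger0_norm (ltW vx)) => h1.
    by rewrite ger0_norm; lra.
  rewrite memNset/=; last by rewrite ltNge vx.
  apply: cvg_near_cst; apply: nearW => k.
  by rewrite /u ler0_norm// subrr mul0r subr0 expr1n mulN1r subrr.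
- move=> k x; have /andP[h1 h2] := u01 x.
  have h3 : 0 <= u x ^+ k by rewrite exprn_ge0.
  have h4 : u x ^+ k <= 1 by rewrite exprn_ile1.
  by rewrite mulN1r ger0_norm; lra.
Qed.

End bounded_algebra.

Section path_space.
Context {R : realType} {d : nat}.
Local Notation E := 'cV[R]_d.

Definition cylinders : set (set (E -> R)) := [set A | exists (x : E)
  (B : set (measurableTypeR R)), measurable B /\ A = [set w | B (w x)]].

(** The path space, with the sigma-algebra for which the functionals in the definition of
    [stationary] are the measurable functions. *)
Definition realization := g_sigma_algebraType cylinders.
HB.instance Definition _ := Measurable.on realization.

Lemma cylinder_measurableP (f : (E -> R) -> R) :
  cylinder_measurable f <-> measurable_fun [set: realization] (f : realization -> R).
Proof.
split=> h; first by move=> _ B mB; rewrite setTI; exact: h.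
by move=> B mB; have := h measurableT B mB; rewrite setTI.
Qed.

Lemma measurable_eval (x : E) : measurable_fun [set: realization] (fun w : realization => w x).
Proof.
move=> _ B mB; rewrite setTI; apply: sub_sigma_algebra; exists x, B; split=> //.
Qed.

Lemma measurable_to_path dT (T : measurableType dT) (F : T -> realization) :
  (forall x, measurable_fun setT (fun t => F t x)) -> measurable_fun setT F.
Proof.
move=> mF; apply: (@measurability _ _ _ _ setT F cylinders) => //.
move=> _ [_ [x [B [mB ->]]] <-].
exact: (mF x measurableT B mB).
Qed.

Definition translate (z : E) (w : realization) : realization := fun y => w (z + y).

Lemma measurable_translate z : measurable_fun setT (translate z).
Proof. by apply: measurable_to_path => x; exact: measurable_eval. Qed.

Definition lin (s : seq (R * E)) (w : realization) : R := \sum_(c <- s) c.1 * w c.2.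

Lemma lin_cat s t w : lin (s ++ t) w = lin s w + lin t w.
Proof. by rewrite /lin big_cat. Qed.

Definition opps (s : seq (R * E)) := [seq (- c.1, c.2) | c <- s].

Lemma lin_opps s w : lin (opps s) w = - lin s w.
Proof. by rewrite /lin big_map -sumrN; apply: eq_bigr => c _; rewrite mulNr. Qed.

Definition translates z (s : seq (R * E)) := [seq (c.1, z + c.2) | c <- s].

Lemma lin_translates z s w : lin s (translate z w) = lin (translates z s) w.
Proof. by rewrite /lin big_map. Qed.

Lemma measurable_lin s : measurable_fun setT (lin s).
Proof.
apply: measurable_sum => c; apply: measurable_funM => //; exact: measurable_eval.
Qed.

(** The phase brings in sines and constants without complex numbers, and makes the class closed
    under products through [cosM_half]. *)
Inductive trigpoly : (realization -> R) -> Prop :=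
| trig_cos s (th : R) : trigpoly (fun w => cos (lin s w + th))
| trig_add p q : trigpoly p -> trigpoly q -> trigpoly (fun w => p w + q w)
| trig_scale k p : trigpoly p -> trigpoly (fun w => k * p w).

Lemma trig_ext p q : p =1 q -> trigpoly p -> trigpoly q.
Proof. by move=> /funext ->. Qed.

Lemma cosM_half (x y : R) : cos x * cos y = 2^-1 * cos (x + y) + 2^-1 * cos (x - y).
Proof. by rewrite cosB cosD; field. Qed.

Lemma trig_mul p q : trigpoly p -> trigpoly q -> trigpoly (fun w => p w * q w).
Proof.
move=> tp tq; elim: tp => [s th|p1 p2 _ h1 _ h2|k p1 _ h1].
- elim: tq => [t th'|q1 q2 _ h1 _ h2|k q1 _ h1].
  + apply: (@trig_ext (fun w => 2^-1 * cos (lin (s ++ t) w + (th + th')) +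
        2^-1 * cos (lin (s ++ opps t) w + (th - th')))).
      move=> w; rewrite cosM_half !lin_cat lin_opps.
      by congr (_ * cos _ + _ * cos _); ring.
    by apply: trig_add; apply: trig_scale; exact: trig_cos.
  + by apply: trig_ext (trig_add h1 h2) => w; rewrite mulrDr.
  + by apply: trig_ext (trig_scale k h1) => w; rewrite mulrCA.
- by apply: trig_ext (trig_add h1 h2) => w; rewrite mulrDl.
- by apply: trig_ext (trig_scale k h1) => w; rewrite mulrA.
Qed.

Lemma trig_bounded p : trigpoly p -> measurable_fun setT p /\ exists K, forall w, `|p w| <= K.
Proof.
elim=> [s th|p1 p2 _ [m1 [K1 h1]] _ [m2 [K2 h2]]|k p1 _ [m1 [K1 h1]]].
- split; last by exists 1 => w; exact: norm_cos_le.
  apply: (@measurableT_comp _ _ _ _ _ _ (@cos R)); first exact: measurable_cosR.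
  by apply: measurable_funD => //; exact: measurable_lin.
- split; first exact: measurable_funD.
  by exists (K1 + K2) => w; apply: le_trans (ler_normD _ _) _; exact: lerD.
- split; first exact: measurable_funM.
  by exists (`|k| * K1) => w; rewrite normrM; apply: ler_wpM2l.
Qed.

Variable Q : {measure set realization -> \bar R}.
Hypothesis Q1 : sqint Q (fun=> 1 : R).

Lemma trig_sqint p : trigpoly p -> sqint Q p.
Proof.
move=> /trig_bounded[mp [K pK]].
by apply: sqint_ext (sqint_bndM mp pK Q1) => w; rewrite mulr1.
Qed.

Definition trig_limit (f : realization -> R) := sqint Q f /\
  forall e : R, 0 < e -> exists p, trigpoly p /\ sqnorm Q (fun w => f w - p w) <= e.

Lemma trig_limit_trig p : trigpoly p -> trig_limit p.
Proof.
move=> tp; split; first exact: trig_sqint.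
move=> e e0; exists p; split=> //; rewrite /sqnorm.
under int_ext do rewrite subrr expr0n /=.
by rewrite int0 ltW.
Qed.

Lemma trig_limitD f g : trig_limit f -> trig_limit g -> trig_limit (fun w => f w + g w).
Proof.
move=> [sf hf] [sg hg]; split; first exact: sqintD.
move=> e e0; have e4 : 0 < e / 4 by rewrite divr_gt0.
have [p [tp hp]] := hf _ e4; have [q [tq hq]] := hg _ e4.
exists (fun w => p w + q w); split; first exact: trig_add.
have s1 := sqintB sf (trig_sqint tp); have s2 := sqintB sg (trig_sqint tq).
have := sqnormD s1 s2.
rewrite (_ : (fun w => f w + g w - (p w + q w)) = fun w => f w - p w + (g w - q w)); first by lra.
by apply/funext => w; ring.
Qed.

Lemma trig_limitZ k f : trig_limit f -> trig_limit (fun w => k * f w).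
Proof.
move=> [sf hf]; split; first exact: sqintZ.
move=> e e0; have k1 : 0 < k ^+ 2 + 1 by rewrite ltr_wpDl ?sqr_ge0.
have e4 : 0 < e / (k ^+ 2 + 1) by rewrite divr_gt0.
have [p [tp hp]] := hf _ e4.
exists (fun w => k * p w); split; first exact: trig_scale.
have s1 := sqintB sf (trig_sqint tp).
have := sqnormZ k s1; rewrite (_ : (fun w => k * f w - k * p w) = fun w => k * (f w - p w)).
  move=> ->; move: hp; rewrite ler_pdivlMr//; have := sqnorm_ge0 Q (fun w => f w - p w);
    have := sqr_ge0 k; nra.
by apply/funext => w; ring.
Qed.

(** f g - p q = f (g - q) + q (f - p). The approximation q is bounded, but not by 1, so it is chosen
    first and p is then chosen with an accuracy depending on the bound of q. *)
Lemma trig_limitM f g : (forall w, `|f w| <= 1) -> (forall w, `|g w| <= 1) ->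
  trig_limit f -> trig_limit g -> trig_limit (fun w => f w * g w).
Proof.
move=> f1 g1 [sf hf] [sg hg]; have [mf _] := sf; have [mg _] := sg.
split; first exact: (sqint_bndM (K := 1)).
move=> e e0; have e4 : 0 < e / 4 by rewrite divr_gt0.
have [q [tq hq]] := hg _ e4; have [mq [K qK]] := trig_bounded tq.
have K1 : 0 < K ^+ 2 + 1 by rewrite ltr_wpDl ?sqr_ge0.
have e5 : 0 < e / 4 / (K ^+ 2 + 1) by rewrite divr_gt0.
have [p [tp hp]] := hf _ e5.
exists (fun w => p w * q w); split; first exact: trig_mul.
have s1 := sqintB sf (trig_sqint tp); have s2 := sqintB sg (trig_sqint tq).
have s3 : sqint Q (fun w => f w * (g w - q w)) by apply: (sqint_bndM (K := 1)).
have s4 : sqint Q (fun w => q w * (f w - p w)) by apply: (sqint_bndM (K := K)).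
rewrite (_ : (fun w => _) = fun w => f w * (g w - q w) + q w * (f w - p w)); last first.
  by apply/funext => w; ring.
apply: le_trans (sqnormD s3 s4) _.
have n1 : sqnorm Q (fun w => f w * (g w - q w)) <= e / 4.
  by apply: le_trans hq; apply: sqnorm_dom => // w; rewrite normrM ler_piMl.
have n2 : sqnorm Q (fun w => q w * (f w - p w)) <= K ^+ 2 * sqnorm Q (fun w => f w - p w).
  rewrite -sqnormZ//; apply: sqnorm_dom => //; first exact: sqintZ.
  by move=> w; rewrite !normrM ler_wpM2r// (le_trans (qK w))// ler_norm.
have n3 := sqnorm_ge0 Q (fun w => f w - p w).
by move: hp; rewrite ler_pdivlMr//; nra.
Qed.

Lemma trig_limit_lim (f_ : nat -> realization -> R) f h : sqint Q h ->
  (forall k, trig_limit (f_ k)) -> (forall x, f_ k x @[k --> \oo] --> f x) ->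
  (forall k x, `|f_ k x| <= h x) -> trig_limit f.
Proof.
move=> hh Hf cf fh.
have mf k : measurable_fun setT (f_ k) by case: (Hf k) => -[].
have [sf cv] := dominated_sqnorm hh mf cf fh.
split=> // e e0; have e4 : 0 < e / 4 by rewrite divr_gt0.
have := cv => /cvgr0Pnorm_lt /(_ _ e4) [N _ /(_ N (leqnn N)) /= hN].
have [sN /(_ _ e4)[p [tp hp]]] := Hf N; exists p; split=> //.
have s1 := sqintB sf sN; have s2 := sqintB sN (trig_sqint tp).
have := sqnormD s1 s2; have := le_lt_trans (ler_norm _) hN.
rewrite (_ : (fun w => f w - f_ N w + (f_ N w - p w)) = fun w => f w - p w); last first.
  by apply/funext => w; rewrite addrA subrK.
lra.
Qed.

Lemma trig_limit1 : trig_limit (fun=> 1).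
Proof.
rewrite (_ : (fun=> 1) = fun w => cos (lin [::] w + 0)); last first.
  by apply/funext => w; rewrite /lin big_nil addr0 cos0.
exact/trig_limit_trig/trig_cos.
Qed.

(** The function sin ((w x - c) / (k + 1)) is a trigonometric polynomial which has the sign of w x -
    c as soon as |w x - c| < (k + 1) pi. The indicators of its positivity sets thus converge
    pointwise to that of the half-line. *)
Lemma trig_limit_halfline x (c : R) : trig_limit (\1_[set w | c < w x]).
Proof.
have b1 (A : set realization) w : `|\1_A w : R| <= 1.
  by rewrite indicE; case: (_ \in _); rewrite ?normr1 ?normr0.
pose v (k : nat) (w : realization) : R := sin ((w x - c) / k.+1%:R).
apply: (trig_limit_lim (f_ := fun k => \1_[set w | 0 < v k w]) Q1) => //.
  move=> k; apply: (V_indic_gt0 (mu := Q)).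
  - by move=> f [].
  - exact: trig_limitD.
  - exact: trig_limitZ.
  - exact: trig_limit_lim.
  - exact: trig_limitM.
  - exact: trig_limit1.
  - rewrite (_ : v k = fun w => cos (lin [:: (k.+1%:R^-1, x)] w + (- c / k.+1%:R - pi / 2)));
    last first.
      apply/funext => w; rewrite /v /lin big_seq1 addrA cosBpihalf /=; congr sin.
      by ring.
    exact/trig_limit_trig/trig_cos.
  - by move=> w; exact: norm_sin_le.
move=> w; apply: cvg_near_cst.
(* The factor 2 is a lower bound for pi. *)
have [N hN] : exists N : nat, `|w x - c| < N%:R * 2.
  exists (Num.truncn `|w x - c|).+1; have := truncnS_gt `|w x - c|.
  have : (0 : R) <= (Num.truncn `|w x - c|).+1%:R by []; lra.
exists N => // k /= Nk; rewrite !indicE; congr (_%:R); congr nat_of_bool.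
have k0 : (0 : R) < k.+1%:R by rewrite ltr0n.
have hk : `|(w x - c) / k.+1%:R| < pi.
  rewrite normrM [`|_^-1|]ger0_norm ?invr_ge0// ltr_pdivrMr//.
  by apply: lt_le_trans hN _; rewrite mulrC; apply: ler_pM => //; [exact: pi_ge2|rewrite ler_nat leqW].
have e : (0 < sin ((w x - c) / k.+1%:R)) = (c < w x).
  have [h|h] := ltP c (w x).
    apply: sin_gt0_pi; rewrite divr_gt0 ?subr_gt0//=.
    by apply: le_lt_trans (ler_norm _) hk.
  apply/negbTE; rewrite -leNgt -oppr_ge0 -sinN; apply: sin_ge0_pi.
  rewrite -mulNr divr_ge0 ?opprB ?subr_ge0//= ltW//.
  by apply: le_lt_trans hk; rewrite -normrN -mulNr opprB ler_norm.
by apply/idP/idP => /[!inE] /=; rewrite /v e.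
Qed.

(** The sets with approximable indicator form a sigma-algebra. It contains the half-lines in one
    coordinate, hence the Borel sets in one coordinate, hence all measurable sets. *)
Lemma sqint_trig_limit f : sqint Q f -> trig_limit f.
Proof.
apply: (@L2_induction _ _ _ Q trig_limit _ _ _ (fun=> setT)).
- exact: trig_limitD.
- exact: trig_limitZ.
- exact: trig_limit_lim.
- move=> _ A mA.
  have salg : sigma_algebra setT [set A | trig_limit (\1_(A `&` setT))].
    apply: (@V_sigma_algebra _ _ _ Q trig_limit).
    + by move=> g [].
    + exact: trig_limitD.
    + exact: trig_limitZ.
    + exact: trig_limit_lim.
    + by rewrite indicT; exact: trig_limit1.
    + exact: trig_limitM.
  suff : <<s cylinders >> `<=` [set A | trig_limit (\1_(A `&` setT))] by apply.
  apply: smallest_sub => // _ [x [B [mB ->]]] /=.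
  have salg' : sigma_algebra setT [set B : set R | trig_limit (\1_([set w | B (w x)] `&` setT))].
    case: salg => s1 s2 s3; split => //.
    - by move=> D /= hD; have := s2 _ hD.
    - by move=> D /= hD; have := s3 _ hD.
  have sub : <<s @RGenOInfty.G R >> `<=` [set B : set R | trig_limit (\1_([set w | B (w x)] `&` setT))].
    apply: smallest_sub => // _ [c ->] /=.
    rewrite setIT; have := trig_limit_halfline x c; congr trig_limit.
    apply/funext => w; rewrite !indicE; congr (_%:R); congr nat_of_bool.
    by apply/idP/idP => /[!inE] /=; rewrite in_itv /= andbT.
  by apply: sub; move: mB; rewrite RGenOInfty.measurableE.
- by move=> x; exact: nearW.
Qed.

End path_space.
Arguments realization : clear implicits.

Section mixing.
Context {R : realType} {d : nat} {dT : measure_display} {T : measurableType dT}.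
Local Notation E := 'cV[R]_d.
Variables (P : probability T R) (G : T -> E -> R).
Hypothesis G_field : random_field G.
Hypothesis G_gauss : gaussian_field P G.
Hypothesis G_stat : stationary_law P G.
Hypothesis G_centered : forall x, \int[P]_w G w x = 0.

Definition tpath (z : E) (w : T) : realization R d := translate z (G w).

Lemma tpath0 w : tpath 0 w = G w.
Proof. by apply/funext => y; rewrite /tpath /translate add0r. Qed.

Lemma shift_tpath z z' w : translate z (tpath z' w) = tpath (z' + z) w.
Proof. by apply/funext => y; rewrite /tpath /translate addrA. Qed.

Lemma measurable_tpath2 : measurable_fun setT (fun p : T * E => tpath p.2 p.1).
Proof.
apply: measurable_to_path => x.
have mf : measurable_fun setT (fun p : T * E => (p.1, p.2 + x)).
  apply/measurable_fun_pairP; split; first exact: measurable_fst.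
  rewrite (_ : snd \o _ = (fun y : E => x + 1 *: y) \o snd); last first.
    by apply/funext => p; rewrite /= scale1r addrC.
  by apply: measurableT_comp => //; exact: measurable_affine.
exact: (measurableT_comp G_field mf).
Qed.

Lemma measurable_tpath z : measurable_fun setT (tpath z).
Proof.
have mf : measurable_fun setT (fun w : T => (w, z)) by exact: measurable_pair2.
exact: (measurableT_comp measurable_tpath2 mf).
Qed.

Definition law : {measure set (realization R d) -> \bar R}.
Proof. by refine (pushforward P (tpath 0)); exact: measurable_tpath. Defined.

(** [stationary_law] gives the equality on rectangles over finitely many points. These are closed
    under intersection, by concatenating the points, and generate the sigma-algebra. *)
Lemma law_translate z A : measurable A -> P (tpath z @^-1` A) = law A.
Proof.
pose H : set (set (realization R d)) := [set A | exists n (x : 'I_n -> E)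
  (B : 'I_n -> set (measurableTypeR R)), (forall k, measurable (B k)) /\
  A = [set w | forall k, B k (w (x k))]].
have mev (x : E) (B : set (measurableTypeR R)) : measurable B ->
    measurable ([set w | B (w x)] : set (realization R d)).
  by move=> mB; apply: sub_sigma_algebra; exists x, B.
have Hm : H `<=` measurable.
  move=> _ [n [x [B [mB ->]]]].
  rewrite (_ : [set w | _] = \bigcap_(k in setT) [set w : E -> R | B k (w (x k))]); last first.
    by apply/seteqP; split=> w h k; [move=> _; exact: h|exact: h].
  by apply: fin_bigcap_measurable => // k _; exact: mev.
have HT : H setT.
  exists 0%N, (fun _ => 0), (fun _ => setT); split=> //.
  by apply/seteqP; split => // w _ [].
have HI : setI_closed H.
  move=> _ _ [n [x [B [mB ->]]]] [m [y [D [mD ->]]]].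
  exists (n + m)%N, (fun k => match fintype.split k with inl k1 => x k1 | inr k2 => y k2 end),
    (fun k => match fintype.split k with inl k1 => B k1 | inr k2 => D k2 end); split.
    by move=> k; case: (fintype.split k).
  apply/seteqP; split=> w /=.
    by move=> [h1 h2] k; case: (fintype.split k).
  move=> h; split=> k.
    by have := h (lshift m k); case: (fintype.splitP (lshift m k)) => [k'|k'] /= e;
      [rewrite (ord_inj e)|have := ltn_ord k; rewrite e ltnNge leq_addr].
  have := h (rshift n k); case: (fintype.splitP (rshift n k)) => [k'|k'] /= e.
    by have := ltn_ord k'; rewrite -e ltnNge leq_addr.
  by move/addnI : e => e; rewrite (ord_inj e).
have sub : @measurable _ (realization R d) `<=` <<s H >>.
  apply: smallest_sub; first exact: smallest_sigma_algebra.
  move=> _ [x [B [mB ->]]]; apply: sub_sigma_algebra.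
  exists 1%N, (fun _ => x), (fun _ => B); split=> //.
  by apply/seteqP; split=> w //= h; exact: (h ord0).
pose law' : {measure set (realization R d) -> \bar R} :=
  ltac:(by refine (pushforward P (tpath z)); exact: measurable_tpath).
move=> mA; apply: (@g_sigma_algebra_measure_unique _ R (realization R d) H Hm (fun=> setT) _
  _ law' law) => //.
- by rewrite bigcup_const//; exists 0%N.
- move=> _ [n [x [B [mB ->]]]]; rewrite /law' /law /=.
  transitivity (P [set w | forall k, B k (G w (x k))]).
    rewrite -(G_stat x z mB); congr (P _).
    by apply/seteqP; split=> w h k; have := h k; rewrite /tpath /translate addrC.
  congr (P _).
  by apply/seteqP; split=> w h k; have := h k; rewrite /tpath /translate add0r.
- by move=> _; have -> : law' setT = 1%E := probability_setT P; rewrite ltry.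
- exact: sub.
Qed.

Lemma int_law F z : measurable_fun setT F -> \int[P]_w F (tpath z w) = \int[law]_x F x.
Proof. exact: (int_mp (m2 := law) (measurable_tpath z) (@law_translate z)). Qed.

Lemma intg_law F z : intg law F -> intg P (fun w => F (tpath z w)).
Proof. exact: (intg_mp (m2 := law) (measurable_tpath z) (@law_translate z)). Qed.

Lemma intg_lawV F z : measurable_fun setT F -> intg P (fun w => F (tpath z w)) -> intg law F.
Proof. exact: (intg_mpV (m2 := law) (measurable_tpath z) (@law_translate z)). Qed.

Lemma sqint_law F z : sqint law F -> sqint P (fun w => F (tpath z w)).
Proof. exact: (sqint_mp (m2 := law) (measurable_tpath z) (@law_translate z)). Qed.

Lemma intg_cst (k : R) : intg P (fun=> k).
Proof. exact: finite_measure_integrable_cst. Qed.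

Lemma int_cst (k : R) : \int[P]_w k = k.
Proof.
rewrite /Rintegral integral_cst//; transitivity (fine (k%:E * 1)%E).
  by congr (fine (_ * _)%E); exact: probability_setT.
by rewrite mule1.
Qed.

Lemma sqint_law1 : sqint law (fun=> 1 : R).
Proof.
split=> //; apply: (@intg_lawV _ 0); first exact: measurable_cst.
by rewrite /= expr1n; exact: intg_cst.
Qed.

Lemma measurable_G x : measurable_fun setT (fun w => G w x).
Proof.
have mf : measurable_fun setT (fun w : T => (w, x)) by exact: measurable_pair2.
exact: (measurableT_comp G_field mf).
Qed.

Lemma lin_gaussian s : measurable_fun setT (fun w => lin s (G w)) /\
  gaussian_rv P (fun w => lin s (G w)).
Proof.
split; first by apply: measurable_sum => c; apply: measurable_funM => //; exact: measurable_G.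
have := G_gauss (fun k => (tnth (in_tuple s) k).2) (fun k => (tnth (in_tuple s) k).1).
by congr gaussian_rv; apply/funext => w; rewrite /lin [RHS]big_tnth.
Qed.

Lemma sqint_G x : sqint P (fun w => G w x).
Proof.
have e w : lin [:: (1, x)] (G w) = G w x by rewrite /lin big_seq1 mul1r.
have [mX gX] := lin_gaussian [:: (1, x)].
have [|s [h _ _ _]] := centered_gaussian mX gX.
  by under int_ext do rewrite e.
exact: sqint_ext h.
Qed.

Lemma lin_centered_gaussian s : exists v, [/\ sqint P (fun w => lin s (G w)),
  \int[P]_w lin s (G w) ^+ 2 = gvar v, \int[P]_w cos (lin s (G w)) = gchar v &
  \int[P]_w sin (lin s (G w)) = 0].
Proof.
have [mX gX] := lin_gaussian s; apply: centered_gaussian => //.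
have iG x : intg P (fun w => G w x).
  by apply: intg_ext (sqint_mul (sqint_G x) (sqint_ext _ (_ : sqint P (fun=> 1)))) => //
    [w|]; [rewrite mulr1|split=> //; under eq_fun do rewrite expr1n; exact: intg_cst].
rewrite int_sum; last by move=> c _; apply: intgZ.
by rewrite big1// => c _; rewrite intZ// G_centered mulr0.
Qed.

Definition cov2 s t : R := \int[P]_w (lin s (G w) * lin t (G w)).

Lemma sqint_lin s : sqint P (fun w => lin s (G w)).
Proof. by have [v []] := lin_centered_gaussian s. Qed.

Lemma cov2E s t : cov2 s t =
  \sum_(c <- s) \sum_(c' <- t) c.1 * c'.1 * covariance_fun P G (c.2 - c'.2).
Proof.
have e x y : \int[P]_w (G w x * G w y) = covariance_fun P G (x - y).
  have mF : measurable_fun setT (fun v : realization R d => v (x - y) * v 0).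
    by apply: measurable_funM; exact: measurable_eval.
  have := int_law y mF; rewrite -(int_law 0 mF).
  rewrite /covariance_fun => h; transitivity (\int[P]_w (tpath y w (x - y) * tpath y w 0)).
    by apply: int_ext => w; rewrite /tpath /translate addr0 addrC subrK.
  apply: (etrans h); apply: int_ext => w; rewrite /tpath /translate !add0r//.
transitivity (\int[P]_w \sum_(c <- s) \sum_(c' <- t) c.1 * c'.1 * (G w c.2 * G w c'.2)).
  apply: int_ext => w; rewrite /lin mulr_suml; apply: eq_bigr => c _.
  by rewrite mulr_sumr; apply: eq_bigr => c' _; rewrite mulrACA.
have i0 (c c' : R * E) : intg P (fun w => c.1 * c'.1 * (G w c.2 * G w c'.2)).
  by apply: intgZ; apply: sqint_mul; exact: sqint_G.
rewrite int_sum; last by move=> c _; apply: intg_sum.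
apply: eq_bigr => c _; rewrite int_sum//; apply: eq_bigr => c' _.
by rewrite intZ ?e//; apply: sqint_mul; exact: sqint_G.
Qed.

Definition char s : R := \int[P]_w cos (lin s (G w)).

(* Jointly Gaussian: the variance of the sum exceeds the sum of the variances by
   2 cov2, and the characteristic function is Lipschitz in the variance. *)
Lemma char_cat s t : `|char (s ++ t) - char s * char t| <= `|cov2 s t|.
Proof.
have [u [_ vu cu _]] := lin_centered_gaussian (s ++ t).
have [v [_ vv cv _]] := lin_centered_gaussian s.
have [v' [_ vv' cv' _]] := lin_centered_gaussian t.
rewrite /char cu cv cv' -gcharM; apply: le_trans (gchar_lip _ _) _.
rewrite gvarD -vu -vv -vv'.
have -> : \int[P]_w lin (s ++ t) (G w) ^+ 2 = \int[P]_w lin s (G w) ^+ 2 +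
    \int[P]_w lin t (G w) ^+ 2 + 2 * cov2 s t.
  have [_ i1] := sqint_lin s; have [_ i2] := sqint_lin t.
  have i3 := sqint_mul (sqint_lin s) (sqint_lin t).
  rewrite /cov2 -intD// -intZ// -intD; [|exact: intgD|exact: intgZ].
  by apply: int_ext => w; rewrite lin_cat; ring.
rewrite addrAC subrr add0r normrM ger0_norm//.
by rewrite mulrAC divff// mul1r.
Qed.

Lemma char_translates z s : char (translates z s) = char s.
Proof.
have mF : measurable_fun setT (fun v => cos (lin s v)).
  by apply: (measurableT_comp (@measurable_cosR R)); exact: measurable_lin.
transitivity (\int[P]_w cos (lin s (tpath z w))).
  by apply: int_ext => w; rewrite -lin_translates.
rewrite (int_law z mF) -(int_law 0 mF).
by apply: int_ext => w; rewrite tpath0.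
Qed.

Lemma char_opps s : char (opps s) = char s.
Proof. by apply: int_ext => w; rewrite lin_opps cosN. Qed.

Lemma int_cosD s th : \int[P]_w cos (lin s (G w) + th) = cos th * char s.
Proof.
have [v [_ _ _ s0]] := lin_centered_gaussian s; have [mX _] := lin_gaussian s.
have i1 : intg P (fun w => cos (lin s (G w))).
  apply: intg_dom (intg_cst 1); first exact: measurableT_comp (@measurable_cosR R) mX.
  by move=> w; exact: norm_cos_le.
have i2 : intg P (fun w => sin (lin s (G w))).
  apply: intg_dom (intg_cst 1); first exact: measurableT_comp (@measurable_sinR R) mX.
  by move=> w; exact: norm_sin_le.
transitivity (\int[P]_w (cos th * cos (lin s (G w)) - sin th * sin (lin s (G w)))).
  by apply: int_ext => w; rewrite cosD; ring.
rewrite intB; [|exact: intgZ|exact: intgZ].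
by rewrite intZ// intZ// s0 mulr0 subr0.
Qed.

Definition decorrelating (zs : nat -> E) :=
  forall x, covariance_fun P G (zs m + x) @[m --> \oo] --> (0 : R).

Definition mixes (zs : nat -> E) (f h : realization R d -> R) :=
  \int[P]_w (f (tpath (zs m) w) * h (tpath 0 w)) @[m --> \oo] -->
  (\int[law]_v f v) * (\int[law]_v h v).

(** By stationarity the covariance function is even. *)
Lemma decorrelatingN zs : decorrelating zs -> decorrelating (fun m => - zs m).
Proof.
move=> h x.
have e y : covariance_fun P G (- y) = covariance_fun P G y.
  have := cov2E [:: (1, 0)] [:: (1, y)]; have := cov2E [:: (1, y)] [:: (1, 0)].
  rewrite !big_seq1 /= subr0 sub0r !mul1r => <- <-.
  by apply: int_ext => w; rewrite mulrC.
have := h (- x); apply: cvg_trans; apply: near_eq_cvg; apply: nearW => m.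
by rewrite -e opprD !opprK.
Qed.

Lemma char_translates_cvg zs s t : decorrelating zs ->
  char (translates (zs m) s ++ t) @[m --> \oo] --> char s * char t.
Proof.
move=> hz.
have c0 : cov2 (translates (zs m) s) t @[m --> \oo] --> (0 : R).
  have -> : (fun m => cov2 (translates (zs m) s) t) = fun m =>
      \sum_(c <- s) \sum_(c' <- t) c.1 * c'.1 * covariance_fun P G (zs m + (c.2 - c'.2)).
    apply/funext => m; rewrite cov2E big_map; apply: eq_bigr => c _.
    by apply: eq_bigr => c' _; rewrite addrA.
  have cs I (r : seq I) (F : nat -> I -> R) : (forall c, F m c @[m --> \oo] --> (0 : R)) ->
      \sum_(c <- r) F m c @[m --> \oo] --> (0 : R).
    move=> hF; elim: r => [|c r ih]; first by under eq_fun do rewrite big_nil; exact: cvg_cst.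
    by under eq_fun do rewrite big_cons; have := cvgD (hF c) ih; rewrite addr0; apply.
  apply: (cs) => c; apply: (cs) => c'.
  by rewrite -[X in _ --> X](mulr0 (c.1 * c'.1)); apply: cvgM; [exact: cvg_cst|exact: hz].
apply/cvgrPdist_le => e e0; have := c0 => /cvgr0Pnorm_le /(_ _ e0).
apply: filterS => m hm; rewrite distrC; apply: le_trans hm.
by have := char_cat (translates (zs m) s) t; rewrite char_translates.
Qed.

Lemma sqint_trig p : trigpoly p -> sqint law p.
Proof. by move=> tp; apply: trig_sqint tp; exact: sqint_law1. Qed.

Lemma int_law_trig s th : \int[law]_v cos (lin s v + th) = cos th * char s.
Proof.
rewrite -int_cosD -(int_law 0); last by have [] := trig_bounded (trig_cos s th).
by apply: int_ext => w; rewrite tpath0.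
Qed.

(** The product is half the sum of two cosines of linear forms, in translates of s joined with t and
    with the opposite of t. Both characteristic functions tend to the product [char s * char t], and
    the addition formula for the phases recombines the limits. *)
Lemma mixes_cos zs s th t th' : decorrelating zs ->
  mixes zs (fun v => cos (lin s v + th)) (fun v => cos (lin t v + th')).
Proof.
move=> hz; rewrite /mixes !int_law_trig.
have i0 u th0 : intg P (fun w => cos (lin u (G w) + th0)).
  have := intg_law 0 (sqint_mul (sqint_trig (trig_cos u th0)) sqint_law1).
  by apply: intg_ext => w; rewrite mulr1 tpath0.
have -> : (fun m => \int[P]_w (cos (lin s (tpath (zs m) w) + th) * cos (lin t (tpath 0 w) + th'))) =
  fun m => 2^-1 * (cos (th + th') * char (translates (zs m) s ++ t)) +
    2^-1 * (cos (th - th') * char (translates (zs m) s ++ opps t)).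
  apply/funext => m; rewrite -!int_cosD -intZ// -intZ// -intD; [|exact: intgZ|exact: intgZ].
  apply: int_ext => w; rewrite tpath0 /tpath lin_translates cosM_half !lin_cat lin_opps.
  by congr (_ * cos _ + _ * cos _); ring.
have -> : cos th * char s * (cos th' * char t) =
   2^-1 * (cos (th + th') * (char s * char t)) + 2^-1 * (cos (th - th') * (char s * char (opps t))).
  by rewrite char_opps mulrACA cosM_half; ring.
by apply: cvgD; apply: cvgM; [exact: cvg_cst| |exact: cvg_cst| ];
  apply: cvgM; [exact: cvg_cst|exact: char_translates_cvg|exact: cvg_cst|exact: char_translates_cvg].
Qed.

Let isq f : sqint law f -> intg law f.
Proof. by move=> hf; apply: intg_ext (sqint_mul hf sqint_law1) => v; rewrite mulr1. Qed.

Let ifh f h z : sqint law f -> sqint law h -> intg P (fun w => f (tpath z w) * h (tpath 0 w)).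
Proof. by move=> hf hh; apply: sqint_mul; exact: sqint_law. Qed.

Lemma mixesD zs f g h : sqint law f -> sqint law g -> sqint law h ->
  mixes zs f h -> mixes zs g h -> mixes zs (fun v => f v + g v) h.
Proof.
move=> sf sg sh mf mg; rewrite /mixes intD; [|exact: isq|exact: isq].
rewrite mulrDl.
have -> : (fun m => \int[P]_w ((f (tpath (zs m) w) + g (tpath (zs m) w)) * h (tpath 0 w))) =
  fun m => \int[P]_w (f (tpath (zs m) w) * h (tpath 0 w)) +
    \int[P]_w (g (tpath (zs m) w) * h (tpath 0 w)).
  apply/funext => m; rewrite -intD; [|exact: ifh|exact: ifh].
  by apply: int_ext => w; rewrite mulrDl.
exact: cvgD.
Qed.

Lemma mixesZ zs k f h : sqint law f -> sqint law h ->
  mixes zs f h -> mixes zs (fun v => k * f v) h.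
Proof.
move=> sf sh mf; rewrite /mixes intZ; last exact: isq.
rewrite -mulrA.
have -> : (fun m => \int[P]_w (k * f (tpath (zs m) w) * h (tpath 0 w))) =
  fun m => k * \int[P]_w (f (tpath (zs m) w) * h (tpath 0 w)).
  apply/funext => m; rewrite -intZ; last exact: ifh.
  by apply: int_ext => w; rewrite mulrA.
by apply: cvgM; [exact: cvg_cst|].
Qed.

Lemma mixes_trig zs p h : (forall s th, mixes zs (fun v => cos (lin s v + th)) h) ->
  sqint law h -> trigpoly p -> mixes zs p h.
Proof.
move=> H sh; elim=> [s th|p1 p2 t1 h1 t2 h2|k p1 t1 h1]; first exact: H.
- by apply: mixesD => //; exact: sqint_trig.
- by apply: mixesZ => //; exact: sqint_trig.
Qed.

(** Replacing f by p costs an error uniform in m, because stationarity makes the L^2 norm of f - p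
    along the translates independent of m. *)
Lemma mixes_closed zs f h : (forall p, trigpoly p -> mixes zs p h) ->
  sqint law h -> sqint law f -> mixes zs f h.
Proof.
move=> H sh sf; apply/cvgrPdist_le => e e0.
pose N := sqnorm law h; have N0 : 0 <= N := sqnorm_ge0 law h.
have N1 : 0 < N + 1 by rewrite ltr_wpDl.
(* By Cauchy-Schwarz this accuracy changes the correlation and its limit by at most e / 3 each; N +
   1 avoids dividing by 0. *)
have e1 : 0 < (e / 3) ^+ 2 / (N + 1) by rewrite divr_gt0// exprn_gt0// divr_gt0.
have [_ /(_ _ e1)[p [tp hp]]] := sqint_trig_limit sqint_law1 sf.
have sp := sqint_trig tp; have sfp := sqintB sf sp.
have sP g z : sqint law g -> \int[P]_w g (tpath z w) ^+ 2 = sqnorm law g.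
  move=> [mg _]; have mg2 : measurable_fun setT (fun v => g v ^+ 2) by exact: measurable_funX.
  exact: (int_law z mg2).
have small x y : 0 <= y -> x ^+ 2 <= y * N -> y <= (e / 3) ^+ 2 / (N + 1) -> `|x| <= e / 3.
  move=> y0 h1; rewrite ler_pdivlMr// => h2.
  have e3 : 0 <= e / 3 by rewrite divr_ge0// ltW.
  by rewrite -(@ler_pXn2r _ 2) ?nnegrE// real_normK ?num_real//; nra.
have n0 := sqnorm_ge0 law (fun v => f v - p v).
have b1 m : `|\int[P]_w (f (tpath (zs m) w) * h (tpath 0 w)) - \int[P]_w (p (tpath (zs m) w)
  * h (tpath 0 w))| <= e / 3.
  apply: (small _ (sqnorm law (fun v => f v - p v))) => //.
  rewrite -intB; [|exact: ifh|exact: ifh].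
  have := int_mul_sq_le (sqint_law (zs m) sfp) (sqint_law 0 sh).
  rewrite (sP _ _ sfp) (sP _ _ sh); apply: le_trans; apply/eqW; congr (_ ^+ 2).
  by apply: int_ext => w; rewrite mulrBl.
have b2 : `|(\int[law]_v f v) * (\int[law]_v h v) - (\int[law]_v p v) * (\int[law]_v h v)| <= e / 3.
  apply: (small _ (sqnorm law (fun v => f v - p v))) => //.
  rewrite -mulrBl -intB; [|exact: isq|exact: isq].
  rewrite exprMn.
  have n1 : \int[law]_v (1 : R) ^+ 2 = 1.
    rewrite -(int_law 0); last by apply: measurable_funX.
    by rewrite expr1n; exact: int_cst.
  have c1 g : sqint law g -> (\int[law]_v g v) ^+ 2 <= sqnorm law g.
    move=> sg; have := int_mul_sq_le sg sqint_law1; rewrite n1 mulr1.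
    by apply: le_trans; apply/eqW; congr (_ ^+ 2); apply: int_ext => v; rewrite mulr1.
  by apply: ler_pM; rewrite ?sqr_ge0//; exact: c1.
have e3 : 0 < e / 3 by rewrite divr_gt0.
have := H _ tp => /cvgrPdist_le /(_ _ e3); apply: filterS => m; have := b1 m; move: b2.
move: (\int[law]_v f v) (\int[law]_v h v) (\int[law]_v p v).
move: (\int[P]_w (f (tpath (zs m) w) * h (tpath 0 w))) (\int[P]_w (p (tpath (zs m) w) * h (tpath 0 w))).
move=> A B F H' Q h1 h2 h3.
have -> : F * H' - A = (F * H' - Q * H') + (Q * H' - B) - (A - B) by ring.
apply: le_trans (ler_normB _ _) _; have := ler_normD (F * H' - Q * H') (Q * H' - B); lra.
Qed.

(** Translating the realization by - zs m moves the translation to the other factor, so that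
    [mixes_closed] can be applied to each factor in turn. *)
Lemma mixes_swap zs f h : sqint law f -> sqint law h ->
  mixes (fun m => - zs m) h f -> mixes zs f h.
Proof.
move=> [mf _] [mh _]; rewrite /mixes mulrC; apply: cvg_trans.
apply: near_eq_cvg; apply: nearW => m.
have mF : measurable_fun setT (fun v : realization R d => f (translate (zs m) v) * h v).
  by apply: measurable_funM => //; exact: (measurableT_comp mf (measurable_translate (zs m))).
transitivity (\int[P]_w (f (translate (zs m) (tpath (- zs m) w)) * h (tpath (- zs m) w))).
  by apply: int_ext => w; rewrite shift_tpath addNr mulrC.
rewrite (int_law (- zs m) mF) -(int_law 0 mF).
by apply: int_ext => w; rewrite shift_tpath add0r.
Qed.

Lemma decorrelating_mixes zs f h : decorrelating zs -> sqint law f -> sqint law h ->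
  mixes zs f h.
Proof.
move=> hz sf sh; apply: mixes_closed => // p tp; apply: mixes_trig => // s th.
have sc s' th' := sqint_trig (trig_cos s' th').
apply: mixes_swap => //; apply: mixes_closed => // q tq; apply: mixes_trig => // t th'.
exact/mixes_cos/decorrelatingN.
Qed.

End mixing.

(** * Orthogonality of curl-free and divergence-free fields *)

Section translation_invariance.
Context {R : realType} {d : nat}.
Local Notation E := 'cV[R]_d.
Local Notation mu := (lebesgue_cV d).

(** Two applications of the mean value theorem bound the remainder by s ^+ 2 times a bound on the
    second derivative. As s <= 1, the remainder vanishes outside the ball of radius r + 1, so one
    integrable D serves for all s. *)
Lemma taylor2 (rho : E -> R) k : tf rho -> exists2 D : E -> R, intg mu D &
  forall (s : R) (z : E), 0 < s -> s <= 1 ->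
    `|rho (z + s *: bvec k) - rho z - s * pderiv k rho z| <= s ^+ 2 * D z.
Proof.
move=> tr; have tr1 := tf_pderiv k tr; have tr2 := tf_pderiv k tr1.
have [M hM] := tf_bounded tr2; have [sr [r1 hr1]] := tr; have [_ [r2 hr2]] := tr1.
pose r := Num.max r1 r2.
have hr (z : E) : r < `|z| -> rho z = 0 by rewrite gt_max => /andP[+ _]; exact: hr1.
have hr' (z : E) : r < `|z| -> pderiv k rho z = 0 by rewrite gt_max => /andP[_]; exact: hr2.
have M0 : 0 <= M by exact: le_trans (normr_ge0 _) (hM 0).
exists (fun z => M * \1_[set z : E | `|z| <= r + 1] z).
  apply: intgZ; apply: (@bounded_cpt_intg _ _ _ 1).
  - exact: measurable_indic (measurable_norm_le _).
  - exists (r + 1) => z hz; rewrite indicE memNset//= leNgt hz//.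
  - by move=> z; rewrite indicE; case: (_ \in _); rewrite ?normr1 ?normr0.
move=> s z s0 s1; rewrite indicE; have [zr|zr] := leP `|z| (r + 1).
  rewrite mem_set//= mulr1.
  have [c /andP[c0 cs] ->] := line_MVT z (smooth_derivable sr (i:=k)) s0.
  rewrite -mulrBr.
  have [c' _ ->] := line_MVT z (smooth_derivable (smooth_pderiv k sr) (i:=k)) c0.
  rewrite !normrM (gtr0_norm s0) (gtr0_norm c0) expr2 -!mulrA.
  apply: ler_wpM2l; first exact: ltW.
  by apply: ler_pM; [exact: ltW|by []|exact: ltW|exact: hM].
rewrite memNset/=; last by rewrite leNgt zr.
rewrite !mulr0.
have rz : r < `|z| by apply: lt_trans zr; rewrite ltrDl.
have z1 : rho (z + s *: bvec k) = 0.
  apply: hr; have := ler_normB (z + s *: bvec k) (s *: bvec k); rewrite addrK.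
  rewrite normrZ (gtr0_norm s0); have := bvec_norm_le k (R := R) (d := d); nra.
by rewrite (hr z)// hr'// z1 mulr0 !subr0 normr0.
Qed.

Lemma tf_shift (rho : E -> R) (c : E) : tf rho -> tf (fun z => rho (z + c)).
Proof.
move=> tr; have := tf_affine c (oner_neq0 R) tr.
by congr tf; apply/funext => z; rewrite scale1r addrC.
Qed.

Lemma pderiv_shift (rho : E -> R) (c : E) k : smooth rho ->
  pderiv k (fun z => rho (z + c)) = fun z => pderiv k rho (z + c).
Proof.
move=> sr; have [h _] := pderiv_affine k c 1 sr.
rewrite (_ : (fun z => rho (z + c)) = fun z => rho (c + 1 *: z)).
  by rewrite h; apply/funext => z; rewrite mul1r scale1r addrC.
by apply/funext => z; rewrite scale1r addrC.
Qed.

Variables (kap : E -> R) (K : R) (k : 'I_d).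
Hypothesis kapK : forall z, `|kap z| <= K.
Hypothesis kap_intg : forall rho, intg mu rho -> intg mu (fun z => kap z * rho z).
Hypothesis kap_flat : forall rho, tf rho -> \int[mu]_z (kap z * pderiv k rho z) = 0.

(* Steps of length s change the integral by O(s^2), hence not at all. *)
Lemma int_flat_translate (rho : E -> R) (m : nat) : tf rho ->
  \int[mu]_z (kap z * rho (z + m%:R *: bvec k)) = \int[mu]_z (kap z * rho z).
Proof.
move=> tr; have [sr _] := tr; have [D iD hD] := taylor2 k tr.
pose J (t : R) := \int[mu]_z (kap z * rho (z + t *: bvec k)).
have K0 : 0 <= K by exact: le_trans (normr_ge0 _) (kapK 0).
have iJ t : intg mu (fun z => kap z * rho (z + t *: bvec k)).
  by apply: kap_intg; apply: tf_intg; exact: tf_shift.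
pose C := K * \int[mu]_z D z.
have step t s : 0 < s -> s <= 1 -> `|J (t + s) - J t| <= C * s ^+ 2.
  move=> s0 s1.
  pose F z := rho (z + (t + s) *: bvec k) - rho (z + t *: bvec k)
     - s * pderiv k rho (z + t *: bvec k).
  have i1 : intg mu (fun z => rho (z + (t + s) *: bvec k)) by apply: tf_intg; exact: tf_shift.
  have i2 : intg mu (fun z => rho (z + t *: bvec k)) by apply: tf_intg; exact: tf_shift.
  have i3 : intg mu (fun z => pderiv k rho (z + t *: bvec k)).
    by apply: tf_intg; apply: tf_shift; exact: tf_pderiv.
  have iF : intg mu F by apply: intgB; [exact: intgB|exact: intgZ].
  have e0 : \int[mu]_z (kap z * pderiv k rho (z + t *: bvec k)) = 0.
    have := kap_flat (tf_shift (t *: bvec k) tr).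
    by rewrite pderiv_shift.
  have -> : J (t + s) - J t = \int[mu]_z (kap z * F z).
    transitivity (J (t + s) - J t - s * \int[mu]_z (kap z * pderiv k rho (z + t *: bvec k))).
      by rewrite e0 mulr0 subr0.
    rewrite /J -intB// -intZ; last exact: kap_intg.
    rewrite -intB; [|exact: intgB|by apply: intgZ; exact: kap_intg].
    by apply: int_ext => z; rewrite /F; ring.
  have iDt : intg mu (fun z => D (z + t *: bvec k)) by exact: intg_shift.
  rewrite (_ : C * s ^+ 2 = \int[mu]_z (K * s ^+ 2 * D (z + t *: bvec k))); last first.
    by rewrite intZ// int_shift// /C; ring.
  apply: int_norm_le; [exact: kap_intg|exact: intgZ|].
  move=> z; rewrite normrM -mulrA; apply: ler_pM => //.
  by rewrite /F (addrC t) scalerDl addrA addrAC; exact: hD.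
have steps t (N : nat) j : `|J (t + j%:R * N.+1%:R^-1) - J t| <= j%:R * (C * N.+1%:R ^- 2).
  elim: j => [|j ih]; first by rewrite !mul0r addr0 subrr normr0.
  have s0 : 0 < N.+1%:R^-1 :> R by rewrite invr_gt0.
  have s1 : N.+1%:R^-1 <= 1 :> R by rewrite invf_le1// ler1n.
  have h := step (t + j%:R * N.+1%:R^-1) _ s0 s1; rewrite exprVn in h.
  have -> : t + j.+1%:R * N.+1%:R^-1 = t + j%:R * N.+1%:R^-1 + N.+1%:R^-1 by rewrite -natr1; ring.
  rewrite -(natr1 j) (mulrDl j%:R) mul1r.
  move: h ih; move: (J _) (J _) (J _) => a b c h ih.
  have -> : c - a = (b - a) + (c - b) by ring.
  by apply: le_trans (ler_normD _ _) _; exact: lerD.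
(* The distance m is covered in m (N + 1) steps of length 1 / (N + 1), each costing C / (N + 1) ^
   2. *)
have bound N : `|J m%:R - J 0| <= m%:R * C * N.+1%:R^-1.
  have := steps 0 N (m * N.+1)%N; rewrite natrM mulfK ?pnatr_eq0// add0r.
  move=> /le_trans; apply; apply: eqW.
  have : N.+1%:R != 0 :> R by rewrite pnatr_eq0.
  by move: (N.+1%:R) => x x_neq0; field.
have J0 : J 0 = \int[mu]_z (kap z * rho z).
  by apply: int_ext => z; rewrite scale0r addr0.
rewrite -J0; apply/eqP; rewrite -subr_eq0 -normr_le0.
apply/ler_addgt0Pr => e e0; rewrite add0r.
pose N := Num.truncn (`|m%:R * C| / e).
apply: le_trans (bound N) _; rewrite ler_pdivrMr//.
have := truncnS_gt (`|m%:R * C| / e); rewrite -/N ltr_pdivrMr// => /ltW; rewrite [_.+1%:R * e]mulrC.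
by apply: le_trans; exact: ler_norm.
Qed.

Hypothesis kap_decay : forall z, kap (z - m%:R *: bvec k) @[m --> \oo] --> (0 : R).

(** By [int_flat_translate] the integral is unchanged when kap is translated by m steps in direction
    k; letting m tend to infinity, dominated convergence gives 0. *)
Lemma int_flat0 (rho : E -> R) : tf rho -> \int[mu]_z (kap z * rho z) = 0.
Proof.
move=> tr; have ir := tf_intg tr.
have i1 m : intg mu (fun z => kap (z - m%:R *: bvec k) * rho z).
  have := intg_shift (- (m%:R *: bvec k)) (kap_intg (tf_intg (tf_shift (m%:R *: bvec k) tr))).
  by apply: intg_ext => z; rewrite subrK.
have e m : \int[mu]_z (kap (z - m%:R *: bvec k) * rho z) = \int[mu]_z (kap z * rho z).
  rewrite -(int_flat_translate m tr).
  apply: (etrans _ (int_shift (- (m%:R *: bvec k)) (kap_intg (tf_intg (tf_shift _ tr))))).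
  by apply: int_ext => z; rewrite subrK.
have : \int[mu]_z (kap (z - m%:R *: bvec k) * rho z) @[m --> \oo] --> \int[mu]_z (0 : R).
  apply: (cvg_int (h := fun z => K * `|rho z|)).
  - by move=> m; exact: (intg_meas (i1 m)).
  - by move=> z; rewrite -(mul0r (rho z)); apply: cvgM; [exact: kap_decay|exact: cvg_cst].
  - by move=> m z; rewrite normrM; apply: ler_wpM2r.
  - by apply: intgZ; exact: intg_norm.
under eq_fun do rewrite e.
by rewrite int0 => /(cvg_lim (@Rhausdorff R)); rewrite lim_cst//; exact: Rhausdorff.
Qed.

(** The integral of kap against a nonnegative bump near 0 is close to kap 0 times the integral of
    the bump, and it is 0. *)
Lemma flat_eq0 (eta : E -> R) x0 : tf eta -> eta x0 != 0 ->
  (forall e, 0 < e -> exists2 del : R, 0 < del & forall z, `|z| < del -> `|kap z - kap 0| <= e) ->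
  kap 0 = 0.
Proof.
move=> te e0 ck; apply/eqP; rewrite -normr_le0; apply/ler_addgt0Pr => e e_gt0; rewrite add0r.
have [del del0 hd] := ck _ e_gt0.
have [rho [tr r0 rs ri]] := tf_bump te e0 del0.
have ir := tf_intg tr.
have := int_flat0 tr; have ik := kap_intg ir => k0.
have : `|\int[mu]_z (kap z * rho z - kap 0 * rho z)| <= \int[mu]_z (e * rho z).
  apply: int_norm_le; [by apply: intgB => //; exact: intgZ|exact: intgZ|].
  move=> z; rewrite -mulrBl normrM (ger0_norm (r0 z)).
  have [zd|zd] := ltP `|z| del; first by apply: ler_wpM2r => //; exact: hd.
  by rewrite rs// !mulr0.
rewrite intB//; last exact: intgZ.
by rewrite k0 sub0r normrN intZ// intZ// normrM (gtr0_norm ri) ler_pM2r.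
Qed.

End translation_invariance.

Section correlation.
Context {R : realType} {d : nat} {dT : measure_display} {T : measurableType dT}.
Local Notation E := 'cV[R]_d.
Local Notation mu := (lebesgue_cV d).
Variables (P : probability T R) (G : T -> E -> R).
Hypothesis G_field : random_field G.
Hypothesis G_gauss : gaussian_field P G.
Hypothesis G_stat : stationary_law P G.
Hypothesis G_centered : forall x, \int[P]_w G w x = 0.
Local Notation law := (law P G_field).
Local Notation tp := (tpath G).
Implicit Types (u v : realization R d -> R) (rho : E -> R).

Lemma measurable_tpath_map (al : E -> E) : measurable_fun setT al ->
  measurable_fun setT (fun p : T * E => tp (al p.2) p.1).
Proof.
move=> mal.
have mf : measurable_fun setT (fun p : T * E => (p.1, al p.2)).
  apply/measurable_fun_pairP; split; first exact: measurable_fst.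
  exact: (measurableT_comp mal).
exact: (measurableT_comp (measurable_tpath2 G_field) mf).
Qed.

Lemma sqnorm_law u z : sqint law u -> \int[P]_w u (tp z w) ^+ 2 = sqnorm law u.
Proof.
move=> [mu_ _]; have mu2 : measurable_fun setT (fun x => u x ^+ 2) by exact: measurable_funX.
exact: (int_law G_field G_stat z mu2).
Qed.

Lemma int_tpath_mul_le u v z z' : sqint law u -> sqint law v ->
  \int[P]_w `|u (tp z w) * v (tp z' w)| <= 2^-1 * sqnorm law u + 2^-1 * sqnorm law v.
Proof.
move=> su sv; rewrite -(sqnorm_law z su) -(sqnorm_law z' sv).
have su' := sqint_law G_stat z su; have sv' := sqint_law G_stat z' sv.
have [_ i1] := su'; have [_ i2] := sv'.
rewrite -intZ// -intZ// -intD; [|exact: intgZ|exact: intgZ].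
apply: int_le.
- by apply: intg_norm; exact: sqint_mul.
- by apply: intgD; exact: intgZ.
- move=> w; rewrite normrM -(real_normK (num_real (u _))) -(real_normK (num_real (v _))).
  by have := sqr_ge0 (`|u (tp z w)| - `|v (tp z' w)|); nra.
Qed.

Lemma tpath_prod_intg u v rho (al be : E -> E) : sqint law u -> sqint law v -> intg mu rho ->
  measurable_fun setT al -> measurable_fun setT be ->
  (P \x mu)%E.-integrable setT
    (EFin \o (fun p : T * E => rho p.2 * (u (tp (al p.2) p.1) * v (tp (be p.2) p.1)))).
Proof.
move=> su sv ir mal mbe; have [mu_ _] := su; have [mv _] := sv.
apply: (@prod_intg2 _ _ _ _ _ P mu (fun w z => u (tp (al z) w) * v (tp (be z) w))
   (2^-1 * sqnorm law u + 2^-1 * sqnorm law v)) => //.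
- apply: measurable_funM.
    exact: (measurableT_comp mu_ (measurable_tpath_map mal)).
  exact: (measurableT_comp mv (measurable_tpath_map mbe)).
- by move=> z; apply: sqint_mul; exact: sqint_law.
- by move=> z; exact: int_tpath_mul_le.
Qed.

Definition correl u v z : R := \int[P]_w (u (tp z w) * v (tp 0 w)).

Lemma correl_bounded u v z : sqint law u -> sqint law v ->
  `|correl u v z| <= 2^-1 * sqnorm law u + 2^-1 * sqnorm law v.
Proof.
move=> su sv; apply: le_trans (int_norm _) (int_tpath_mul_le z 0 su sv).
by apply: sqint_mul; exact: sqint_law.
Qed.

Lemma correl_prod u v rho : sqint law u -> sqint law v -> intg mu rho ->
  (P \x mu)%E.-integrable setT
    (EFin \o (fun p : T * E => rho p.2 * (u (tp p.2 p.1) * v (tp 0 p.1)))).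
Proof.
move=> su sv ir; exact: (tpath_prod_intg (al := id) (be := fun=> 0)).
Qed.

Lemma correl_intg u v rho : sqint law u -> sqint law v -> intg mu rho ->
  intg mu (fun z => correl u v z * rho z).
Proof.
move=> su sv ir; have [h _] := Rfubini_aux2 (correl_prod su sv ir).
apply: intg_ext h => z; rewrite /= intZ; first exact: mulrC.
by apply: sqint_mul; exact: sqint_law.
Qed.

Lemma correl_fubini u v rho : sqint law u -> sqint law v -> intg mu rho ->
  intg P (fun w => v (tp 0 w) * \int[mu]_z (u (tp z w) * rho z)) /\
  \int[mu]_z (correl u v z * rho z) =
    \int[P]_w (v (tp 0 w) * \int[mu]_z (u (tp z w) * rho z)).
Proof.
move=> su sv ir; have hP := correl_prod su sv ir.
have [mu_ _] := su.
have e w : \int[mu]_z (rho z * (u (tp z w) * v (tp 0 w))) =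
  v (tp 0 w) * \int[mu]_z (u (tp z w) * rho z).
  rewrite -intZm; first by apply: int_ext => z; ring.
  apply: measurable_funM; last exact: intg_meas ir.
  have mf : measurable_fun setT (fun z : E => (w, z)) by exact: measurable_pair1.
  exact: (measurableT_comp mu_ (measurableT_comp (measurable_tpath2 G_field) mf)).
split; first by have [h _] := Rfubini_aux1 hP; apply: intg_ext h => w; exact: e.
transitivity (\int[P]_w \int[mu]_z (rho z * (u (tp z w) * v (tp 0 w)))).
  rewrite (Rfubini hP); apply: int_ext => z /=; rewrite intZ; first exact: mulrC.
  by apply: sqint_mul; exact: sqint_law.
by apply: int_ext => w; exact: e.
Qed.

Lemma correlN u v z : sqint law u -> sqint law v -> correl u v z = correl v u (- z).
Proof.
move=> [mu_ _] [mv _].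
have mF : measurable_fun setT (fun x : realization R d => u (translate z x) * v x).
  by apply: measurable_funM => //; exact: (measurableT_comp mu_ (measurable_translate z)).
transitivity (\int[P]_w (u (translate z (tp 0 w)) * v (tp 0 w))).
  by apply: int_ext => w; rewrite shift_tpath add0r.
rewrite (int_law G_field G_stat 0 mF) -(int_law G_field G_stat (- z) mF).
by apply: int_ext => w; rewrite shift_tpath addNr mulrC.
Qed.

(* Averaging over a ball reduces this to corr_continuous0 for each realization. *)
Lemma correl_continuous0 u v : sqint law u -> sqint law v ->
  forall e, 0 < e -> exists2 del : R, 0 < del &
    forall z, `|z| < del -> `|correl u v z - correl u v 0| <= e.
Proof.
move=> su sv; have [mu_ _] := su; have [mv _] := sv.
pose B (r : R) : set E := [set y | `|y| <= r].
pose b r : E -> R := \1_(B r).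
have mb r : measurable_fun setT (b r) by exact: measurable_indic (measurable_norm_le _).
have b01 r y : 0 <= b r y <= 1 by rewrite /b indicE; case: (_ \in _) => /=; rewrite ?lexx ?ler01.
have ib r : intg mu (b r).
  apply: (bounded_cpt_intg (K := 1)) => //.
    by exists r => y ry; rewrite /b indicE memNset//= /B /=; apply/negP; rewrite -ltNge.
  by move=> y; have /andP[h1 h2] := b01 r y; rewrite ger0_norm.
pose F w y := b 1 y * v (tp y w).
(* Radius 2 makes this cut-off equal to 1 at y + z when |y| <= 1 and |z| <= 1, so it does not affect
   the correlation. *)
pose f w y := b 2 y * u (tp y w).
have msec (x : realization R d -> R) w : measurable_fun setT x ->
  measurable_fun setT (fun y : E => x (tp y w)).
  move=> mx; have mf : measurable_fun setT (fun z : E => (w, z)) by exact: measurable_pair1.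
  exact: (measurableT_comp mx (measurableT_comp (measurable_tpath2 G_field) mf)).
have isec r (x : realization R d -> R) : sqint law x -> (P \x mu)%E.-integrable setT
    (EFin \o (fun p : T * E => b r p.2 * (x (tp p.2 p.1) * x (tp p.2 p.1)))).
  by move=> sx; apply: (tpath_prod_intg (al := id) (be := id)) => //; exact: measurable_id.
have ssec r (x : realization R d -> R) : sqint law x ->
  {ae P, forall w, sqint mu (fun y => b r y * x (tp y w))}.
  move=> sx; have [mx _] := sx; apply: filterS (ae_integrable1 (isec r x sx)) => w iw.
  split; first by apply: measurable_funM => //; exact: msec.
  apply: intg_ext iw => y /=; rewrite /b indicE; case: (_ \in _) => /=.
    by rewrite !mul1r expr2.
  by rewrite !mul0r expr0n.
pose m := \int[mu]_y b 1 y.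
have m0 : 0 < m.
  have -> : m = fine (mu (B 1)).
    by rewrite /m /Rintegral integral_indic ?setIT//; exact: measurable_norm_le.
  rewrite fine_gt0// mu_ball_lty andbT.
  apply: lt_le_trans (mu_ball_gt0 0 ltr01) _; apply: le_measure; rewrite ?inE.
  - exact: measurable_cV_ball.
  - exact: measurable_norm_le.
  - by move=> y /=; rewrite sub0r normrN => /ltW.
have eF z w : `|z| <= 1 -> corr (F w) (f w) (- z) =
    \int[mu]_y (b 1 y * (u (tp (y + z) w) * v (tp y w))).
  move=> z1; apply: int_ext => y; rewrite opprK /F /f /b !indicE.
  have [y1|y1] := leP `|y| 1; last first.
    by rewrite [y \in _]memNset/= ?mul0r// /B /=; apply/negP; rewrite -ltNge.
  rewrite [y \in _]mem_set// [y + z \in _]mem_set ?mul1r 1?mulrC//.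
  by apply: le_trans (ler_normD _ _) _; rewrite -[2]/(1 + 1) lerD.
(* By stationarity the expectation does not depend on y; integrating over the unit ball multiplies
   [correl] by its measure m. *)
have eqc z : `|z| <= 1 -> intg P (fun w => corr (F w) (f w) (- z)) /\
    m * correl u v z = \int[P]_w corr (F w) (f w) (- z).
  move=> z1.
  have mal : measurable_fun setT (fun y : E => y + z).
    rewrite (_ : (fun y => _) = fun y : E => z + 1 *: y); first exact: measurable_affine.
    by apply/funext => y; rewrite scale1r addrC.
  have hP := tpath_prod_intg (al := fun y => y + z) (be :=
    id) su sv (ib 1) mal (@measurable_id _ _ setT).
  split; first by have [h _] := Rfubini_aux1 hP; apply: intg_ext h => w; rewrite eF.
  transitivity (\int[P]_w \int[mu]_y (b 1 y * (u (tp (y + z) w) * v (tp y w)))); last first.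
    by apply: int_ext => w; rewrite eF.
  rewrite (Rfubini hP) /= /m mulrC -intZ//; apply: int_ext => y.
  rewrite intZ; last by apply: sqint_mul; exact: sqint_law.
  rewrite mulrC; apply: (congr1 ( *%R _)).
  have mG : measurable_fun setT (fun x : realization R d => u (translate z x) * v x).
    by apply: measurable_funM => //; exact: (measurableT_comp mu_ (measurable_translate z)).
  transitivity (\int[P]_w (u (translate z (tp 0 w)) * v (tp 0 w))).
    by apply: int_ext => w; rewrite shift_tpath add0r.
  apply: (etrans (int_law G_field G_stat 0 mG)); apply: (etrans (esym (int_law G_field G_stat y mG))).
  by apply: int_ext => w; rewrite shift_tpath.
move=> e e0; apply: contrapT => nex.
have hz k : exists z : E, `|z| < k.+1%:R^-1 /\ e < `|correl u v z - correl u v 0|.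
  apply: contrapT => nz; apply: nex; exists k.+1%:R^-1; first by rewrite invr_gt0.
  move=> z zk; rewrite leNgt; apply/negP => ez; apply: nz; by exists z.
have /choice[zs hzs] : forall k, exists z : E,
  `|z| < k.+1%:R^-1 /\ e < `|correl u v z - correl u v 0| by exact: hz.
have zs1 k : `|zs k| <= 1.
  by have [/ltW h _] := hzs k; apply: le_trans h _; rewrite invf_le1// ler1n.
(* The bound of [int_mul_le] with s = 1, independent of the shift. The sections are square
   integrable only almost surely, whence the use of [cvg_int_ae]. *)
pose D w := 2^-1 * \int[mu]_y (b 1 y * (v (tp y w) * v (tp y w))) +
            2^-1 * \int[mu]_y (b 2 y * (u (tp y w) * u (tp y w))).
have iD : intg P D.
  have [h1 _] := Rfubini_aux1 (isec 1 v sv); have [h2 _] := Rfubini_aux1 (isec 2 u su).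
  by apply: intgD; apply: intgZ.
have bsq r (x : E -> R) : \int[mu]_y (b r y * x y) ^+ 2 = \int[mu]_y (b r y * (x y * x y)).
  apply: int_ext => y; rewrite /b indicE; case: (_ \in _); first by rewrite !mul1r expr2.
  by rewrite !mul0r expr0n.
have [_ e0'] := eqc 0 (eq_ind_r (fun t => t <= 1) ler01 (normr0 _)).
have i0 : intg P (fun w => corr (F w) (f w) (- 0)) by have [] :=
  eqc 0 (eq_ind_r (fun t => t <= 1) ler01 (normr0 _)).
have cv : \int[P]_w corr (F w) (f w) (- zs k) @[k --> \oo] --> \int[P]_w corr (F w) (f w) (- 0).
  apply: (cvg_int_ae (h := D)) => //.
  - by move=> k; have [h _] := eqc _ (zs1 k); exact: intg_meas h.
  - exact: intg_meas i0.
  - apply: filterS2 (ssec 1 v sv) (ssec 2 u su) => w sF sf.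
    apply/cvgrPdist_le => eps eps0.
    have [del del0 hd] := corr_continuous0 sF sf eps0.
    exists (Num.truncn del^-1) => // k /= hk; rewrite oppr0 distrC; apply: hd.
    rewrite normrN; have [h _] := hzs k; apply: lt_le_trans h _.
    rewrite -[del]invrK lef_pV2 ?posrE ?invr_gt0//.
    by apply/ltW; apply: lt_le_trans (truncnS_gt _) _; rewrite ler_nat ltnS.
  - apply: filterS2 (ssec 1 v sv) (ssec 2 u su) => w sF sf k.
    rewrite /D -!bsq; have sf' := sqint_shift (zs k) sf.
    have := int_mul_le (ltr01 : 0 < 1 :> R) sF sf'.
    rewrite mulr1 !mul1r.
    have -> : \int[mu]_y (b 2 (y + zs k) * u (tp (y + zs k) w)) ^+ 2 =
      \int[mu]_y (b 2 y * u (tp y w)) ^+ 2.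
      by have [_ h] := sf; exact: (int_shift (zs k) h).
    apply: le_trans; rewrite /corr /F /f; apply: eqW; apply: (congr1 Num.norm).
    by apply: int_ext => y; rewrite opprK.
have mc : m * correl u v (zs k) @[k --> \oo] --> m * correl u v 0.
  rewrite e0'; move: cv; apply: cvg_trans; apply: near_eq_cvg; apply: nearW => k.
  by have [_ h] := eqc _ (zs1 k); exact: esym h.
have me : 0 < m * e by rewrite mulr_gt0.
have /cvgrPdist_le /(_ _ me) [N _ /(_ N (leqnn N)) /=] := mc.
rewrite -mulrBr normrM (gtr0_norm m0) ler_pM2l// distrC leNgt => /negP; apply.
by have [] := hzs N.
Qed.

End correlation.

Section orthogonality.
Context {R : realType} {d : nat} {dT : measure_display} {T : measurableType dT}.
Local Notation E := 'cV[R]_d.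
Local Notation mu := (lebesgue_cV d).
Variables (P : probability T R) (G : T -> E -> R).

(** As d + alpha0 >= 1 and the Euclidean norm dominates the maximum norm, the covariance is at most
    C0 / (1 + |y|), while the points z - m e_k + x leave every ball as m grows. *)
Lemma decorrelating_line (C0 alpha0 : R) (z : E) (k : 'I_d) : 0 < alpha0 ->
  (forall x, `|covariance_fun P G x| <= C0 / (1 + enorm x) `^ (d%:R + alpha0)) ->
  decorrelating P G (fun m => z - m%:R *: bvec k).
Proof.
move=> al0 decay x.
have en0 (y : E) : 0 <= enorm y by exact: sqrtr_ge0.
have C00 : 0 <= C0.
  have := le_trans (normr_ge0 _) (decay 0).
  rewrite pmulr_lge0// invr_gt0 powR_gt0// ltr_pwDl//.
have b (y : E) : `|covariance_fun P G y| <= C0 / (1 + `|y|).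
  apply: le_trans (decay y) _; apply: ler_wpM2l => //.
  have p1 : 0 < 1 + enorm y by rewrite ltr_pwDl.
  have p2 : 0 < 1 + `|y| by rewrite ltr_pwDl.
  rewrite lef_pV2 ?posrE ?powR_gt0//.
  apply: (@le_trans _ _ (1 + enorm y)); first by rewrite lerD2l enorm_ge.
  rewrite -[leLHS]powRr1; last exact: ltW.
  apply: ler_powR; first by rewrite lerDl.
  (* The index k witnesses d > 0. *)
  have d1 : (1 : R) <= d%:R by rewrite ler1n; case: d k => [[]|].
  by rewrite (le_trans d1)// lerDl ltW.
have ek : 1 <= `|bvec k : E|.
  by have := cV_coord_le (bvec k : E) k; rewrite /bvec mxE !eqxx normr1.
apply/cvgr0Pnorm_le => e e0.
have [N hN] : exists N : nat, C0 / e + `|z + x| < N%:R.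
  by exists (Num.truncn (C0 / e + `|z + x|)).+1; exact: truncnS_gt.
exists N => // m /= Nm; apply: le_trans (b _) _.
have p2 (y : E) : 0 < 1 + `|y| by rewrite ltr_pwDl.
rewrite ler_pdivrMr// mulrC -ler_pdivrMr//.
have h1 : m%:R <= `|m%:R *: bvec k : E| by rewrite normrZ normr_nat ler_peMr.
have h2 : `|m%:R *: bvec k : E| <= `|z + x| + `|z - m%:R *: bvec k + x|.
  rewrite -[`|z - _ + x|]normrN; apply: le_trans (ler_normD _ _); apply: eqW; congr (`| _ |).
  by rewrite [z - _ + x]addrAC opprB [RHS]addrC subrK.
have h3 : (N%:R : R) <= m%:R by rewrite ler_nat.
move: hN h1 h2 h3; move: (`|z + x|) (`|z - m%:R *: bvec k + x|) (`|m%:R *: bvec k : E|) => A B D; lra.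
Qed.

Hypothesis G_field : random_field G.
Hypothesis G_gauss : gaussian_field P G.
Hypothesis G_stat : stationary_law P G.
Hypothesis G_centered : forall x, \int[P]_w G w x = 0.
Local Notation law := (law P G_field).
Local Notation tp := (tpath G).

Lemma curl_div_orthogonal (f h : 'I_d -> realization R d -> R) (eta : E -> R) x0 (k : 'I_d) :
  tf eta -> eta x0 != 0 ->
  (forall z, decorrelating P G (fun m => z - m%:R *: bvec k)) ->
  (forall l, sqint law (f l)) -> (forall l, sqint law (h l)) ->
  (forall l, \int[law]_x f l x = 0) ->
  {ae P, forall w, forall l m v, tf v ->
    \int[mu]_z (f l (tp z w) * pderiv m v z) = \int[mu]_z (f m (tp z w) * pderiv l v z)} ->
  {ae P, forall w, forall v, tf v ->
    \sum_l \int[mu]_z (h l (tp z w) * pderiv l v z) = 0} ->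
  \sum_l \int[P]_w (f l (tp 0 w) * h l (tp 0 w)) = 0.
Proof.
move=> te e0 dec sf sh f0 fcurl hdiv.
pose kap z := \sum_l correl P G (f l) (h l) z.
pose K := \sum_l (2^-1 * sqnorm law (f l) + 2^-1 * sqnorm law (h l)).
have i1 u v rho := @correl_intg _ _ _ _ P G G_field G_stat u v rho.
apply: (@flat_eq0 _ _ kap K k _ _ _ _ eta x0 te e0).
- move=> z; apply: le_trans (ler_norm_sum _ _ _) _; apply: ler_sum => l _.
  exact: correl_bounded.
- move=> rho ir; apply: (intg_ext (f := fun z => \sum_l (correl P G (f l) (h l) z * rho z))).
    by move=> z; rewrite mulr_suml.
  by apply: intg_sum => l _; apply: (i1).
- move=> rho tr; have ir l := tf_intg (tf_pderiv l tr).
  (* Passing from the correlation of f with h to that of h with f reflects z, so the divergence of h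
     is tested with the reflection of rho. *)
  pose v (z : E) := rho (0 + (-1) *: z).
  have tv : tf v by apply: tf_affine => //; rewrite oppr_eq0 oner_eq0.
  have iv l := tf_intg (tf_pderiv l tv).
  have sgn : ((-1 : R) == 1) || ((-1 : R) == -1) by rewrite eqxx orbT.
  transitivity (\sum_l \int[mu]_z (correl P G (f l) (h l) z * pderiv k rho z)).
    rewrite -int_sum; last by move=> l _; apply: (i1).
    by apply: int_ext => z; rewrite mulr_suml.
  (* The curl-free condition, applied in each realization, exchanges the index l of f with the
     direction k of the derivative. *)
  transitivity (\sum_l \int[mu]_z (correl P G (f k) (h l) z * pderiv l rho z)).
    apply: eq_bigr => l _.
    have [a1 ->] := correl_fubini G_stat (sf l) (sh l) (ir k).
    have [a2 ->] := correl_fubini G_stat (sf k) (sh l) (ir l).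
    apply: int_ae; [exact: intg_meas a1|exact: intg_meas a2|].
    apply: filterS fcurl => w hw; apply: (congr1 ( *%R _)); exact: (hw l k rho tr).
  (* After the reflection the derivatives are paired with h along the translates, where they sum to
     its divergence; f k no longer depends on z or l. *)
  transitivity (\sum_l - \int[mu]_z (correl P G (h l) (f k) z * pderiv l v z)).
    apply: eq_bigr => l _.
    have iL := i1 (f k) (h l) _ (sf k) (sh l) (ir l).
    apply: (etrans (esym (int_affine 0 sgn iL))).
    have iR := i1 (h l) (f k) _ (sh l) (sf k) (iv l).
    apply: (etrans _ (intN iR)); apply: int_ext => z.
    have [pv _] := pderiv_affine l 0 (-1) (proj1 tr).
    rewrite /v pv !add0r !scaleN1r.
    by rewrite (correlN G_stat (- z) (sf k) (sh l)) opprK mulN1r mulrN opprK.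
  rewrite sumrN.
  transitivity (- \sum_l \int[P]_w (f k (tp 0 w) * \int[mu]_z (h l (tp z w) * pderiv l v z))).
    apply: congr1; apply: eq_bigr => l _.
    by have [_ e] := correl_fubini G_stat (sh l) (sf k) (iv l); exact: e.
  have a3 l : intg P (fun w => f k (tp 0 w) * \int[mu]_z (h l (tp z w) * pderiv l v z)).
    by have [a _] := correl_fubini G_stat (sh l) (sf k) (iv l).
  rewrite -int_sum; last by move=> l _; exact: a3.
  apply/eqP; rewrite oppr_eq0; apply/eqP.
  transitivity (\int[P]_w (0 : R)); last exact: int0.
  apply: int_ae => //; first by apply: intg_meas; apply: intg_sum => l _; exact: a3.
  apply: filterS hdiv => w hw; rewrite -mulr_sumr.
  by apply: (etrans (congr1 ( *%R _) (hw v tv))); rewrite mulr0.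
- move=> z.
  have cs I (r : seq I) (F : nat -> I -> R) : (forall c, F m c @[m --> \oo] --> (0 : R)) ->
      \sum_(c <- r) F m c @[m --> \oo] --> (0 : R).
    move=> hF; elim: r => [|c r ih]; first by under eq_fun do rewrite big_nil; exact: cvg_cst.
    by under eq_fun do rewrite big_cons; have := cvgD (hF c) ih; rewrite addr0; apply.
  apply: (cs) => l.
  (* The limit is a product of means, and that of f is 0. *)
  have := decorrelating_mixes G_gauss G_stat G_centered (dec z) (sf l) (sh l).
  by rewrite /mixes f0 mul0r.
- move=> e eg0.
  have d0 : (0 : R) < d%:R by rewrite ltr0n; exact: leq_ltn_trans (leq0n k) (ltn_ord k).
  have ed : 0 < e / d%:R by rewrite divr_gt0.
  have hc l : exists del : R, 0 < del /\ forall z : E, `|z| < del ->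
      `|correl P G (f l) (h l) z - correl P G (f l) (h l) 0| <= e / d%:R.
    by have [del del0 hd] := correl_continuous0 G_stat (sf l) (sh l) ed; exists del.
  have /choice[del hdel] := hc.
  exists (\big[Order.min/1]_l del l).
    by elim/big_ind: _ => // [x y x0' y0|l _]; [rewrite lt_min x0'|have [] := hdel l].
  move=> z hz; rewrite /kap -sumrB; apply: le_trans (ler_norm_sum _ _ _) _.
  have -> : e = \sum_(l < d) e / d%:R.
    by rewrite sumr_const card_ord -[RHS]mulr_natr divfK// gt_eqF.
  apply: ler_sum => l _; have [_ h1] := hdel l; apply: (h1).
  by apply: lt_le_trans hz _; exact: bigmin_le_cond.
Qed.

End orthogonality.

(** * Symmetry of the effective coefficients *)

Section almost_everywhere.
Context {R : realType}.

Lemma ae_exists d (T : measurableType d) (m : {measure set T -> \bar R}) (Q : T -> Prop) :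
  (0 < m setT)%E -> {ae m, forall x, Q x} -> exists x, Q x.
Proof.
move=> m0 [N [mN N0 sub]]; apply: contrapT => nQ.
have NT : N = setT by apply/seteqP; split=> // x _; apply: sub => Qx; apply: nQ; exists x.
by rewrite -NT N0 ltxx in m0.
Qed.

(** Tonelli for |f - g|. Stationarity represents a field almost surely for almost every point,
    whereas the equations need this representation almost everywhere for almost every
    realization. *)
Lemma ae_swap d1 d2 (T1 : measurableType d1) (T2 : measurableType d2)
    (m1 : {sigma_finite_measure set T1 -> \bar R}) (m2 : {sigma_finite_measure set T2 -> \bar R})
    (f g : T1 -> T2 -> R) :
  measurable_fun setT (fun p : T1 * T2 => f p.1 p.2) ->
  measurable_fun setT (fun p : T1 * T2 => g p.1 p.2) ->
  {ae m2, forall y, {ae m1, forall x, f x y = g x y}} ->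
  {ae m1, forall x, {ae m2, forall y, f x y = g x y}}.
Proof.
move=> mf mg H.
pose F (p : T1 * T2) := (`|f p.1 p.2 - g p.1 p.2|%:E)%E.
have mF : measurable_fun setT F.
  by apply/measurable_EFinP; apply: measurableT_comp => //; exact: measurable_funB.
have F0 p : (0 <= F p)%E by rewrite lee_fin.
have ft := fubini_tonelli (m1 := m1) (m2 := m2) F mF F0.
have mF1 := measurable_fun_fubini_tonelli_F (m2 := m2) F mF F0.
have mF2 := measurable_fun_fubini_tonelli_G (m1 := m1) F mF F0.
have z2 : (\int[m2]_y \int[m1]_x F (x, y) = 0)%E.
  have h := proj2 (ae_eq_integral_abs m2 measurableT mF2).
  rewrite -[RHS]h.
    by apply: eq_integral => y _; rewrite gee0_abs//; apply: integral_ge0.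
  apply: filterS H => y Hy _; rewrite /fubini_G /cst.
  have mFy : measurable_fun setT (fun x => F (x, y)) by exact: measurableT_comp.
  have h' := proj2 (ae_eq_integral_abs m1 measurableT mFy).
  rewrite -[RHS]h'; first by apply: eq_integral => x _; rewrite gee0_abs.
  by apply: filterS Hy => x e _; rewrite /F /= e subrr normr0.
have z1 : (\int[m1]_x `|fubini_F m2 F x| = 0)%E.
  by rewrite -z2 -ft; apply: eq_integral => x _; rewrite gee0_abs//; apply: integral_ge0.
have := proj1 (ae_eq_integral_abs m1 measurableT mF1) z1.
apply: filterS => x /(_ I) Fx.
have mFx : measurable_fun setT (fun y => F (x, y)) by exact: measurableT_comp.
have z3 : (\int[m2]_y `|F (x, y)| = 0)%E.
  by rewrite -[RHS]Fx; apply: eq_integral => y _; rewrite gee0_abs.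
have := proj1 (ae_eq_integral_abs m2 measurableT mFx) z3.
apply: filterS => y /(_ I) [] /eqP; rewrite normr_eq0 subr_eq0 => /eqP; exact.
Qed.

End almost_everywhere.

Section first_corrector.
Context {R : realType} {d : nat} {dT : measure_display} {T : measurableType dT}.
Local Notation E := 'cV[R]_d.
Local Notation mu := (lebesgue_cV d).
Variables (P : probability T R) (G : T -> E -> R).
Hypothesis G_field : random_field G.
Hypothesis G_stat : stationary_law P G.
Local Notation law := (law P G_field).
Local Notation tp := (tpath G).

Lemma stationary_realization (Y : T -> E -> R) : stationary P G Y ->
  exists2 f : realization R d -> R, measurable_fun setT f &
    {ae mu, forall x, {ae P, forall w, Y w x = f (tp x w)}}.
Proof. by move=> [_ [f [/cylinder_measurableP mf hf]]]; exists f. Qed.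

Lemma section_measurable (Y : T -> E -> R) x : random_field Y -> measurable_fun setT (Y ^~ x).
Proof.
move=> mY; have mf : measurable_fun setT (fun w : T => (w, x)) by exact: measurable_pair2.
exact: (measurableT_comp mY mf).
Qed.

(** Component l of a (grad phi_k + e_k) at the origin, as a functional of the realization. *)
Definition flux (A : R -> 'M[R]_d) (f : 'I_d -> realization R d -> R) (k l : 'I_d)
    (v : realization R d) : R :=
  \sum_m A (v 0) l m * (f m v + (m == k)%:R).

Lemma sqint_flux (A : R -> 'M[R]_d) (K : R) f k l : (forall p q,
  measurable_fun setT (fun t => A t p q)) ->
  (forall t p q, `|A t p q| <= K) -> (forall m, sqint law (f m)) -> sqint law (flux A f k l).
Proof.
move=> mA bA sf; apply: sqint_sum => m _; apply: (sqint_bndM (K := K)).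
- exact: (measurableT_comp (mA l m) (measurable_eval 0)).
- by move=> v; exact: bA.
- apply: sqintD => //.
  have h : sqint law (fun v => (m == k)%:R * 1) by apply: sqintZ; exact: sqint_law1.
  by apply: sqint_ext h => v; rewrite mulr1.
Qed.

(** This carries the corrector over to path space. The integrability of f, its mean and the
    effective coefficient are read off at one point, while the curl and divergence conditions are
    weak equations in almost every realization. *)
Lemma first_corrector_realization (A : R -> 'M[R]_d) (K : R) (C : corrector_data R d dT T) k :
  (forall p q, measurable_fun setT (fun t => A t p q)) -> (forall t p q, `|A t p q| <= K) ->
  (forall w x, phi C [::] w x = 1) -> (forall w x, sigma C [::] w x = 0) ->
  corrector_step P G (fun w x => A (G w x)) C [::] k ->
  exists f : 'I_d -> realization R d -> R,
    [/\ forall l, sqint law (f l), forall l, \int[law]_x f l x = 0,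
      {ae P, forall w, forall l m v, tf v ->
        \int[mu]_z (f l (tp z w) * pderiv m v z) = \int[mu]_z (f m (tp z w) * pderiv l v z)},
      {ae P, forall w, forall v, tf v ->
        \sum_l \int[mu]_z (flux A f k l (tp z w) * pderiv l v z) = 0} &
      forall l, (abar C [::] *m bvec k) l 0 = \int[law]_x flux A f k l x].
Proof.
move=> mA bA phi1 sig0 step.
have sY l := cs_grad_phi step l.
have hf l : exists f : realization R d -> R, measurable_fun setT f /\
    {ae mu, forall x, {ae P, forall w, grad_phi C [:: k] w x l 0 = f (tp x w)}}.
  by have [/stationary_realization[f mf ?] _ _] := sY l; exists f.
have /choice[f hf'] := hf.
have mf l : measurable_fun setT (f l) by have [] := hf' l.
have hY l : {ae mu, forall x, {ae P, forall w, grad_phi C [:: k] w x l 0 = f l (tp x w)}}.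
  by have [] := hf' l.
have rY l : random_field (fun w x => grad_phi C [:: k] w x l 0) by have [[]] := sY l.
have mu0 : (0 < mu [set: E])%E.
  apply: lt_le_trans (mu_ball_gt0 (0 : E) (ltr01 : 0 < 1 :> R)) _.
  by apply: le_measure; rewrite ?inE//; exact: measurable_cV_ball.
have hYa : {ae mu, forall x, forall l, {ae P, forall w, grad_phi C [:: k] w x l 0 = f l (tp x w)}}.
  exact: filter_forall.
have hca : {ae mu, forall x, forall l, \int[P]_w grad_phi C [:: k] w x l 0 = 0}.
  by apply: filter_forall => l; have [] := sY l.
have hsa : {ae mu, forall x, forall l, (\int[P]_w ((grad_phi C [:: k] w x l 0) ^+ 2)%:E < +oo)%E}.
  by apply: filter_forall => l; have [] := sY l.
(* All moment conditions hold at almost every point; a single point common to them suffices, since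
   the law of the translated realization does not depend on it. *)
have [x [hx [cx [sx ax]]]] := ae_exists mu0 (filterI hYa (filterI hca (filterI hsa (cs_abar step)))).
have mfx l : measurable_fun setT (fun w => f l (tp x w)).
  exact: (measurableT_comp (mf l) (measurable_tpath G_field x)).
have sf l : sqint law (f l).
  split; first exact: mf.
  apply: (intg_lawV G_field G_stat (z := x)); first exact: measurable_funX.
  have [_ h] : sqint P (fun w => grad_phi C [:: k] w x l 0).
    by apply/sqintP; split; [exact: (section_measurable x (rY l))|exact: sx].
  apply: intg_ae h; first exact: measurable_funX.
  by apply: filterS (hx l) => w ->.
have hw : {ae P, forall w, forall l, {ae mu, forall z, grad_phi C [:: k] w z l 0 = f l (tp z w)}}.
  apply: filter_forall => l; apply: ae_swap; [exact: rY| |exact: hY].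
  exact: (measurableT_comp (mf l) (measurable_tpath2 G_field)).
have msec w (u : realization R d -> R) : measurable_fun setT u ->
  measurable_fun setT (fun z : E => u (tp z w)).
  move=> mx; have m2 : measurable_fun setT (fun z : E => (w, z)) by exact: measurable_pair1.
  exact: (measurableT_comp mx (measurableT_comp (measurable_tpath2 G_field) m2)).
have hH : {ae P, forall w, [/\ L2loc (phi C [:: k] w), vloc (grad_phi C [:: k] w) &
    forall l, wgrad l (phi C [:: k] w) (fun x => grad_phi C [:: k] w x l 0)]}.
  by apply: filterS (cs_phi_H1loc step) => w /H1locP.
have mfl l : measurable_fun setT (flux A f k l).
  by have [] := sqint_flux k l mA bA sf.
exists f; split => //.
- move=> l; rewrite -(int_law G_field G_stat x)// -[RHS](cx l).
  apply: int_ae => //; first exact: section_measurable x (rY l).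
  by apply: filterS (hx l) => w ->.
- apply: filterS2 hw hH => w hw [_ vY wY] l m v tv.
  have mv p : measurable_fun setT (pderiv p v) by apply: tf_meas; exact: tf_pderiv.
  transitivity (\int[mu]_z (grad_phi C [:: k] w z l 0 * pderiv m v z)).
    apply: int_ae; [apply: measurable_funM => //;
      exact: msec|by apply: measurable_funM => //; have [] := vY l|].
    by apply: filterS (hw l) => z ->.
  rewrite (curl_test (wY l) (wY m) tv).
  apply: int_ae; [by apply: measurable_funM => //;
    have [] := vY m|apply: measurable_funM => //; exact: msec|].
  by apply: filterS (hw m) => z ->.
- apply: filterS3 hw hH (cs_phi_eq step) => w hw [_ vY wY] eqw v tv.
  have mv p : measurable_fun setT (pderiv p v) by apply: tf_meas; exact: tf_pderiv.
  have maw p q : measurable_fun setT (fun z => A (G w z) p q).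
    have m2 : measurable_fun setT (fun z : E => (w, z)) by exact: measurable_pair1.
    exact: (measurableT_comp (mA p q) (measurableT_comp G_field m2)).
  have i1 l m : intg mu (fun z => A (G w z) l m * (grad_phi C [:: k] w z m 0 * pderiv l v z)).
    apply: (intg_bndM (K := K)) => //; apply: L2loc_tf_intg => //; exact: tf_pderiv.
  have i2 l : intg mu (fun z => A (G w z) l k * pderiv l v z).
    apply: (intg_bndM (K := K)) => //; apply: tf_intg; exact: tf_pderiv.
  have e l : \int[mu]_z (flux A f k l (tp z w) * pderiv l v z) =
      \int[mu]_z (\sum_m A (G w z) l m * (grad_phi C [:: k] w z m 0 * pderiv l v z)) +
      \int[mu]_z (A (G w z) l k * pderiv l v z).
    rewrite -intD//; last by apply: intg_sum.
    apply: int_ae.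
    + by apply: measurable_funM => //; exact: msec.
    + by apply: intg_meas; apply: intgD => //; apply: intg_sum.
    + apply: filterS (filter_forall _ hw) => z hz.
      rewrite /flux /tpath /translate addr0 mulr_suml.
      transitivity (\sum_m (A (G w z) l m * (grad_phi C [:: k] w z m 0 * pderiv l v z)
          + (m == k)%:R * (A (G w z) l m * pderiv l v z))).
        by apply: eq_bigr => m _; rewrite hz /tpath /translate; ring.
      rewrite big_split /=; apply: (congr1 (fun t => _ + t)).
      by rewrite (bigD1 k)//= eqxx mul1r big1 ?addr0// => m /negPf ->; rewrite mul0r.
  rewrite (eq_bigr _ (fun l _ => e l)) big_split /=.
  have cv : Ccinfty setT v by apply/tfP.
  have := eqw v cv.
  have -> : \int[mu]_z dot (grad v z) (A (G w z) *m grad_phi C (rcons [::] k) w z) =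
      \sum_l \int[mu]_z (\sum_m A (G w z) l m * (grad_phi C [:: k] w z m 0 * pderiv l v z)).
    rewrite -int_sum; last by move=> l _; apply: intg_sum.
    apply: int_ext => z; apply: eq_bigr => l _; rewrite !mxE mulr_sumr.
    by apply: eq_bigr => m _; ring.
  have -> : \int[mu]_z dot (grad v z) (corrector_source (fun w x => A (G w x)) C [::] k w z) =
      \sum_l \int[mu]_z (A (G w z) l k * pderiv l v z).
    rewrite -int_sum//; apply: int_ext => z; apply: eq_bigr => l _.
    rewrite /corrector_source phi1 sig0 scale1r subr0 !mxE mulrC.
    rewrite (bigD1 k)//= /bvec mxE !eqxx mulr1 big1 ?addr0// => m /negPf mk.
    by rewrite mxE mk mulr0.
  move=> ->; exact: addNr.
- move=> l; rewrite (ax l) -(int_law G_field G_stat x)//.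
  have mAx p q : measurable_fun setT (fun w => A (G w x) p q).
    exact: (measurableT_comp (mA p q) (section_measurable x G_field)).
  apply: int_ae.
  + rewrite (_ : (fun w => _) = fun w => \sum_m A (G w x) l m * (grad_phi C [:: k] w x m 0 +
    (m == k)%:R)).
      apply: measurable_sum => m; apply: measurable_funM; first exact: mAx.
      by apply: measurable_funD => //; exact: section_measurable x (rY m).
    apply/funext => w; rewrite phi1 scale1r !mxE; apply: eq_bigr => m _.
    by rewrite !mxE eqxx andbT.
  + exact: (measurableT_comp (mfl l) (measurable_tpath G_field x)).
  + apply: filterS (filter_forall _ hx) => w hxw.
    rewrite phi1 scale1r !mxE; apply: eq_bigr => m _.
    by rewrite !mxE eqxx andbT hxw /tpath /translate addr0.
Qed.

End first_corrector.

Section effective_transpose.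
Context {R : realType} {d : nat} {dT : measure_display} {T : measurableType dT}.
Local Notation E := 'cV[R]_d.
Local Notation mu := (lebesgue_cV d).
Variables (P : probability T R) (G : T -> E -> R).
Hypothesis G_field : random_field G.
Hypothesis G_gauss : gaussian_field P G.
Hypothesis G_stat : stationary_law P G.
Hypothesis G_centered : forall x, \int[P]_w G w x = 0.
Local Notation law := (law P G_field).
Local Notation tp := (tpath G).

Lemma int_flux_mul (A : R -> 'M[R]_d) (K : R) f h (i l : 'I_d) :
  (forall p q, measurable_fun setT (fun t => A t p q)) -> (forall t p q, `|A t p q| <= K) ->
  (forall m, sqint law (f m)) -> (forall m, sqint law (h m)) ->
  \int[P]_w (\sum_m (h m (tp 0 w) + (m == l)%:R) * flux A f i m (tp 0 w)) =
  \sum_m \int[P]_w (h m (tp 0 w) * flux A f i m (tp 0 w)) + \int[law]_x flux A f i l x.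
Proof.
move=> mA bA sf sh.
have sfl m := sqint_flux G_stat i m mA bA sf.
have ihf m : intg P (fun w => h m (tp 0 w) * flux A f i m (tp 0 w)).
  by apply: sqint_mul; exact: sqint_law.
have ifl : intg P (fun w => flux A f i l (tp 0 w)).
  have := intg_law G_stat 0 (sqint_mul (sqint_law1 G_field G_stat) (sfl l)).
  by apply: intg_ext => w; rewrite mul1r.
have [mfl _] := sfl l.
rewrite -(int_law G_field G_stat 0 mfl) -int_sum// -intD//; last exact: intg_sum.
apply: int_ext => w; transitivity (\sum_m (h m (tp 0 w) * flux A f i m (tp 0 w) +
    (m == l)%:R * flux A f i m (tp 0 w))).
  by apply: eq_bigr => m _; rewrite mulrDl.
rewrite big_split /=; apply: (congr1 (fun t => _ + t)).
by rewrite (bigD1 l)//= eqxx mul1r big1 ?addr0// => m /negPf ->; rewrite mul0r.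
Qed.

(** The expectation of (grad phi^*_j + e_j) . a (grad phi_i + e_i) is computed twice. Orthogonality
    of grad phi^*_j to the flux of phi_i leaves entry j of that mean flux; after transposing a,
    orthogonality of grad phi_i to the dual flux leaves entry i of the dual one. *)
Lemma effective_transpose (A : R -> 'M[R]_d) (K : R) (C Cs : corrector_data R d dT T)
    (eta : E -> R) x0 (i j : 'I_d) : tf eta -> eta x0 != 0 ->
  (forall k z, decorrelating P G (fun m => z - m%:R *: bvec k)) ->
  (forall p q, measurable_fun setT (fun t => A t p q)) -> (forall t p q, `|A t p q| <= K) ->
  (forall w x, phi C [::] w x = 1) -> (forall w x, sigma C [::] w x = 0) ->
  (forall w x, phi Cs [::] w x = 1) -> (forall w x, sigma Cs [::] w x = 0) ->
  corrector_step P G (fun w x => A (G w x)) C [::] i ->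
  corrector_step P G (fun w x => (A (G w x))^T) Cs [::] j ->
  (abar Cs [::] *m bvec j) i 0 = (abar C [::] *m bvec i) j 0.
Proof.
move=> te e0 dec mA bA p1 s0 p1s s0s st sts.
pose At t := (A t)^T.
have mAt p q : measurable_fun setT (fun t => At t p q).
  by rewrite (_ : (fun t => _) = fun t => A t q p)//; apply/funext => t; rewrite mxE.
have bAt t p q : `|At t p q| <= K by rewrite mxE.
have [f [sf f0 cf df ab]] := first_corrector_realization G_field G_stat mA bA p1 s0 st.
have [h [sh h0 ch dh abs]] := first_corrector_realization G_field G_stat mAt bAt p1s s0s sts.
have o1 := curl_div_orthogonal G_gauss G_stat G_centered te e0 (dec i) sh
  (fun l => sqint_flux G_stat i l mA bA sf) h0 ch df.
have o2 := curl_div_orthogonal G_gauss G_stat G_centered te e0 (dec i) sf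
  (fun l => sqint_flux G_stat j l mAt bAt sh) f0 cf dh.
rewrite (ab j) (abs i).
have e1 := int_flux_mul i j mA bA sf sh; have e2 := int_flux_mul j i mAt bAt sh sf.
apply: (etrans (esym (add0r _))); apply: (etrans (esym (congr1 (fun t => t + _) o2))).
apply: (etrans (esym e2)); apply: (etrans _ (add0r _)).
apply: (etrans _ (congr1 (fun t => t + _) o1)); apply: (etrans _ e1).
apply: int_ext => w; rewrite /flux.
under eq_bigr do rewrite mulr_sumr.
rewrite exchange_big /=; apply: eq_bigr => l _; rewrite mulr_sumr.
by apply: eq_bigr => m _; rewrite /At mxE; ring.
Qed.

End effective_transpose.

(** * Bounds from ellipticity and conclusion *)

Section coefficients.
Context {R : realType} {d : nat}.
Local Notation E := 'cV[R]_d.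

Lemma enorm_sq (u : E) : enorm u ^+ 2 = dot u u.
Proof. by rewrite /enorm sqr_sqrtr// dot_ge0. Qed.

Lemma dot_eq0 (u : E) : dot u u = 0 -> u = 0.
Proof.
move=> u0; apply/colP => p; rewrite mxE; apply/eqP.
have /eqP := u0; rewrite psumr_eq0 => [|q _]; last by rewrite -expr2 sqr_ge0.
by move=> /allP /(_ p (mem_index_enum p)); rewrite -expr2 sqrf_eq0.
Qed.

(** The lower bound makes M injective. This is needed to read the second condition of [elliptic], as
    [invmx] returns a default value on singular matrices. *)
Lemma elliptic_unit (lambda : R) (M : 'M[R]_d) : 0 < lambda -> elliptic lambda M ->
  M \in unitmx.
Proof.
move=> l0 eM; rewrite -unitmx_tr unitmxE unitfE; apply/negP => /det0P [v v0 vM].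
have [h _] := eM v^T.
have Mv : M *m v^T = 0 by rewrite -[M]trmxK -trmx_mul vM trmx0.
move: h; rewrite Mv dot0r enorm_sq pmulr_rle0// => h.
have /dot_eq0 v0' : dot v^T v^T = 0 by apply/eqP; rewrite eq_le h dot_ge0.
by move: v0; rewrite -[v]trmxK v0' trmx0 eqxx.
Qed.

(** For u = M e_q the bound on the inverse reads |u| ^ 2 <= u_q, whence |u| <= 1. *)
Lemma elliptic_le1 (lambda : R) (M : 'M[R]_d) p q : 0 < lambda -> elliptic lambda M ->
  `|M p q| <= 1.
Proof.
move=> l0 eM; have uM := elliptic_unit l0 eM.
pose u := M *m bvec q.
have [_] := eM u; rewrite enorm_sq /u mulKmx// -/u dotC dot_bvec => h.
have up : u p 0 ^+ 2 <= dot u u.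
  rewrite /dot (bigD1 p)//= -expr2 lerDl sumr_ge0// => r _.
  by rewrite -expr2 sqr_ge0.
have uq : u q 0 ^+ 2 <= dot u u.
  rewrite /dot (bigD1 q)//= -expr2 lerDl sumr_ge0// => r _.
  by rewrite -expr2 sqr_ge0.
have -> : M p q = u p 0.
  rewrite /u mxE (bigD1 q)//= /bvec mxE !eqxx mulr1 big1 ?addr0// => r /negPf rq.
  by rewrite mxE rq mulr0.
have d1 : dot u u <= 1 by nra.
rewrite -(@ler_pXn2r _ 2) ?nnegrE// real_normK ?num_real// expr1n.
exact: le_trans up d1.
Qed.

Lemma mx_coord_le (M : 'M[R]_d) p q : `|M p q| <= `|M|.
Proof. by rewrite [leRHS]/Num.norm /= mx_normrE; apply: le_trans (le_bigmax _ _ (p, q)). Qed.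

Lemma lipschitz_measurable (A : R -> 'M[R]_d) (L : R) p q :
  (forall s t, `|A s - A t| <= L * `|s - t|) -> measurable_fun setT (fun t => A t p q).
Proof.
move=> hA; apply: continuous_measurable_fun => t; apply/cvgrPdist_le => e e0.
have L1 : 0 < `|L| + 1 by rewrite ltr_wpDl.
apply/nbhs_ballP; exists ((`|L| + 1)^-1 * e) => /=; first by rewrite mulr_gt0// invr_gt0.
move=> s /= /ltW hs.
have h1 : `|A t p q - A s p q| <= `|A t - A s|.
  by apply: le_trans (mx_coord_le _ p q); rewrite !mxE.
apply: le_trans h1 _; apply: le_trans (hA t s) _.
apply: (@le_trans _ _ ((`|L| + 1) * `|t - s|)).
  by apply: ler_wpM2r => //; have := ler_norm L; lra.
by rewrite -ler_pdivlMl.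
Qed.

Lemma ae_countable dT (T : measurableType dT) (m : {measure set T -> \bar R})
    (I : countType) (Q : I -> T -> Prop) :
  (forall i, {ae m, forall x, Q i x}) -> {ae m, forall x, forall i, Q i x}.
Proof.
move=> H.
have h : {ae m, forall x, forall n, (fun n x => if unpickle n is Some i then Q i x else True) n x}.
  apply: ae_foralln => n; case: (unpickle n) => [i|]; first exact: H.
  exact: filterE.
by apply: filterS h => x hx i; have := hx (pickle i); rewrite pickleK.
Qed.

End coefficients.

Theorem proposition4
    (R : realType) (d : nat) (dT : measure_display) (T : measurableType dT)
    (P : probability T R)
    (lambda C0 C1 alpha0 alpha1 : R)
    (G : T -> 'cV[R]_d -> R) (A : R -> 'M[R]_d)
    (C Cs : corrector_data R d dT T)
    (eta : 'cV[R]_d -> R) (Rad : R) (n : nat) (i j : 'I_d) :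
  0 < lambda ->
  0 < alpha0 <= d%:R / 2 -> 0 < alpha1 < 1 -> 0 < C0 -> 0 < C1 ->
  gaussian_ensemble P C0 C1 alpha0 alpha1 G ->
  (forall t, elliptic lambda (A t)) ->
  (exists L : R, forall s t, `|A s - A t| <= L * `|s - t|) ->
  let a := fun w x => A (G w x) in
  let dtil := uphalf d in
  correctors P G a dtil C ->
  correctors P G (fun w x => (a w x)^T) dtil Cs ->
  0 < Rad -> Ccinfty (eball 1) eta ->
  (1 <= n <= dtil)%N ->
  let g := fun x => Rad ^- d * eta (Rad^-1 *: x) in
  {ae P, forall w,
    forall (U : ('cV[R]_d -> 'M[R]_d) -> 'cV[R]_d -> 'cV[R]_d)
           (h : 'cV[R]_d -> R) (Dh : 'cV[R]_d -> 'cV[R]_d),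
    corrector_gradient_map (a w) (grad_phi C [:: i] w) i U ->
    lax_milgram (fun x => (a w x)^T)
      (fun x => \sum_(I : n.-1.-tuple 'I_d)
         (phi Cs (j :: I) w x *: (a w x)^T - sigma Cs (j :: I) w x)
           *m grad (pderivs I g) x) h Dh ->
    functional_derivative
      (fun b => commutator (abar C [::]) (abar Cs) n i j b (U b) g)
      (a w)
      (fun x => tens (grad_phi C [:: i] w x + bvec i)
         (\sum_(0 <= k < n) \sum_(I : k.-tuple 'I_d)
            pderivs I g x *:
              (grad_phi Cs (j :: I) w x
                 + phi Cs (belast j I) w x *: bvec (last j I))
          + \sum_(I : n.-tuple 'I_d)
              pderivs I g x *: (phi Cs (belast j I) w x *: bvec (last j I))
          + Dh x))}.
Proof.
move=> lambda_gt0 /andP[alpha0_gt0 _] _ _ _ ensG ellA [L lipA] a dtil coC coCs Rad_gt0.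
move=> [seta ceta _] /andP[n_gt0 n_le] g.
have [mG gG stG cG decG _ _] := ensG.
have teta : tf eta by split=> //; apply/cptP.
have tg : tf g.
  apply: tfZ; have := tf_affine 0 (_ : Rad^-1 != 0) teta.
  rewrite invr_eq0 gt_eqF// => /(_ isT).
  by congr tf; apply/funext => x; rewrite add0r.
have mA p q : measurable_fun setT (fun t => A t p q) by exact: lipschitz_measurable lipA.
have bA t p q : `|A t p q| <= 1 by exact: elliptic_le1 (ellA t).
have dtil_gt0 : (0 < dtil)%N by exact: leq_trans n_le.
have Hab x : g x *: (abar Cs [::] *m bvec j) = g x *: ((abar C [::])^T *m bvec j).
  (* Where g does not vanish, neither does eta at the rescaled point, and this provides the
     mollifiers for [effective_transpose]. *)
  have [->|gx] := eqVneq (g x) 0; first by rewrite !scale0r.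
  apply: (congr1 ( *:%R _)); apply/colP => l.
  have e0 : eta (Rad^-1 *: x) != 0 by apply: contraNneq gx => e; rewrite /g e mulr0.
  rewrite (effective_transpose mG gG stG cG teta e0
    (fun k z => decorrelating_line z k alpha0_gt0 decG) mA bA (co_phi0 coC) (co_sigma0 coC)
    (co_phi0 coCs) (co_sigma0 coCs) (co_step (s := [::]) coC l dtil_gt0)
    (co_step (s := [::]) coCs j dtil_gt0)).
  have mb (M : 'M[R]_d) k l' : (M *m bvec k) l' 0 = M l' k.
    rewrite mxE (bigD1 k)//= /bvec mxE !eqxx mulr1 big1 ?addr0// => r /negPf rk.
    by rewrite mxE rk mulr0.
  by rewrite !mb mxE.
have stepCs s k : (size s < n)%N -> corrector_step P G (fun w x => (a w x)^T) Cs s k.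
  by move=> sn; apply: (co_step coCs); exact: leq_trans sn n_le.
(* Multi-indices are countable, so one almost sure event serves all of them; pairing s with k gives
   a single countable index. *)
have hphi : {ae P, forall w, forall sk : seq 'I_d * 'I_d, (size sk.1 < n)%N ->
    H1loc (phi Cs (rcons sk.1 sk.2) w) (grad_phi Cs (rcons sk.1 sk.2) w)}.
  apply: ae_countable => -[s k] /=; case: (ltnP (size s) n) => sn; last exact: filterE.
  by apply: filterS (cs_phi_H1loc (stepCs s k sn)).
have hsig : {ae P, forall w, forall sk : seq 'I_d * 'I_d, (size sk.1 < n)%N -> forall p q,
    H1loc (fun x => sigma Cs (rcons sk.1 sk.2) w x p q)
          (fun x => grad_sigma Cs (rcons sk.1 sk.2) w x p q)}.
  apply: ae_countable => -[s k] /=; case: (ltnP (size s) n) => sn; last exact: filterE.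
  have h : {ae P, forall w, forall p q, H1loc (fun x => sigma Cs (rcons s k) w x p q)
      (fun x => grad_sigma Cs (rcons s k) w x p q)}.
    by apply: filter_forall => p; apply: filter_forall => q; exact: cs_sigma_H1loc (stepCs s k sn) p q.
  by apply: filterS h.
have heq : {ae P, forall w, {ae lebesgue_cV d, forall x, forall s k, (size s < n)%N ->
  (\col_p \sum_(q < d) grad_sigma Cs (rcons s k) w x p q q 0) =
    (a w x)^T *m grad_phi Cs (rcons s k) w x
    + (phi Cs s w x *: (a w x)^T - sigma Cs s w x) *m bvec k - abar Cs s *m bvec k}}.
  have h : {ae P, forall w, forall sk : seq 'I_d * 'I_d, (size sk.1 < n)%N ->
    {ae lebesgue_cV d, forall x,
      (\col_p \sum_(q < d) grad_sigma Cs (rcons sk.1 sk.2) w x p q q 0) =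
      (a w x)^T *m grad_phi Cs (rcons sk.1 sk.2) w x
      + (phi Cs sk.1 w x *: (a w x)^T - sigma Cs sk.1 w x) *m bvec sk.2
      - abar Cs sk.1 *m bvec sk.2}}.
    apply: ae_countable => -[s k] /=; case: (ltnP (size s) n) => sn; last exact: filterE.
    by apply: filterS (cs_sigma_eq (stepCs s k sn)).
  apply: filterS h => w hw.
  have h : {ae lebesgue_cV d, forall x, forall sk : seq 'I_d * 'I_d, (size sk.1 < n)%N ->
      (\col_p \sum_(q < d) grad_sigma Cs (rcons sk.1 sk.2) w x p q q 0) =
      (a w x)^T *m grad_phi Cs (rcons sk.1 sk.2) w x
      + (phi Cs sk.1 w x *: (a w x)^T - sigma Cs sk.1 w x) *m bvec sk.2
      - abar Cs sk.1 *m bvec sk.2}.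
    apply: ae_countable => sk; case: (ltnP (size sk.1) n) => sn; last exact: filterE.
    by apply: filterS (hw sk sn).
  by apply: filterS h => x hx s k; exact: (hx (s, k)).
have hC : {ae P, forall w, vloc (grad_phi C [:: i] w)}.
  by apply: filterS (cs_phi_H1loc (co_step (s := [::]) coC i dtil_gt0)) => w /H1locP[].
apply: filterS (filterI hphi (filterI hsig (filterI heq hC))) => w [Hphi [Hsig [Heq vC]]] U h Dh.
have maw p q : measurable_fun setT (fun x => a w x p q).
  have m2 : measurable_fun setT (fun z : 'cV[R]_d => (w, z)) by exact: measurable_pair1.
  exact: (measurableT_comp (mA p q) (measurableT_comp mG m2)).
exact: (two_scale_functional_derivative (phi := fun s => phi Cs s w) (sig := fun s => sigma Cs s w)
  (gphi := fun s => grad_phi Cs s w) (gsig := fun s => grad_sigma Cs s w)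
  lambda_gt0 maw (fun x => bA (G w x))
  (fun x u => eq_ind _ (fun t => lambda * t <= _) (proj1 (ellA (G w x) u)) _ (enorm_sq u))
  (co_phi0 coCs w) (co_sigma0 coCs w) (fun s k => Hphi (s, k))
  (fun s k x sn => cs_sigma_skew (stepCs s k sn) w x) (fun s k => Hsig (s, k)) Heq tg n_gt0 vC Hab).
Qed.
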